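(* Let $\Omega\subset\mathbb{R}^2$, let $(\lambda,u)$ be an eigenpair of the biharmonic eigenvalue problem $$(\nabla^2 u,\nabla^2 v)_{L^2(\Omega)}=\lambda(u,v)_{L^2(\Omega)}\quad\text{for any } v\in H_0^2(\Omega),$$ and let $(\lambda_h,u_h)$, $u_h\in V_h$, be the corresponding (approximating) eigenpair of the two-dimensional rectangular Morley element discretization $$(\nabla_h^2 u_h,\nabla_h^2 v_h)_{L^2(\Omega)}=\lambda_h(u_h,v_h)_{L^2(\Omega)}\quad\text{for any } v_h\in V_h.$$ Assume that $u\in H_0^2(\Omega)\cap H^4(\Omega)$. Then $$\lambda_h\le\lambda$$ provided that $h$ is small enough.
   Context: $\nabla^2 w$ is the Hessian matrix of $w$; $\nabla_h^2$ is its piecewise counterpart, computed element by element. $\mathcal{T}_h$ is a regular uniform rectangular triangulation of $\Omega\subset\mathbb{R}^2$ with meshsize $h$: with $(x_{1,c},x_{2,c})$ the center of $K\in\mathcal{T}_h$, the map $\xi_i=(x_i-x_{i,c})/h$, $i=1,2$, sends $K$ onto $[-1,1]^2$ (so $K$ is a square of side $2h$). Rectangular Morley element in 2D: the shape function space is $P_T(K)=P_2(K)+\mathrm{span}\{x_1^3,x_2^3\}$, where $P_l(K)$ denotes the polynomials of degree $\le l$ on $K$. The nodal parameters are $v(a_i)$ at the 4 vertices $a_i$ of $K$ and $\frac1{|F_j|}\int_{F_j}\frac{\partial v}{\partial\nu_{F_j}}\,ds$ on the 4 edges $F_j$ of $K$ ($\nu_F$ a unit normal to $F$). $V_h$ is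 the set of $v\in L^2(\Omega)$ such that $v|_K\in P_T(K)$ for all $K\in\mathcal{T}_h$, $v$ is continuous at all internal vertices and vanishes at all boundary vertices, and $\int_F\frac{\partial v}{\partial\nu_F}\,ds$ is continuous across internal edges $F$ and vanishes on boundary edges $F$ of $\mathcal{T}_h$. Eigenfunctions are normalized by $\|u\|_{L^2(\Omega)}=\|u_h\|_{L^2(\Omega)}=1$. That $(\lambda_h,u_h)$ is the discrete eigenpair approximating $(\lambda,u)$ means that, as $h\to0$, the following error estimates (taken from the literature) hold with a constant $C>0$ independent of $h$: $\|u-u_h\|_{L^2(\Omega)}\le Ch^2$ and $|u-u_h|_h^2\le Ch^2$, where $|v|_h^2:=(\nabla_h^2v,\nabla_h^2v)_{L^2(\Omega)}$. *)

(* Defs.v *)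
From HB Require Import structures.
From mathcomp Require Import all_boot all_order all_algebra.
From mathcomp Require Import finmap.
From mathcomp Require Import all_classical all_reals all_analysis.
Set Implicit Arguments.
Unset Strict Implicit.
Unset Printing Implicit Defensive.
Import Order.TTheory GRing.Theory Num.Theory.
Import numFieldNormedType.Exports.
Local Open Scope classical_set_scope.
Local Open Scope ring_scope.

Section Sobolev.
Context {R : realType}.
Local Notation R2 := (R * R)%type.
(* R2 with the sigma-algebra on which the product measure lives. *)
Local Notation M2 := (measurableTypeR R * measurableTypeR R)%type.
Implicit Types (D : set R2) (f g u v phi : R2 -> R) (s : seq 'I_2).

Definition leb2 : set M2 -> \bar R :=
  (@lebesgue_measure R \x @lebesgue_measure R)%E.
HB.instance Definition _ := Measure.on leb2.

Definition ei (i : 'I_2) : R2 := if i == ord0 then (1, 0) else (0, 1).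

(* [:: i1; ...; ik] stands for the iterated derivative d_i1 (... (d_ik f)). *)
Definition pderiv s f : R2 -> R := foldr (fun i g => 'D_(ei i) g) f s.

Definition smooth f := forall s,
  continuous (pderiv s f) /\ (forall i x, derivable (pderiv s f) x (ei i)).

Definition test_function D phi :=
  [/\ smooth phi, compact (closure [set x | phi x != 0])
    & closure [set x | phi x != 0] `<=` D].

Definition inL2 D f :=
  measurable_fun (D : set M2) (f : M2 -> R) /\ leb2.-integrable D (fun x => (f x ^+ 2)%:E).

Definition dotL2 D f g : R := \int[leb2]_(x in D) (f x * g x).

Definition normL2 D f : R := Num.sqrt (dotL2 D f f).

Definition is_wderiv D s f g :=
  inL2 D g /\ forall phi, test_function D phi ->
    dotL2 D f (pderiv s phi) = (-1) ^+ size s * dotL2 D g phi.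

(* A representative of the weak derivative (unique a.e. on the open set D);
   the zero function when there is none in L^2(D). *)
Definition wderiv D s f : R2 -> R := xget (fun=> 0) [set g | is_wderiv D s f g].

Definition inH (m : nat) D f :=
  inL2 D f /\ forall s, (size s <= m)%N -> exists g, is_wderiv D s f g.

Definition normH (m : nat) D f : R :=
  Num.sqrt (\sum_(k < m.+1) \sum_(s : k.-tuple 'I_2) normL2 D (wderiv D s f) ^+ 2).

Definition inH0 (m : nat) D f :=
  inH m D f /\ forall eps : R, 0 < eps ->
    exists2 phi, test_function D phi & normH m D (f \- phi) < eps.

(* (nabla^2 f, nabla^2 g)_{L^2(D)}. *)
Definition dot_hess D f g : R :=
  \int[leb2]_(x in D) \sum_(i < 2) \sum_(j < 2)
    (wderiv D [:: i; j] f x * wderiv D [:: i; j] g x).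

Definition biharmonic_eigenpair D (lam : R) u :=
  inH0 2 D u /\
  forall v, inH0 2 D v -> dot_hess D u v = lam * dotL2 D u v.

End Sobolev.

Section Morley.
Context {R : realType}.
Local Notation R2 := (R * R)%type.
Implicit Types (h : R) (c a : R2) (D : set R2) (f g v p : R2 -> R)
  (F : 'I_2 * R2) (T : {fset R2}).

(* A square element is represented by its center c. *)
Definition elt h c : set R2 :=
  [set x | `|x.1 - c.1| <= h /\ `|x.2 - c.2| <= h].

Definition vertex h c : set R2 :=
  [set a | `|a.1 - c.1| = h /\ `|a.2 - c.2| = h].

(* An edge is the pair of the direction of its normal and its midpoint. *)
Definition edge h c : set ('I_2 * R2) :=
  [set F | F.2 = c + h *: ei F.1 \/ F.2 = c - h *: ei F.1].

Definition edge_pt F (t : R) : R2 := F.2 + t *: ei (rev_ord F.1).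

Definition edge_set h F : set R2 := edge_pt F @` `[- h, h].

Definition edge_flux h F p : R :=
  \int[@lebesgue_measure R]_(t in `[- h, h]) 'D_(ei F.1) p (edge_pt F t).

Definition boundary D : set R2 := closure D `\` D°.

(* T is the set of centers; the elements of a mesh meet in nothing, in a common
   vertex or in a common edge. *)
Definition uniform_mesh D h T :=
  [/\ 0 < h,
      D = (\bigcup_(c in [set` T]) elt h c)° &
      forall c c', c \in T -> c' \in T -> c != c' ->
        [\/ elt h c `&` elt h c' = set0,
            exists2 a, (vertex h c `&` vertex h c') a &
              elt h c `&` elt h c' = [set a]
          | exists2 F, (edge h c `&` edge h c') F &
              elt h c `&` elt h c' = edge_set h F]].

Definition P_ (l : nat) p :=
  exists b : nat -> nat -> R, forall x,
    p x = \sum_(i < l.+1) \sum_(j < l.+1 | (i + j <= l)%N) b i j * x.1 ^+ i * x.2 ^+ j.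

Definition P_T p :=
  exists2 q, P_ 2 q &
    exists b : R * R, forall x, p x = q x + b.1 * x.1 ^+ 3 + b.2 * x.2 ^+ 3.

(* p c is the polynomial v|_K on the element K with center c.  An edge common
   to two elements is internal; the normals on it are both taken to be ei F.1. *)
Definition V_h D h T v :=
  inL2 D v /\ exists p : R2 -> R2 -> R,
  [/\ forall c, c \in T ->
        P_T (p c) /\ {ae leb2, forall x, elt h c x -> v x = p c x},
      forall c c' a, c \in T -> c' \in T -> vertex h c a -> vertex h c' a ->
        D a -> p c a = p c' a,
      forall c a, c \in T -> vertex h c a -> boundary D a -> p c a = 0,
      forall c c' F, c \in T -> c' \in T -> edge h c F -> edge h c' F ->
        edge_flux h F (p c) = edge_flux h F (p c')
    & forall c F, c \in T -> edge h c F -> edge_set h F `<=` boundary D ->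
        edge_flux h F (p c) = 0].

(* The Hessian is taken on each open element separately, so that f and g need
   only be in H^2 of each element. *)
Definition dot_hess_h h T f g : R :=
  \sum_(c <- T) dot_hess (elt h c)° f g.

Definition Morley_eigenpair D h T (lam : R) v :=
  V_h D h T v /\
  forall w, V_h D h T w -> dot_hess_h h T v w = lam * dotL2 D v w.

End Morley.

(* Main.v *)
Require Import Defs.
From HB Require Import structures.
From mathcomp Require Import all_boot all_order all_algebra.
From mathcomp Require Import finmap.
From mathcomp Require Import all_classical all_reals all_analysis.
From mathcomp Require Import measurable_realfun.
From mathcomp Require Import ring lra.
Set Implicit Arguments.
Unset Strict Implicit.
Unset Printing Implicit Defensive.
Import Order.TTheory GRing.Theory Num.Theory.
Import numFieldNormedType.Exports.
Local Open Scope classical_set_scope.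
Local Open Scope ring_scope.

(** Let j denote the direction other than i, K a cell of half-width h, xi_i
the i-th coordinate relative to its centre, and N = 4h^4/3 the integral of
xi_i^2 over K.  For the eigenfunction u let a_i be the integral over K of
xi_i d_ii u, and q_i that of xi_j d_ij u.  The claim follows from

  lam - lam_h >= (2/N) sum_i sum_K a_i q_i + o(h^2)

and from the fact that sum_K a_i q_i >= c h^6 with c > 0: the right-hand side
is then at least of order h^2 and positive for small h.

The inequality.  Expanding the square gives
|u - u_h|_h^2 = lam + lam_h - 2X, where X is the sum over the cells of the
integrals of Hess u : Hess u_h ([hess_expand]).  On K the shape functions make
d_ij u_h constant and d_ii u_h = al + A_i xi_i.  Hence, by Bessel's inequality
for the functions 1 and xi ([bessel]), |u - u_h|_h^2 is at least the sum of
((a_i - A_i N)^2 + q_i^2)/N.  On the other hand let phi be a test function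
close to u, and interpolate it in V_h by its vertex values and edge fluxes.
Green's formula shows that the second derivatives of the interpolation error
have mean zero on K, but that the xi_i-moment of its ii-derivative is the
xi_j-moment of d_ij phi ([interp_mean], [interp_mom]).  So
testing the discrete equation with the interpolant and letting phi tend to u
yields X = lam_h (u, u_h) + sum A_i q_i + lam_h o(h^2) ([consistency]), the
remainder being the L2 interpolation error.  Since
(u, u_h) = 1 - |u - u_h|^2/2 = 1 + O(h^4), combining both facts leaves the sum
of (a_i - A_i N - q_i)^2/N >= 0 plus the sum of 2 a_i q_i/N ([bessel_sum],
[eigenvalue_gap]).

The lower bound ([moments_lower]).  The moment q_i is a difference of two edge
functionals, each close to (2h^3/3) d_jj u.  Summing by parts over the mesh
moves the difference onto the moments m_i(f) of a function f, whose jumps are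
integrals of d_ii f against a kernel.  This gives
sum_K m_i(f) q_i = -(4h^6/9) (d_jj u, d_ii f) + o(h^6)
([moment_product_limit]).  With f = d_ii u the main term contains
(d_jj u, d_iiii u) = (d_ii u, d_iijj u), because u is in H^2_0 ([U_fourth]), and
the same main term arises for direction j and f = d_ii u.  Up to o(h^6), then,
sum a_i q_i is the sum of the products of m_j(d_ii u) and q_j, and these two
numbers differ by O(h^8) in the sense of sums of squares, since both are h^2/3
times the integral of d_iij u ([sum_mom_diff]).  So sum a_i q_i is at least
half the sum of the q_j^2, up to o(h^6).  Finally f = u in direction j gives
sum m_j(u) q_j = -(4h^6/9) (d_ii u, d_jj u) + o(h^6), where
(d_ii u, d_jj u) = |d_ij u|^2 > 0 by Poincare's inequality ([U_mixed],
[U_mixed_gt0]), while sum m_j(u)^2 = O(h^6); hence the sum of the q_j^2 is at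
least c h^6. *)

(** * Smooth functions on the plane *)

Section Smooth.
Context {R : realType}.
Local Notation R2 := (R * R)%type.
Implicit Types (f g : R2 -> R) (i j : 'I_2) (s : seq 'I_2) (x m : R2).

Definition co i x : R := if i == ord0 then x.1 else x.2.

Lemma ord2P i : i = ord0 \/ i = ord_max.
Proof. by case: i => -[|[|//]] p; [left|right]; apply/val_inj. Qed.

Lemma rev_ord2 : (rev_ord (ord0 : 'I_2) = ord_max) * (rev_ord (ord_max : 'I_2) = ord0).
Proof. by split; apply/val_inj. Qed.

Lemma co_ei i : co i (ei i : R2) = 1.
Proof. by case: (ord2P i) => ->; rewrite /co /ei. Qed.

Lemma co_ei_rev i : co i (ei (rev_ord i) : R2) = 0.
Proof. by case: (ord2P i) => ->; rewrite rev_ord2 /co /ei. Qed.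

Lemma co_rev_ei i : co (rev_ord i) (ei i : R2) = 0.
Proof. by case: (ord2P i) => ->; rewrite rev_ord2 /co /ei. Qed.

Lemma coD i x y : co i (x + y) = co i x + co i y.
Proof. by rewrite /co; case: ifP. Qed.

Lemma coB i x y : co i (x - y) = co i x - co i y.
Proof. by rewrite /co; case: ifP. Qed.

Lemma coN i x : co i (- x) = - co i x.
Proof. by rewrite /co; case: ifP. Qed.

Lemma coZ i t x : co i (t *: x) = t * co i x.
Proof. by rewrite /co; case: ifP. Qed.

Definition coE := (coD, coN, coZ, co_ei, co_ei_rev, co_rev_ei, @rev_ordK 2).

Lemma co_split i x : x = co i x *: ei i + co (rev_ord i) x *: ei (rev_ord i).
Proof.
case: x => a b; case: (ord2P i) => ->; rewrite rev_ord2 /co /ei /=;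
by apply: injective_projections; rewrite /= /GRing.scale /= ?mulr1 ?mulr0 ?addr0 ?add0r.
Qed.

Lemma co_inj i x y : co i x = co i y -> co (rev_ord i) x = co (rev_ord i) y -> x = y.
Proof. by move=> h1 h2; rewrite (co_split i x) (co_split i y) h1 h2. Qed.

Lemma co_continuous i : continuous (co i).
Proof. by case: (ord2P i) => -> x; [exact: cvg_fst|exact: cvg_snd]. Qed.

Lemma smooth_continuous f : smooth f -> continuous f.
Proof. by move=> /(_ [::]) []. Qed.

Lemma smooth_derivable f i x : smooth f -> derivable f x (ei i).
Proof. by move=> /(_ [::]) [_]; apply. Qed.

Lemma pderiv_cat s s' f : pderiv (s ++ s') f = pderiv s (pderiv s' f).
Proof. by rewrite /pderiv foldr_cat. Qed.

Lemma pderiv_rcons s i f : pderiv (rcons s i) f = pderiv s ('D_(ei i) f).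
Proof. by rewrite -cats1 pderiv_cat. Qed.

Lemma smooth_pderiv s f : smooth f -> smooth (pderiv s f).
Proof. by move=> sf s'; rewrite -pderiv_cat; exact: sf. Qed.

Lemma smooth_D i f : smooth f -> smooth ('D_(ei i) f).
Proof. exact: (@smooth_pderiv [:: i]). Qed.

(** Since [smooth] speaks of all iterated derivatives it is a greatest fixed
point: it contains every class of continuous, partially differentiable functions
that both partial derivatives preserve. *)
Lemma smooth_coind (P : (R2 -> R) -> Prop) :
  (forall f, P f -> [/\ continuous f, forall i x, derivable f x (ei i)
     & forall i, P ('D_(ei i) f)]) -> forall f, P f -> smooth f.
Proof.
move=> HP f Pf s; suff : P (pderiv s f) by move=> /HP[].
by elim: s => //= i s /HP[].
Qed.

(** Differentiating a product produces sums of products, so neither sums nor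
products of smooth functions alone form a class to which [smooth_coind] applies;
the algebra they generate does. *)
Inductive alg : (R2 -> R) -> Prop :=
| alg_base f : smooth f -> alg f
| alg_add f g : alg f -> alg g -> alg (f + g)
| alg_mul f g : alg f -> alg g -> alg (f * g).

Lemma alg_smooth f : alg f -> smooth f.
Proof.
apply: smooth_coind => {}f; elim => {f}[f sf|f g _ [cf df af] _ [cg dg ag]|f g fa [cf df af] ga [cg dg ag]].
- split; [exact: smooth_continuous|by move=> ??; exact: smooth_derivable|].
  by move=> i; apply: alg_base; exact: smooth_D.
- split; first by move=> x; apply: cvgD; [exact: cf|exact: cg].
    by move=> i x; apply: derivableD.
  move=> i; rewrite (_ : 'D_(ei i) (f + g) = 'D_(ei i) f + 'D_(ei i) g); first exact: alg_add.
  by apply/funext => x; rewrite deriveD.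
- split; first by move=> x; apply: cvgM; [exact: cf|exact: cg].
    by move=> i x; apply: derivableM.
  move=> i; rewrite (_ : 'D_(ei i) (f * g) = f * 'D_(ei i) g + g * 'D_(ei i) f).
    by apply: alg_add; apply: alg_mul.
  by apply/funext => x; rewrite deriveM.
Qed.

Lemma smooth_add f g : smooth f -> smooth g -> smooth (fun x => f x + g x).
Proof. by move=> sf sg; apply: alg_smooth; apply: alg_add; apply: alg_base. Qed.

Lemma smooth_mul f g : smooth f -> smooth g -> smooth (fun x => f x * g x).
Proof. by move=> sf sg; apply: alg_smooth; apply: alg_mul; apply: alg_base. Qed.

Lemma smooth_cst a : smooth (fun _ : R2 => a).
Proof.
apply: (@smooth_coind (fun f => exists a, f = fun=> a)); last by exists a.
move=> f [{}a ->]; split; first by move=> x; exact: cvg_cst.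
  by move=> i x; exact: derivable_cst.
by move=> i; exists 0; apply/funext => x; rewrite derive_cst.
Qed.

Lemma smooth_scale a f : smooth f -> smooth (fun x => a * f x).
Proof. by move=> sf; apply: smooth_mul => //; exact: smooth_cst. Qed.

Lemma smooth_opp f : smooth f -> smooth (fun x => - f x).
Proof.
move=> /(smooth_scale (-1)); congr smooth; apply/funext => x.
by rewrite mulN1r.
Qed.

Lemma smooth_sub f g : smooth f -> smooth g -> smooth (fun x => f x - g x).
Proof. by move=> sf /smooth_opp; exact: smooth_add. Qed.

Lemma is_derive_lin (l : R2 -> R) v x :
  (forall t y, l (t *: y + x) = t * l y + l x) -> is_derive x v l (l v).
Proof.
move=> hl.
have E : (fun t : R => t^-1 *: (l (t *: v + x) - l x)) = fun t => t^-1 * (t * l v).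
  by apply/funext => t; rewrite hl addrK.
have C : t^-1 * (t * l v) @[t --> (0:R)^'] --> l v.
  apply/cvgrPdist_lt => e e0; near=> t.
  by rewrite mulrA mulVf ?mul1r ?subrr ?normr0//; near: t; exact: nbhs_dnbhs_neq.
apply: DeriveDef; last by rewrite /derive /= E; apply: cvg_lim.
by rewrite /derivable /= E; apply/cvg_ex; exists (l v).
Unshelve. all: by end_near. Qed.

Lemma is_derive_co i v x : is_derive x v (co i) (co i v).
Proof. by apply: is_derive_lin => t y; rewrite coD coZ. Qed.

Lemma smooth_co i : smooth (co i).
Proof.
apply: (@smooth_coind (fun f => f = co i \/ exists a, f = fun=> a)); last by left.
move=> f [->|[a ->]]; split.
- exact: co_continuous.
- by move=> k x; have [] := is_derive_co i (ei k) x.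
- move=> k; right; exists (co i (ei k)); apply/funext => x.
  by have [_ ->] := is_derive_co i (ei k) x.
- by move=> x; exact: cvg_cst.
- by move=> k x; exact: derivable_cst.
- by move=> k; right; exists 0; apply/funext => x; rewrite derive_cst.
Qed.

Lemma smooth_coc i m : smooth (fun x => co i (x - m)).
Proof.
under eq_fun do rewrite coB.
by apply: smooth_sub; [exact: smooth_co|exact: smooth_cst].
Qed.

Lemma smooth_exp n f : smooth f -> smooth (fun x => f x ^+ n).
Proof.
move=> sf; elim: n => [|n IH]; first by under eq_fun do rewrite expr0; exact: smooth_cst.
by under eq_fun do rewrite exprS; exact: smooth_mul.
Qed.

Lemma pdD i f g x : smooth f -> smooth g ->
  'D_(ei i) (fun y => f y + g y) x = 'D_(ei i) f x + 'D_(ei i) g x.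
Proof. by move=> sf sg; rewrite (@deriveD _ _ _ f g)//; exact: smooth_derivable. Qed.

Lemma pdB i f g x : smooth f -> smooth g ->
  'D_(ei i) (fun y => f y - g y) x = 'D_(ei i) f x - 'D_(ei i) g x.
Proof. by move=> sf sg; rewrite (@deriveB _ _ _ f g)//; exact: smooth_derivable. Qed.

Lemma pdM i f g x : smooth f -> smooth g ->
  'D_(ei i) (fun y => f y * g y) x = f x * 'D_(ei i) g x + g x * 'D_(ei i) f x.
Proof. by move=> sf sg; rewrite (@deriveM _ _ f g)//; exact: smooth_derivable. Qed.

Lemma pdZ i a f x : smooth f ->
  'D_(ei i) (fun y => a * f y) x = a * 'D_(ei i) f x.
Proof.
by move=> sf; rewrite (@pdM i (fun=> a) f)//; [rewrite derive_cst mulr0 addr0|exact: smooth_cst].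
Qed.

Lemma pd_cst i (a : R) x : 'D_(ei i) (fun _ : R2 => a) x = 0.
Proof. by rewrite derive_cst. Qed.

Lemma pd_coc i k m x : 'D_(ei i) (fun y => co k (y - m)) x = (i == k)%:R.
Proof.
have -> : (fun y => co k (y - m)) = (fun y => co k y - co k m).
  by apply/funext => y; rewrite coB.
rewrite pdB ?pd_cst ?subr0; [|exact: smooth_co|exact: smooth_cst].
have [_ ->] := is_derive_co k (ei i) x.
by case: (ord2P i) => ->; case: (ord2P k) => ->; rewrite /co /ei.
Qed.

Lemma smooth_line f i x t : smooth f ->
  is_derive t (1:R) (fun t : R => f (x + t *: ei i)) ('D_(ei i) f (x + t *: ei i)).
Proof.
move=> sf; have := @smooth_derivable f i (x + t *: ei i) sf.
have E : (fun h : R => h^-1 *: (((fun t0 : R => f (x + t0 *: ei i)) \o shift t) (h *: 1) - f (x + t *: ei i)))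
  = (fun h : R => h^-1 *: ((f \o shift (x + t *: ei i)) (h *: ei i) - f (x + t *: ei i))).
  apply/funext => h /=; congr (_ *: (f _ - _)).
  by rewrite scalerDl /GRing.scale /= mulr1 addrCA.
move=> D; apply: DeriveDef.
  by rewrite /derivable E; exact: D.
by rewrite /derive; congr (lim _); rewrite -/(fmap _ _) E.
Qed.

Lemma line_continuous f i x : continuous f -> continuous (fun t : R => f (x + t *: ei i)).
Proof.
move=> cf t; apply: (@continuous_comp _ _ _ (fun t : R => x + t *: ei i) f); last exact: cf.
by apply: cvgD; [exact: cvg_cst|apply: cvgZr_tmp; exact: cvg_id].
Qed.

End Smooth.

(** * Integration over rectangles *)

Section Measure2.
Context {R : realType}.
Local Notation R2 := (R * R)%type.
Local Notation M2 := (measurableTypeR R * measurableTypeR R)%type.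
Local Notation leb := (@lebesgue_measure R).
Implicit Types (f g : R2 -> R) (i j : 'I_2) (x m : R2) (D : set R2).

Definition I2 D f : R := \int[@leb2 R]_(x in (D : set M2)) f x.
Definition itg D f : Prop := (@leb2 R).-integrable (D : set M2) (EFin \o (f : M2 -> R)).
Definition meas D : Prop := measurable (D : set M2).

(** The direction i is a parameter so that a statement for one direction gives
the other one by instantiation. *)
Definition rect i (r s : R) m : set R2 :=
  [set x | `|co i (x - m)| < r /\ `|co (rev_ord i) (x - m)| < s].

Lemma rect_rev i r s m : rect (rev_ord i) s r m = rect i r s m.
Proof. by rewrite /rect rev_ordK; apply/seteqP; split => x [? ?]. Qed.

Lemma rect0 r s m : rect ord0 r s m =
  `]m.1 - r, m.1 + r[%classic `*` `]m.2 - s, m.2 + s[%classic.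
Proof.
apply/seteqP; split => -[a b]; rewrite /rect rev_ord2 /co /= !in_itv /= !ltr_norml.
  by move=> [/andP[? ?] /andP[? ?]]; split; apply/andP; split; lra.
by move=> [/andP[? ?] /andP[? ?]]; split; apply/andP; split; lra.
Qed.

Lemma rect_open i r s m : open (rect i r s m).
Proof.
have E k (t : R) : open [set x : R2 | `|co k (x - m)| < t].
  apply: (@open_comp _ _ (fun x : R2 => `|co k (x - m)|) [set u | u < t]); last exact: open_lt.
  move=> x _; apply: (@continuous_comp _ _ _ (fun x : R2 => co k (x - m)) (@Num.norm _ R)); last exact: norm_continuous.
  exact/smooth_continuous/smooth_coc.
rewrite (_ : rect _ _ _ _ = [set x | `|co i (x - m)| < r] `&` [set x | `|co (rev_ord i) (x - m)| < s])//.
exact: openI.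
Qed.

(** The sigma-algebra is generated by products of Borel sets of the line, so an
open set has to be written as a countable union of rational boxes. *)
Lemma open_meas D : open D -> meas D.
Proof.
move=> oD.
pose B (q : (rat * rat) * (rat * rat)) : set R2 :=
  `]ratr q.1.1, ratr q.1.2[%classic `*` `]ratr q.2.1, ratr q.2.2[%classic.
have -> : D = \bigcup_(q in [set q | B q `<=` D]) B q.
  apply/seteqP; split; last by move=> x [q /= qD] /qD.
  move=> [a b] Dab.
  have [e /= e0 eD] : exists2 e : R, 0 < e & ball (a, b) e `<=` D.
    by apply/nbhs_ballP; move: oD; rewrite openE => /(_ _ Dab).
  have [q1] := @rat_in_itvoo R (a - e) a ltac:(lra).
  have [q2] := @rat_in_itvoo R a (a + e) ltac:(lra).
  have [q3] := @rat_in_itvoo R (b - e) b ltac:(lra).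
  have [q4] := @rat_in_itvoo R b (b + e) ltac:(lra).
  rewrite !in_itv /= => /andP[? ?] /andP[? ?] /andP[? ?] /andP[? ?].
  exists ((q1, q2), (q3, q4)) => /=; last by split; rewrite /= in_itv /=; apply/andP; split; lra.
  move=> [u v] [/=]; rewrite !in_itv /= => /andP[? ?] /andP[? ?].
  by apply: eD; split; rewrite /ball /= ltr_norml; apply/andP; split; lra.
rewrite /meas bigcup_mkcond.
apply: countable_bigcupT_measurable; first exact: countableP.
move=> q; case: ifPn => // _.
apply: measurableX; exact: measurable_itv.
Qed.

Lemma continuous_meas2 f : continuous f -> measurable_fun setT (f : M2 -> R).
Proof.
move=> /continuousP cf; apply: (measurability _ (measurable_realfun.RGenOpens.measurableE R)).
move=> _ [_ [a [b ->] <-]]; rewrite setTI.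
by apply: open_meas; apply: cf; exact: interval_open.
Qed.

Lemma rect_meas i r s m : meas (rect i r s m).
Proof. by apply: open_meas; exact: rect_open. Qed.

Lemma leb2X (A B : set R) : measurable (A : set (measurableTypeR R)) ->
  measurable (B : set (measurableTypeR R)) ->
  (@leb2 R (A `*` B) = leb A * leb B)%E.
Proof. by move=> mA mB; rewrite /leb2 product_measure1E. Qed.

Lemma rect_fin i r s m : (@leb2 R (rect i r s m) < +oo)%E.
Proof.
wlog -> : i r s / i = ord0.
  move=> H; case: (ord2P i) => [|E]; first exact: H.
  by rewrite -(rect_rev i) E rev_ord2; exact: H.
by rewrite rect0 leb2X//= !lebesgue_measure_itv /= !lte_fin; do 2 case: ifP => _;
   rewrite -?EFinB -?EFinM ?mule0 ?mul0e ltry.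
Qed.

Lemma bounded_rect i (r s : R) m f : continuous f -> exists2 M : R, 0 < M &
  forall x, `|co i (x - m)| <= r -> `|co (rev_ord i) (x - m)| <= s -> `|f x| <= M.
Proof.
move=> cf.
wlog -> : i r s / i = ord0.
  move=> H; case: (ord2P i) => [|E]; first exact: H.
  have [M M0 HM] := H ord0 s r erefl.
  by exists M => //; rewrite E rev_ord2 => x h1 h2; apply: HM; rewrite ?rev_ord2.
have cK : compact (`[m.1 - r, m.1 + r]%classic `*` `[m.2 - s, m.2 + s]%classic : set R2).
  by apply: compact_setX; exact: segment_compact.
have := continuous_compact (continuous_subspaceT cf) cK.
move=> /compact_bounded[M [_ HM]].
exists (`|M| + 1) => [|x]; first by rewrite ltr_pwDr.
rewrite rev_ord2 /co /= !ler_norml => /andP[? ?] /andP[? ?].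
have lt : M < `|M| + 1 by rewrite (le_lt_trans (ler_norm M))// ltrDl.
have xK : (`[m.1 - r, m.1 + r]%classic `*` `[m.2 - s, m.2 + s]%classic) x.
  by split; rewrite /= in_itv /=; apply/andP; split; lra.
have xi : (f @` (`[m.1 - r, m.1 + r]%classic `*` `[m.2 - s, m.2 + s]%classic)) (f x) by exists x.
have H := HM _ lt (f x) xi.
by rewrite -ler_norml; exact: H.
Qed.

Lemma itg_cont i r s m f : continuous f -> itg (rect i r s m) f.
Proof.
move=> cf; apply: measurable_bounded_integrable.
- exact: rect_meas.
- exact: rect_fin.
- by apply: measurable_funTS; exact: continuous_meas2.
- have [M M0 HM] := bounded_rect i r s m cf.
  exists M; split; first by rewrite num_real.
  by move=> N MN x [/ltW h1 /ltW h2]; apply: le_trans (HM x h1 h2) (ltW MN).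
Qed.

Lemma itg1_cont (a b : R) (g : R -> R) : continuous g ->
  leb.-integrable (`[a, b]%classic : set (measurableTypeR R)) (EFin \o g).
Proof.
move=> cg; apply: (@continuous_compact_integrable R); first exact: segment_compact.
exact: continuous_subspaceT.
Qed.

Lemma itg1o_cont (a b : R) (g : R -> R) : continuous g ->
  leb.-integrable (`]a, b[%classic : set (measurableTypeR R)) (EFin \o g).
Proof.
move=> cg; apply: (integrableS _ _ _ (itg1_cont a b cg)) => //.
exact: subset_itv_oo_cc.
Qed.

Lemma I1_oo_cc (a b : R) (g : R -> R) : continuous g ->
  \int[leb]_(t in `]a, b[) g t = \int[leb]_(t in `[a, b]) g t.
Proof.
move=> cg; rewrite -(Rintegral_itv_obnd_cbnd (r := a)); last first.
  by apply: (integrableS _ _ _ (itg1_cont a b cg)) => //; exact: subset_itv_oc_cc.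
rewrite -Rintegral_itv_bndo_bndc //; exact: itg1o_cont.
Qed.

Lemma I1_shift (s m : R) (g : R -> R) : 0 < s -> continuous g ->
  \int[leb]_(t in `[m - s, m + s]) g t = \int[leb]_(t in `[- s, s]) g (m + t).
Proof.
move=> s0 cg; rewrite /Rintegral; congr fine.
have D : forall t : R, is_derive t (1:R) (fun t : R => m + t) 1.
  move=> t; rewrite (_ : (fun t : R => m + t) = cst m + id)//; apply: is_derive_eq.
  by rewrite add0r.
have D1 : (derive1 (fun t : R => m + t) = fun=> 1).
  by apply/funext => t; rewrite derive1E; have [_ ->] := D t.
have E := @integration_by_substitution_increasing R (fun t => m + t) g (- s) s.
rewrite E; first last.
- exact: continuous_subspaceT.
- split; first by move=> t _; have [] := D t.
  + by apply: cvg_at_right_filter; apply: cvgD; [exact: cvg_cst|exact: cvg_id].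
  + by apply: cvg_at_left_filter; apply: cvgD; [exact: cvg_cst|exact: cvg_id].
- by rewrite D1; exact: is_cvg_cst.
- by rewrite D1; exact: is_cvg_cst.
- by rewrite D1 => t _; exact: cvg_cst.
- by move=> a b _ _ ab; rewrite ltrD2l.
- by lra.
by apply: eq_integral => t _; rewrite /= D1 fctE mulr1.
Qed.

Lemma int_derive (a b : R) (G g : R -> R) : a < b -> continuous g ->
  (forall t, is_derive t (1:R) G (g t)) ->
  \int[leb]_(t in `[a, b]) g t = G b - G a.
Proof.
move=> ab cg dG; rewrite /Rintegral (@continuous_FTC2 _ g G)//.
- exact: continuous_subspaceT.
- have cG : continuous G.
    by move=> t; apply/differentiable_continuous/derivable1_diffP; have [] := dG t.
  split; first by move=> t _; have [] := dG t.
  + by apply: cvg_at_right_filter; exact: cG.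
  + by apply: cvg_at_left_filter; exact: cG.
- by move=> t _; rewrite derive1E; have [_ ->] := dG t.
Qed.

(** The product measure theorem concerns integrals over the whole plane; the box
enters through extension by zero. *)
Lemma fubini_12 (A B : set R) f : continuous f ->
  measurable (A : set (measurableTypeR R)) -> measurable (B : set (measurableTypeR R)) ->
  (forall a, leb.-integrable (B : set (measurableTypeR R)) (EFin \o (fun b => f (a, b)))) ->
  itg (A `*` B) f ->
  I2 (A `*` B) f = \int[leb]_(a in A) \int[leb]_(b in B) f (a, b).
Proof.
move=> cf mA mB iB iAB; rewrite /I2 /Rintegral; congr fine.
rewrite [LHS]integral_mkcond /leb2.
rewrite -integral12_prod_meas1; last first.
  move: iAB => /(integrable_mkcond _ _) ; apply; exact: measurableX.
rewrite [RHS]integral_mkcond; apply: eq_integral => a _.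
rewrite /fubini_F patchE; case: ifPn => aA.
  rewrite fineK; last exact: integrable_fin_num (iB a).
  rewrite [RHS]integral_mkcond; apply: eq_integral => b _.
  rewrite !patchE; congr (if _ then _ else _).
  by rewrite in_setX aA.
rewrite integral0_eq// => b _; rewrite patchE ifF//.
by rewrite in_setX (negbTE aA).
Qed.

Lemma fubini_21 (A B : set R) f : continuous f ->
  measurable (A : set (measurableTypeR R)) -> measurable (B : set (measurableTypeR R)) ->
  (forall b, leb.-integrable (A : set (measurableTypeR R)) (EFin \o (fun a => f (a, b)))) ->
  itg (A `*` B) f ->
  I2 (A `*` B) f = \int[leb]_(b in B) \int[leb]_(a in A) f (a, b).
Proof.
move=> cf mA mB iA iAB; rewrite /I2 /Rintegral; congr fine.
rewrite [LHS]integral_mkcond /leb2.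
rewrite -integral21_prod_meas1; last first.
  move: iAB => /(integrable_mkcond _ _) ; apply; exact: measurableX.
rewrite [RHS]integral_mkcond; apply: eq_integral => b _.
rewrite /fubini_G patchE; case: ifPn => bB.
  rewrite fineK; last exact: integrable_fin_num (iA b).
  rewrite [RHS]integral_mkcond; apply: eq_integral => a _.
  rewrite !patchE; congr (if _ then _ else _).
  by rewrite in_setX bB andbT.
rewrite integral0_eq// => a _; rewrite patchE ifF//.
by rewrite in_setX (negbTE bB) andbF.
Qed.

Lemma int_fubini_12 (A B : set R) f :
  measurable (A : set (measurableTypeR R)) -> measurable (B : set (measurableTypeR R)) ->
  (forall a, leb.-integrable (B : set (measurableTypeR R)) (EFin \o (fun b => f (a, b)))) ->
  itg (A `*` B) f ->
  leb.-integrable (A : set (measurableTypeR R)) (EFin \o (fun a => \int[leb]_(b in B) f (a, b))).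
Proof.
move=> mA mB iB iAB; apply/(integrable_mkcond _ mA).
have /(integrable_mkcond _ (measurableX mA mB)) := iAB.
move=> /(@integrable_fubini_F _ _ _ _ R leb leb).
apply: eq_integrable => // a _.
rewrite /fubini_F patchE /=; case: ifPn => aA.
  rewrite fineK; last exact: integrable_fin_num (iB a).
  rewrite [RHS]integral_mkcond; apply: eq_integral => b _.
  rewrite !patchE; congr (if _ then _ else _).
  by rewrite in_setX aA.
rewrite integral0_eq// => b _; rewrite patchE ifF//.
by rewrite in_setX (negbTE aA).
Qed.

(** Integrability follows from Tonelli's theorem for the absolute value. *)
Lemma int_fubini_21 (A B : set R) f :
  measurable (A : set (measurableTypeR R)) -> measurable (B : set (measurableTypeR R)) ->
  (forall b, leb.-integrable (A : set (measurableTypeR R)) (EFin \o (fun a => f (a, b)))) ->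
  itg (A `*` B) f ->
  leb.-integrable (B : set (measurableTypeR R)) (EFin \o (fun b => \int[leb]_(a in A) f (a, b))).
Proof.
move=> mA mB iA iAB; apply/(integrable_mkcond _ mB).
have /(integrable_mkcond _ (measurableX mA mB)) := iAB.
move=> ifm.
have mf := measurable_int _ ifm.
have : leb.-integrable setT (fubini_G leb ((EFin \o f) \_ (A `*` B))).
  apply/integrableP; split; first exact: (measurable_fubini_G ifm).
  apply: le_lt_trans ((integrable21ltyP leb leb mf).1 ifm).
  apply: ge0_le_integral => //.
  all: try solve [by move=> b _; apply: integral_ge0].
  all: try solve [by apply: measurableT_comp => //; exact: (measurable_fubini_G ifm)].
  - have ma : measurable_fun (setT : set M2) (abse \o ((EFin \o f) \_ (A `*` B))) by exact: measurableT_comp.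
    have H := @measurable_fun_fubini_tonelli_G _ _ _ _ R leb _ ma (fun z => abse_ge0 _).
    exact: H.
  - move=> b _; apply: le_abse_integral => //.
    by apply: measurableT_comp => //; exact: measurable_pair2.
apply: eq_integrable => // b _.
rewrite /fubini_G patchE /=; case: ifPn => bB.
  rewrite fineK; last exact: integrable_fin_num (iA b).
  rewrite [RHS]integral_mkcond; apply: eq_integral => a _.
  rewrite !patchE; congr (if _ then _ else _).
  by rewrite in_setX bB andbT.
rewrite integral0_eq// => a _; rewrite patchE ifF//.
by rewrite in_setX (negbTE bB) andbF.
Qed.

Definition pt i (a b : R) : R2 := a *: ei i + b *: ei (rev_ord i).

Lemma pt0 a b : pt ord0 a b = (a, b).
Proof. by rewrite /pt rev_ord2 /ei; apply: injective_projections; rewrite /= /GRing.scale /= ?mulr1 ?mulr0 ?addr0 ?add0r. Qed.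

Lemma pt1 a b : pt ord_max a b = (b, a).
Proof. by rewrite /pt rev_ord2 /ei; apply: injective_projections; rewrite /= /GRing.scale /= ?mulr1 ?mulr0 ?addr0 ?add0r. Qed.

Lemma continuous_pair1 f (a : R) : continuous f -> continuous (fun b : R => f (a, b)).
Proof.
move=> cf; rewrite (_ : (fun b => _) = fun b => f ((a, 0) + b *: ei ord_max)).
  exact: line_continuous.
by apply/funext => b; congr f; apply: injective_projections; rewrite /= /GRing.scale /= ?mulr1 ?mulr0 ?addr0 ?add0r.
Qed.

Lemma continuous_pair2 f (b : R) : continuous f -> continuous (fun a : R => f (a, b)).
Proof.
move=> cf; rewrite (_ : (fun a => _) = fun a => f ((0, b) + a *: ei ord0)).
  exact: line_continuous.
by apply/funext => a; congr f; apply: injective_projections; rewrite /= /GRing.scale /= ?mulr1 ?mulr0 ?addr0 ?add0r.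
Qed.

Lemma fubini_rect i (r s : R) m f : continuous f ->
  I2 (rect i r s m) f =
    \int[leb]_(b in `]co (rev_ord i) m - s, co (rev_ord i) m + s[)
    \int[leb]_(a in `]co i m - r, co i m + r[) f (pt i a b)
  /\ leb.-integrable (`]co (rev_ord i) m - s, co (rev_ord i) m + s[%classic : set (measurableTypeR R))
    (EFin \o (fun b => \int[leb]_(a in `]co i m - r, co i m + r[) f (pt i a b))).
Proof.
move=> cf; case: (ord2P i) => ->.
  under eq_Rintegral do under eq_Rintegral do rewrite pt0.
  rewrite (_ : (fun b => \int[leb]_(a in _) _) = (fun b => \int[leb]_(a in `]co ord0 m - r, co ord0 m + r[) f (a, b))); last first.
    by apply/funext => b; under eq_Rintegral do rewrite pt0.
  rewrite rev_ord2 rect0 /co /=.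
  have iA b : leb.-integrable (`]m.1 - r, m.1 + r[%classic : set (measurableTypeR R)) (EFin \o (fun a => f (a, b))).
    by apply: itg1o_cont; exact: continuous_pair2.
  have := @itg_cont ord0 r s m f cf; rewrite rect0 => iAB.
  by split; [rewrite fubini_21|apply: int_fubini_21].
under eq_Rintegral do under eq_Rintegral do rewrite pt1.
rewrite (_ : (fun b => \int[leb]_(a in _) _) = (fun b => \int[leb]_(a in `]co ord_max m - r, co ord_max m + r[) f (b, a))); last first.
    by apply/funext => b; under eq_Rintegral do rewrite pt1.
rewrite -rect_rev rev_ord2 rect0 /co /=.
have iB a : leb.-integrable (`]m.2 - r, m.2 + r[%classic : set (measurableTypeR R)) (EFin \o (fun b => f (a, b))).
  by apply: itg1o_cont; exact: continuous_pair1.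
have := @itg_cont ord0 s r m f cf; rewrite rect0 => iAB.
by split; [rewrite fubini_12|apply: int_fubini_12].
Qed.

(** The integral over an edge with midpoint m and normal [ei i]. *)
Definition line i (s : R) m f : R :=
  \int[leb]_(t in `[- s, s]) f (m + t *: ei (rev_ord i)).

(** Green's formula for one derivative on a rectangle; all the boundary terms of
the proof are edge integrals obtained in this way. *)
Lemma gauss i (r s : R) m f : 0 < r -> 0 < s -> smooth f ->
  I2 (rect i r s m) ('D_(ei i) f) =
    line i s (m + r *: ei i) f - line i s (m - r *: ei i) f.
Proof.
move=> r0 s0 sf.
have cf := smooth_continuous sf; have cdf := smooth_continuous (smooth_D i sf).
have [-> _] := fubini_rect i r s m cdf.
have cL k (a : R) : continuous (fun b => f (pt k a b)).
  by move=> b; exact: (@line_continuous _ f (rev_ord k) (a *: ei k) cf b).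
pose g b := f (pt i (co i m + r) b) - f (pt i (co i m - r) b).
have cg : continuous g by move=> b; apply: cvgB; exact: cL.
transitivity (\int[leb]_(b in `]co (rev_ord i) m - s, co (rev_ord i) m + s[) g b).
  apply: eq_Rintegral => b _.
  have ptC a : pt i a b = b *: ei (rev_ord i) + a *: ei i by rewrite /pt addrC.
  under eq_Rintegral do rewrite ptC.
  rewrite I1_oo_cc; last exact: (@line_continuous _ _ i (b *: ei (rev_ord i)) cdf).
  have dF a : is_derive a (1:R) (fun a => f (b *: ei (rev_ord i) + a *: ei i))
      ('D_(ei i) f (b *: ei (rev_ord i) + a *: ei i)) by exact: smooth_line.
  rewrite (int_derive _ _ dF) ?/g ?ptC//; first lra.
  exact: (@line_continuous _ _ i (b *: ei (rev_ord i)) cdf).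
rewrite (I1_oo_cc _ _ cg) (I1_shift _ s0 cg) /line -RintegralB//; last 2 first.
- by apply: itg1_cont; exact: line_continuous.
- by apply: itg1_cont; exact: line_continuous.
apply: eq_Rintegral => t _; rewrite /g.
congr (f _ - f _); apply: (@co_inj _ i); rewrite /pt !coE; ring.
Qed.

End Measure2.

(** * Square-integrable functions *)

Section L2.
Context {R : realType}.
Local Notation R2 := (R * R)%type.
Local Notation M2 := (measurableTypeR R * measurableTypeR R)%type.
Local Notation leb := (@lebesgue_measure R).
Implicit Types (f g : R2 -> R) (i j : 'I_2) (x m : R2) (D E : set R2).

Lemma itgD D f g : meas D -> itg D f -> itg D g -> itg D (fun x => f x + g x).
Proof. by move=> mD fi gi; have := integrableD mD fi gi. Qed.

Lemma itgZ D a f : meas D -> itg D f -> itg D (fun x => a * f x).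
Proof. by move=> mD fi; have := integrableZl mD a fi. Qed.

Lemma itgB D f g : meas D -> itg D f -> itg D g -> itg D (fun x => f x - g x).
Proof. by move=> mD fi gi; have := integrableB mD fi gi. Qed.

Lemma itg_meas D f : itg D f -> measurable_fun (D : set M2) (f : M2 -> R).
Proof. by move=> /measurable_int /measurable_EFinP. Qed.

Lemma itg_le D f g : meas D -> measurable_fun (D : set M2) (f : M2 -> R) -> itg D g ->
  (forall x, D x -> `|f x| <= g x) -> itg D f.
Proof.
move=> mD mf gi H; apply: (le_integrable mD _ _ gi); first exact/measurable_EFinP.
move=> x Dx; rewrite /= lee_fin (le_trans (H x Dx))// ler_norm //.
Qed.

Lemma itg_sub D E f : meas D -> meas E -> E `<=` D -> itg D f -> itg E f.
Proof. by move=> mD mE ED; exact: integrableS. Qed.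

Lemma itg_abs D f : meas D -> itg D f -> itg D (fun x => `|f x|).
Proof. by move=> mD; exact: integrable_norm. Qed.

Lemma itg_sum D (I : Type) (r : seq I) (P : pred I) (F : I -> R2 -> R) : meas D ->
  (forall k, P k -> itg D (F k)) -> itg D (fun x => \sum_(k <- r | P k) F k x).
Proof.
move=> mD HF; elim: r => [|k r IH].
  under eq_fun do rewrite big_nil.
  by rewrite /itg (_ : _ \o _ = cst 0%E) //; exact: integrable0.
under eq_fun do rewrite big_cons.
by case Pk: (P k) => //; apply: itgD => //; exact: HF.
Qed.

Lemma I2D D f g : meas D -> itg D f -> itg D g ->
  I2 D (fun x => f x + g x) = I2 D f + I2 D g.
Proof. by move=> mD fi gi; rewrite /I2 RintegralD. Qed.

Lemma I2B D f g : meas D -> itg D f -> itg D g ->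
  I2 D (fun x => f x - g x) = I2 D f - I2 D g.
Proof. by move=> mD fi gi; rewrite /I2 RintegralB. Qed.

Lemma I2Z D a f : meas D -> itg D f -> I2 D (fun x => a * f x) = a * I2 D f.
Proof. by move=> mD fi; rewrite /I2 RintegralZl. Qed.

Lemma I2N D f : meas D -> itg D f -> I2 D (fun x => - f x) = - I2 D f.
Proof.
by move=> mD fi; rewrite -mulN1r -I2Z//; congr I2; apply/funext => x; rewrite mulN1r.
Qed.

Lemma I2_0 D : I2 D (fun=> 0) = 0.
Proof. by rewrite /I2 /Rintegral integral0. Qed.

Lemma I2_sum D (I : Type) (r : seq I) (P : pred I) (F : I -> R2 -> R) : meas D ->
  (forall k, P k -> itg D (F k)) ->
  I2 D (fun x => \sum_(k <- r | P k) F k x) = \sum_(k <- r | P k) I2 D (F k).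
Proof.
move=> mD HF; elim: r => [|k r IH].
  by rewrite big_nil -[RHS](I2_0 D); congr I2; apply/funext => x; rewrite big_nil.
under eq_fun do rewrite big_cons.
rewrite big_cons; case: ifP => // Pk.
by rewrite I2D ?IH//; [exact: HF|exact: itg_sum].
Qed.

Lemma I2_le D f g : meas D -> itg D f -> itg D g ->
  (forall x, D x -> f x <= g x) -> I2 D f <= I2 D g.
Proof. by move=> mD fi gi fg; rewrite /I2; apply: le_Rintegral. Qed.

Lemma I2_ge0 D f : (forall x, D x -> 0 <= f x) -> 0 <= I2 D f.
Proof. by move=> f0; rewrite /I2; apply: Rintegral_ge0. Qed.

Lemma I2_eq D f g : (forall x, D x -> f x = g x) -> I2 D f = I2 D g.
Proof. by move=> fg; apply: eq_Rintegral => x /set_mem; exact: fg. Qed.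

Lemma I2_abs D f : meas D -> itg D f -> `|I2 D f| <= I2 D (fun x => `|f x|).
Proof. by move=> mD fi; exact: le_normr_Rintegral. Qed.

Lemma I2_subset D E f : meas D -> meas E -> E `<=` D -> itg D f ->
  (forall x, D x -> 0 <= f x) -> I2 E f <= I2 D f.
Proof.
move=> mD mE ED fi f0.
rewrite /I2 /Rintegral fine_le//.
- by apply: integrable_fin_num => //; exact: itg_sub fi.
- exact: integrable_fin_num.
by apply: ge0_subset_integral => //; exact: measurable_int fi.
Qed.

Lemma I2_ae D f g : meas D -> measurable_fun (D : set M2) (f : M2 -> R) ->
  measurable_fun (D : set M2) (g : M2 -> R) ->
  ae_eq (@leb2 R) (D : set M2) (f : M2 -> R) g -> I2 D f = I2 D g.
Proof.
move=> mD mf mg fg; rewrite /I2 /Rintegral; congr fine; apply: ae_eq_integral => //.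
- exact/measurable_EFinP.
- exact/measurable_EFinP.
- by apply: filterS fg => x H /= Dx; rewrite H.
Qed.

Lemma inL2_meas D f : inL2 D f -> measurable_fun (D : set M2) (f : M2 -> R).
Proof. by case. Qed.

Lemma inL2_sq D f : inL2 D f -> itg D (fun x => f x ^+ 2).
Proof. by case. Qed.

Lemma inL2_itgM D f g : meas D -> inL2 D f -> inL2 D g -> itg D (fun x => f x * g x).
Proof.
move=> mD fL gL; apply: (@itg_le _ _ (fun x => f x ^+ 2 + g x ^+ 2)) => //.
- by apply: measurable_funM; exact: inL2_meas.
- by apply: itgD => //; exact: inL2_sq.
move=> x _; rewrite normrM -(real_normK (num_real (f x))) -(real_normK (num_real (g x))).
set a := `|f x|; set b := `|g x|; have := sqr_ge0 (a - b); have := sqr_ge0 a; have := sqr_ge0 b.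
by rewrite /a /b; nra.
Qed.

Lemma inL2D D f g : meas D -> inL2 D f -> inL2 D g -> inL2 D (fun x => f x + g x).
Proof.
move=> mD fL gL; split; first by apply: measurable_funD; exact: inL2_meas.
rewrite (_ : (fun x => _) = EFin \o (fun x => (f x ^+ 2 + 2 * (f x * g x)) + g x ^+ 2)); last first.
  by apply/funext => x /=; congr (_ %:E); ring.
apply: itgD => //; last exact: inL2_sq.
by apply: itgD => //; [exact: inL2_sq|apply: itgZ => //; exact: inL2_itgM].
Qed.

Lemma inL2Z D a f : meas D -> inL2 D f -> inL2 D (fun x => a * f x).
Proof.
move=> mD fL; split; first by apply: measurable_funM => //; exact: inL2_meas.
rewrite (_ : (fun x => _) = EFin \o (fun x => a ^+ 2 * f x ^+ 2)); last first.
  by apply/funext => x /=; congr (_ %:E); ring.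
by apply: itgZ => //; exact: inL2_sq.
Qed.

Lemma inL2N D f : meas D -> inL2 D f -> inL2 D (fun x => - f x).
Proof.
by move=> mD /(inL2Z (-1) mD); congr inL2; apply/funext => x; rewrite mulN1r.
Qed.

Lemma inL2B D f g : meas D -> inL2 D f -> inL2 D g -> inL2 D (fun x => f x - g x).
Proof. by move=> mD fL gL; apply: inL2D => //; exact: inL2N. Qed.

Lemma inL2_sub D E f : meas D -> meas E -> E `<=` D -> inL2 D f -> inL2 E f.
Proof.
move=> mD mE ED [mf fi]; split; last exact: (itg_sub mD mE ED fi).
exact: measurable_funS mf.
Qed.

Lemma inL2_bdM D f g (M : R) : meas D -> measurable_fun (D : set M2) (g : M2 -> R) ->
  (forall x, D x -> `|g x| <= M) -> inL2 D f -> inL2 D (fun x => g x * f x).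
Proof.
move=> mD mg gM fL; split; first by apply: measurable_funM => //; exact: inL2_meas.
have mf := inL2_meas fL.
apply: (@itg_le _ (fun x => (g x * f x) ^+ 2) (fun x => M ^+ 2 * f x ^+ 2)) => //.
- by apply: measurable_funX; exact: measurable_funM.
- by apply: itgZ => //; exact: inL2_sq.
move=> x Dx; rewrite ger0_norm ?sqr_ge0// exprMn ler_wpM2r ?sqr_ge0//.
rewrite -(real_normK (num_real (g x))) lerXn2r ?nnegrE//; last exact: gM.
exact: le_trans (gM x Dx).
Qed.

Lemma inL2_cont i r s m f : continuous f -> inL2 (rect i r s m) f.
Proof.
move=> cf; split; first by apply: measurable_funTS; exact: continuous_meas2.
by apply: itg_cont => x; apply: (@continuous_comp _ _ _ f (fun y => y ^+ 2)); [exact: cf|exact: exprn_continuous].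
Qed.

Lemma inL2_contM i r s m f g : continuous g -> inL2 (rect i r s m) f ->
  inL2 (rect i r s m) (fun x => g x * f x).
Proof.
move=> cg fL; have [M M0 HM] := bounded_rect i r s m cg.
apply: (@inL2_bdM _ _ _ M) => //; first exact: rect_meas.
  by apply: measurable_funTS; exact: continuous_meas2.
by move=> x [/ltW h1 /ltW h2]; exact: HM.
Qed.

Lemma inL2_cst D (a : R) : meas D -> (@leb2 R D < +oo)%E -> inL2 D (fun=> a).
Proof.
move=> mD fD; split; first exact: measurable_cst.
apply: measurable_bounded_integrable => //.
exists (a ^+ 2); split; first by rewrite num_real.
by move=> N MN x _; rewrite ger0_norm ?sqr_ge0// ltW.
Qed.

Lemma itg_cst D (a : R) : meas D -> (@leb2 R D < +oo)%E -> itg D (fun=> a).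
Proof.
move=> mD fD; apply: measurable_bounded_integrable => //.
exists `|a|; split; first by rewrite num_real.
by move=> N MN x _; rewrite ltW.
Qed.

Lemma inL2_itg D f : meas D -> (@leb2 R D < +oo)%E -> inL2 D f -> itg D f.
Proof.
move=> mD fD fL; have := inL2_itgM mD fL (inL2_cst 1 mD fD).
by congr itg; apply/funext => x; rewrite mulr1.
Qed.

Lemma cauchy_schwarz D f g : meas D -> inL2 D f -> inL2 D g ->
  (I2 D (fun x => f x * g x)) ^+ 2 <= I2 D (fun x => f x ^+ 2) * I2 D (fun x => g x ^+ 2).
Proof.
move=> mD fL gL.
set A := I2 D (fun x => f x ^+ 2); set B := I2 D (fun x => f x * g x).
set C := I2 D (fun x => g x ^+ 2).
have A0 : 0 <= A by apply: I2_ge0 => x _; exact: sqr_ge0.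
have C0 : 0 <= C by apply: I2_ge0 => x _; exact: sqr_ge0.
have H (a b : R) : 0 <= a ^+ 2 * A + 2 * (a * b) * B + b ^+ 2 * C.
  have -> : a ^+ 2 * A + 2 * (a * b) * B + b ^+ 2 * C = I2 D (fun x => (a * f x + b * g x) ^+ 2).
    rewrite /A /B /C -!I2Z -?I2D//.
    - by congr I2; apply/funext => x; ring.
    all: try (by apply: inL2_sq); try (by apply: inL2_itgM).
    - by apply: itgD => //; apply: itgZ => //; [exact: inL2_sq|exact: inL2_itgM].
    - by apply: itgZ => //; exact: inL2_sq.
    - by apply: itgZ => //; exact: inL2_sq.
    - by apply: itgZ => //; exact: inL2_itgM.
  by apply: I2_ge0 => x _; exact: sqr_ge0.
(* If A = 0 the form is affine in a, so B = 0; otherwise evaluate it at (- B, A). *)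
have [A00|A00] := eqVneq A 0.
  have [B0|B0] := eqVneq B 0; first by rewrite B0 A00 mul0r expr0n.
  have := H (- (C + 1) / (2 * B)) 1; rewrite A00 mulr0 add0r mulr1 expr1n mul1r.
  have -> : 2 * (- (C + 1) / (2 * B)) * B = - (C + 1) by field.
  lra.
have {}A0 : 0 < A by rewrite lt_def A00.
have := H (- B) A.
have -> : (- B) ^+ 2 * A + 2 * (- B * A) * B + A ^+ 2 * C = A * (A * C - B ^+ 2) by ring.
by rewrite pmulr_rge0// subr_ge0.
Qed.

End L2.

(** * Smooth cutoff functions *)

Section Bump.
Context {R : realType}.
Local Notation R2 := (R * R)%type.
Local Notation M2 := (measurableTypeR R * measurableTypeR R)%type.
Implicit Types (f g : R2 -> R) (i j : 'I_2) (x m : R2) (D E : set R2).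

(** The functions t^-k exp(-1/t), extended by zero.  Their span is stable under
differentiation ([eb_derive]), and at infinity [eb 0] tends to 1 while [eb 1] tends
to 0, which is what the cutoff functions need. *)
Definition eb (k : nat) (t : R) : R := if 0 < t then (t^-1) ^+ k * expR (- t^-1) else 0.

Lemma eb_ge0 k t : 0 <= eb k t.
Proof.
by rewrite /eb; case: ifP => // t0; rewrite mulr_ge0 ?expR_ge0// exprn_ge0// invr_ge0 ltW.
Qed.

(** The exponential series bounds exp(1/t) from below by a single term, which
beats any power of 1/t. *)
Lemma eb_le k n t : 0 < t -> eb k t <= ((k + n).+1)`!%:R * t ^+ n.+1.
Proof.
move=> t0; rewrite /eb t0.
have y0 : 0 < t^-1 by rewrite invr_gt0.
set F := (_`!)%:R; have F0 : 0 < F by rewrite ltr0n fact_gt0.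
have : t^-1 ^+ (k + n).+1 / F <= expR (t^-1).
  by apply: le_trans (@expR_ge1Dxn R (t^-1) (k + n) (ltW y0)); rewrite lerDr.
rewrite ler_pdivrMr// expRN => H.
have E0 := expR_gt0 (t^-1).
rewrite ler_pdivrMr// -[leLHS]mul1r.
have -> : 1 * t^-1 ^+ k = t ^+ n.+1 * t^-1 ^+ (k + n).+1.
  by rewrite -addnS exprD mulrCA -exprMn divff ?expr1n ?mulr1 ?mul1r// gt_eqF.
by rewrite [leRHS]mulrAC [leRHS]mulrC ler_wpM2l ?exprn_ge0 ?(ltW t0)// mulrC.
Qed.

Lemma eb0_le1 t : eb 0 t <= 1.
Proof.
rewrite /eb; case: ifP => // t0; rewrite expr0 mul1r -[leRHS]expR0 ler_expR oppr_le0 invr_ge0.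
exact: ltW.
Qed.

Lemma eb1_le1 t : eb 1 t <= 1.
Proof.
rewrite /eb; case: ifP => // t0; rewrite expr1 expRN ler_pdivrMr ?expR_gt0// mul1r.
by apply: le_trans (expR_ge1Dx _); rewrite lerDr.
Qed.

Lemma eb1_le t : 0 < t -> eb 1 t <= t^-1.
Proof.
move=> t0; rewrite /eb t0 expr1 -[leRHS]mulr1 ler_wpM2l ?invr_ge0 ?(ltW t0)//.
by rewrite -[leRHS]expR0 ler_expR oppr_le0 invr_ge0 ltW.
Qed.

Lemma eb0_ge t : 0 < t -> 1 - t^-1 <= eb 0 t.
Proof. by move=> t0; rewrite /eb t0 expr0 mul1r expR_ge1Dx. Qed.

Lemma mul_eb2 t : t * eb 2 t = eb 1 t.
Proof.
rewrite /eb; case: ifP => t0; last by rewrite mulr0.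
by rewrite mulrA expr2 mulrA divff ?mul1r ?expr1// gt_eqF.
Qed.

Lemma eb_derive k t : is_derive t (1:R) (eb k) (- (k%:R * eb k.+1 t) + eb k.+2 t).
Proof.
have [t0|t0|t0] := ltgtP 0 t; first last.
-
  (* [eb_le] with one power of h to spare makes the difference quotient O(h). *)
  rewrite -t0 /eb ltxx mulr0 oppr0 addr0.
  have C : h^-1 *: (eb k (h *: 1 + 0) - eb k 0) @[h --> (0:R)^'] --> (0:R).
    apply/cvgrPdist_le => e e0; near=> h.
    rewrite sub0r normrN {2}/eb ltxx subr0 addr0 /GRing.scale /= mulr1.
    have hn0 : h != 0 by near: h; exact: nbhs_dnbhs_neq.
    have [h0|h0] := ltP 0 h; last by rewrite /eb ltNge h0 mulr0 normr0 ltW.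
    rewrite normrM ger0_norm ?invr_ge0 ?(ltW h0)// ger0_norm ?eb_ge0//.
    rewrite mulrC ler_pdivrMr//; apply: le_trans (eb_le k 1 h0) _.
    rewrite expr2 mulrA ler_wpM2r ?(ltW h0)//.
    rewrite mulrC -ler_pdivlMr ?ltr0n ?fact_gt0//.
    apply: ltW; apply: le_lt_trans (ler_norm _) _.
    by near: h; apply: dnbhs0_lt; rewrite divr_gt0// ltr0n fact_gt0.
  apply: DeriveDef; last by rewrite /derive /=; apply: cvg_lim.
  by rewrite /derivable /=; apply/cvg_ex; exists 0.
-
  rewrite /eb ltNge (ltW t0) /= mulr0 oppr0 addr0.
  apply: (@near_eq_is_derive _ _ _ (cst 0)).
    near=> u; rewrite /= ltNge (_ : u <= 0)//.
    by apply: ltW; near: u; exact: lt_nbhsl.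
-
  apply: (@near_eq_is_derive _ _ _ (fun t : R => (t^-1) ^+ k * expR (- t^-1))).
    have Pos : \forall u \near t, 0 < u := lt_nbhsr t0.
    by apply: filterS Pos => u u0; rewrite /eb u0.
  have tn0 : t != 0 by rewrite gt_eqF.
  have D1 : is_derive t (1:R) (fun u : R => u^-1) (- t ^- 2).
    apply: DeriveDef; first exact: (@derivableV _ _ id).
    by rewrite (@deriveV _ _ id)// derive_id /GRing.scale /= mulr1.
  have D2 : is_derive t (1:R) (fun u : R => - u^-1) (t ^- 2).
    by apply: is_derive_eq; rewrite opprK.
  have D3 : is_derive t (1:R) (expR \o (fun u : R => - u^-1)) (t ^- 2 * expR (- t^-1)).
    by rewrite mulrC; apply: is_derive1_comp; exact: is_derive_expR.
  have D4 : is_derive t (1:R) ((fun u : R => u^-1) ^+ k) (k%:R * (t^-1) ^+ k.-1 * (- t ^- 2)).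
    by apply: is_derive_eq.
  rewrite (_ : (fun t : R => _) = ((fun u : R => u^-1) ^+ k) * (expR \o (fun u : R => - u^-1))); last first.
    by apply/funext => u; rewrite /= exprfctE.
  apply: is_derive_eq; rewrite /eb t0 /GRing.scale /= exprfctE -exprVn.
  case: k {D4} => [|k] /=; first by rewrite !expr0; ring.
  by rewrite !exprS; ring.
Unshelve. all: by end_near. Qed.

Lemma eb_continuous k : continuous (eb k).
Proof. by move=> t; apply/differentiable_continuous/derivable1_diffP; have [] := eb_derive k t. Qed.

Lemma is_derive_aff (g : R -> R) (dg a b : R) i k x :
  is_derive (a * co i x + b) (1:R) g dg ->
  is_derive x (ei k) (fun y => g (a * co i y + b)) (a * (k == i)%:R * dg).
Proof.
move=> Dg.
have ck : co i (ei k : R2) = (k == i)%:R.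
  by case: (ord2P i) => ->; case: (ord2P k) => ->; rewrite /co /ei.
pose F (h : R) := a * (h * (k == i)%:R + co i x) + b.
have D : is_derive (0:R) (1:R) (g \o F) (a * (k == i)%:R * dg).
  have L : is_derive (0:R) (1:R) F (a * (k == i)%:R).
    rewrite (_ : F = (cst (a * (k == i)%:R) * id) + cst (a * co i x + b)); last first.
      by apply/funext => h; rewrite /F !fctE /=; ring.
    by apply: is_derive_eq; rewrite /GRing.scale /= mulr1 mulr0 !addr0.
  have Dg' : is_derive (F 0) (1:R) g dg by rewrite /F mul0r add0r.
  have := is_derive1_comp Dg' L.
  by rewrite mulrC.
have E : (fun h : R => h^-1 *: (g (a * co i (h *: ei k + x) + b) - g (a * co i x + b))) =
   (fun h : R => h^-1 *: (g (a * ((h *: (1:R) + 0) * (k == i)%:R + co i x) + b) - g (a * (0 * (k == i)%:R + co i x) + b))).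
  apply/funext => h; rewrite coD coZ ck mul0r add0r addr0 /GRing.scale /= mulr1 //.
move: D => [D1 D2]; apply: DeriveDef; first by rewrite /derivable /= E.
by rewrite /derive /= E.
Qed.

(** The span of the functions [eb k], composed with a fixed affine function of
one coordinate, is stable under partial derivatives. *)
Lemma smooth_eb k (a b : R) i : smooth (fun x : R2 => eb k (a * co i x + b)).
Proof.
suff : forall f, (exists l : seq (R * nat), f = fun x => \sum_(p <- l) p.1 * eb p.2 (a * co i x + b)) -> smooth f.
  apply; exists [:: (1, k)]; apply/funext => x.
  by rewrite big_seq1 mul1r.
apply: smooth_coind => f [l ->] {f}.
(* A pair (p, k) stands for the term p * eb k; the derivative of a term has two terms. *)
pose d (l : seq (R * nat)) j : seq (R * nat) := flatten [seq [:: (- (a * (j == i)%:R * p.1 * p.2%:R), p.2.+1); (a * (j == i)%:R * p.1, p.2.+2)] | p <- l].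
have D j x : is_derive x (ei j) (fun x => \sum_(p <- l) p.1 * eb p.2 (a * co i x + b))
    (\sum_(p <- d l j) p.1 * eb p.2 (a * co i x + b)).
  elim: l => [|p l IH].
    rewrite /d /= big_nil (_ : (fun x => _) = cst 0); first exact: is_derive_cst.
    by apply/funext => y; rewrite big_nil.
  rewrite (_ : (fun x => _) = (p.1 *: (fun x => eb p.2 (a * co i x + b))) +
      (fun x => \sum_(p <- l) p.1 * eb p.2 (a * co i x + b))); last first.
    by apply/funext => y; rewrite big_cons.
  have H := @is_derive_aff (eb p.2) _ a b i j x (eb_derive p.2 _).
  apply: is_derive_eq.
  rewrite /d /= !big_cons /= /GRing.scale /=; ring.
split.
- move=> x; elim: l {D} => [|p l IH].
    rewrite (_ : (fun x => _) = cst 0); first exact: cvg_cst.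
    by apply/funext => y; rewrite big_nil.
  under eq_fun do rewrite big_cons.
  apply: cvgD; last exact: IH.
  apply: cvgM; first exact: cvg_cst.
  apply: (@continuous_comp _ _ _ (fun y : R2 => a * co i y + b) (eb p.2)); last exact: eb_continuous.
  by apply: cvgD; [apply: cvgM; [exact: cvg_cst|exact: co_continuous]|exact: cvg_cst].
- by move=> j x; have [] := D j x.
- by move=> j; exists (d l j); apply/funext => x; have [_ ->] := D j x.
Qed.

Lemma d_eb k (a b : R) i j x : 'D_(ei j) (fun x : R2 => eb k (a * co i x + b)) x =
  a * (j == i)%:R * (- (k%:R * eb k.+1 (a * co i x + b)) + eb k.+2 (a * co i x + b)).
Proof. by have [_ ->] := @is_derive_aff (eb k) _ a b i j x (eb_derive k _). Qed.

Definition crect i (r s : R) m : set R2 :=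
  [set x | `|co i (x - m)| <= r /\ `|co (rev_ord i) (x - m)| <= s].

Lemma crect_closed i r s m : closed (crect i r s m).
Proof.
have E k (t : R) : closed [set x : R2 | `|co k (x - m)| <= t].
  apply: (@closed_comp _ _ (fun x : R2 => `|co k (x - m)|) [set u | u <= t]); last exact: closed_le.
  move=> x _; apply: (@continuous_comp _ _ _ (fun x : R2 => co k (x - m)) (@Num.norm _ R)); last exact: norm_continuous.
  exact/smooth_continuous/smooth_coc.
rewrite (_ : crect _ _ _ _ = [set x | `|co i (x - m)| <= r] `&` [set x | `|co (rev_ord i) (x - m)| <= s])//.
exact: closedI.
Qed.

Lemma crect_rev i r s m : crect (rev_ord i) s r m = crect i r s m.
Proof. by rewrite /crect rev_ordK; apply/seteqP; split => x [? ?]. Qed.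

Lemma crect_compact i r s m : compact (crect i r s m).
Proof.
wlog -> : i r s / i = ord0.
  move=> H; case: (ord2P i) => [|E]; first exact: H.
  by rewrite -(crect_rev i) E rev_ord2; exact: H.
have -> : crect ord0 r s m = `[m.1 - r, m.1 + r]%classic `*` `[m.2 - s, m.2 + s]%classic.
  apply/seteqP; split => -[a b]; rewrite /crect rev_ord2 /co /= !in_itv /= !ler_norml.
    by move=> [/andP[? ?] /andP[? ?]]; split; apply/andP; split; lra.
  by move=> [/andP[? ?] /andP[? ?]]; split; apply/andP; split; lra.
by apply: compact_setX; exact: segment_compact.
Qed.

Lemma test_functionP D f i r s m : smooth f -> (forall x, f x != 0 -> crect i r s m x) ->
  crect i r s m `<=` D -> test_function D f.
Proof.
move=> sf sup sub.
have cl : closure [set x | f x != 0] `<=` crect i r s m.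
  have /closure_id E := @crect_closed i r s m; rewrite E; exact: closureS.
split => //; last exact: subset_trans cl sub.
by apply: (subclosed_compact _ (@crect_compact i r s m) cl); exact: closed_closure.
Qed.

End Bump.

(** * Weak derivatives tested against polynomials on a rectangle *)

Section Cutoff.
Context {R : realType}.
Local Notation R2 := (R * R)%type.
Local Notation M2 := (measurableTypeR R * measurableTypeR R)%type.
Implicit Types (f g : R2 -> R) (i j : 'I_2) (x m : R2) (D E : set R2).

Lemma I2_supp D E f : meas D -> meas E -> E `<=` D -> (forall x, D x -> ~ E x -> f x = 0) ->
  I2 D f = I2 E f.
Proof.
move=> mD mE ED f0; rewrite /I2 Rintegral_mkcond [RHS]Rintegral_mkcond; apply: eq_Rintegral => x _.
rewrite !patchE; case: ifPn => xD; case: ifPn => xE //.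
  by apply: f0; [exact/set_mem|move/mem_set; apply/negP].
by move: xD; rewrite (mem_set (ED _ (set_mem xE))).
Qed.

Lemma I2_dct D (F : nat -> R2 -> R) f g : meas D ->
  (forall n, measurable_fun (D : set M2) (F n : M2 -> R)) ->
  measurable_fun (D : set M2) (f : M2 -> R) ->
  (forall x, D x -> F n x @[n --> \oo] --> f x) -> itg D g ->
  (forall n x, D x -> `|F n x| <= g x) -> I2 D (F n) @[n --> \oo] --> I2 D f.
Proof.
move=> mD mF mf Ff gi Fg.
have Ff' x : D x -> (F n x)%:E @[n --> \oo] --> (EFin \o f) x.
  by move=> Dx; apply: cvg_EFin; [exact: nearW|exact: Ff].
have Fae : {ae @leb2 R, forall x, D x -> (F n x)%:E @[n --> \oo] --> (EFin \o f) x}.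
  by apply: aeW => x; exact: Ff'.
have Gae : {ae @leb2 R, forall x n, D x -> (`|(F n x)%:E| <= (EFin \o g) x)%E}.
  by apply: aeW => x n Dx; rewrite /= lee_fin; exact: Fg.
have [fi _ H] := @dominated_convergence _ _ _ (@leb2 R) D mD (fun n x => (F n x)%:E)
   (EFin \o f) (EFin \o g)
   (fun n => (measurable_EFinP _ _).2 (mF n)) ((measurable_EFinP _ _).2 mf)
   Fae gi Gae.
apply: (@fine_cvg _ _ _ _ (fun n => \int[@leb2 R]_(x in (D : set M2)) (F n x)%:E)%E).
rewrite fineK; last exact: integrable_fin_num.
exact: H.
Qed.

(** The argument of [eb] is positive exactly when r + sg * xi > r / n.+1, and tends
to infinity with n when r + sg * xi > 0: [bs 0 n] is a smooth approximation of the
indicator of a half-plane. *)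
Definition bs k n (sg : R) i (r : R) m x : R :=
  eb k (n.+1%:R * (r + sg * co i (x - m)) - r).

Lemma bsE k n sg i r m : bs k n sg i r m =
  fun x => eb k ((n.+1%:R * sg) * co i x + (n.+1%:R * (r - sg * co i m) - r)).
Proof. by apply/funext => x; rewrite /bs; congr eb; rewrite coB; ring. Qed.

Lemma smooth_bs k n sg i r m : smooth (bs k n sg i r m).
Proof. by rewrite bsE; exact: smooth_eb. Qed.

Lemma d_bs n sg i r m j x : 'D_(ei j) (bs 0 n sg i r m) x =
  n.+1%:R * sg * (j == i)%:R * bs 2 n sg i r m x.
Proof. by rewrite bsE d_eb mul0r oppr0 add0r /bs; congr (_ * eb _ _); rewrite coB; ring. Qed.

Definition bump2 n i (r : R) m x : R := bs 0 n 1 i r m x * bs 0 n (-1) i r m x.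

Lemma smooth_bump2 n i r m : smooth (bump2 n i r m).
Proof. by apply: smooth_mul; exact: smooth_bs. Qed.

Lemma bump2_01 n i r m x : 0 <= bump2 n i r m x <= 1.
Proof.
rewrite mulr_ge0 ?eb_ge0//= -[leRHS]mulr1.
by apply: ler_pM; rewrite ?eb_ge0 ?eb0_le1.
Qed.

Lemma bump2_supp n i r m x : 0 < r -> bump2 n i r m x != 0 -> `|co i (x - m)| <= r * (1 - n.+1%:R^-1).
Proof.
move=> r0; rewrite /bump2 mulf_eq0 negb_or /bs /eb mul1r mulN1r.
have n0 : 0 < n.+1%:R :> R by rewrite ltr0n.
case: ifP => h1; last by rewrite eqxx.
case: ifP => h2; last by rewrite eqxx andbF.
move=> _; rewrite ler_norml.
set v := n.+1%:R^-1; have E : n.+1%:R * v = 1 by rewrite divff// gt_eqF.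
have v0 : 0 < v by rewrite invr_gt0.
have H1 := mulr_gt0 v0 h1; have H2 := mulr_gt0 v0 h2.
rewrite mulrBr mulrA [v * _]mulrC E mul1r in H1.
rewrite mulrBr mulrA [v * _]mulrC E mul1r in H2.
by apply/andP; split; nra.
Qed.

Lemma bump2_supp0 n i r m x : 0 < r -> r <= `|co i (x - m)| -> bump2 n i r m x = 0.
Proof.
move=> r0 h; apply/eqP; rewrite -[_ == _]negbK; apply/negP => /(bump2_supp r0) h2.
have : 0 < r * n.+1%:R^-1 by rewrite mulr_gt0// invr_gt0 ltr0n.
move: h2; rewrite mulrBr mulr1; move: (r * _) h => v h h2 v0.
by have := lt_le_trans (_ : r - v < r) (le_trans h h2); rewrite ltxx gtrBl => /(_ v0).
Qed.

Lemma test_function_cut D f n i r s m : 0 < r -> 0 < s -> rect i r s m `<=` D ->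
  smooth f -> test_function D (fun x => f x * (bump2 n i r m x * bump2 n (rev_ord i) s m x)).
Proof.
move=> r0 s0 sub sf.
apply: (@test_functionP _ _ _ i (r * (1 - n.+1%:R^-1)) (s * (1 - n.+1%:R^-1)) m).
- by apply: smooth_mul => //; apply: smooth_mul; exact: smooth_bump2.
- move=> x; have [-> |h1 h] := eqVneq (bump2 n i r m x) 0; first by rewrite mul0r mulr0 eqxx.
  have h2 : bump2 n (rev_ord i) s m x != 0.
    by apply: contra_neq h => ->; rewrite !mulr0.
  by split; [exact: bump2_supp r0 h1|exact: bump2_supp s0 h2].
apply: subset_trans sub => x [h1 h2].
have n0 : 0 < n.+1%:R^-1 :> R by rewrite invr_gt0 ltr0n.
by split; [apply: le_lt_trans h1 _|apply: le_lt_trans h2 _]; rewrite -[ltRHS]mulr1 ltr_pM2l//; lra.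
Qed.

Lemma bs_arg_cvg (a r : R) : 0 < a -> (n.+1%:R * a - r) @[n --> \oo] --> +oo.
Proof.
move=> a0; apply/cvgryPge => A; near=> n.
have : (A + r) / a <= n.+1%:R.
  rewrite (le_trans _ (_ : n%:R <= n.+1%:R))// ?ler_nat//.
  by near: n; exact: nbhs_infty_ger.
by rewrite ler_pdivrMr//; lra.
Unshelve. all: by end_near. Qed.

Lemma eb0_cvg (u : nat -> R) : u n @[n --> \oo] --> +oo -> eb 0 (u n) @[n --> \oo] --> (1:R).
Proof.
move=> cu; have u0 : \forall n \near \oo, 0 < u n by exact: cvgry_gt cu 0.
apply: (@squeeze_cvgr _ _ _ _ (fun n => 1 - (u n)^-1) (cst 1)).
- by near=> n; rewrite eb0_le1 eb0_ge//; near: n.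
- rewrite -[X in _ --> X]subr0; apply: cvgB; first exact: cvg_cst.
  exact/gtr0_cvgV0.
- exact: cvg_cst.
Unshelve. all: by end_near. Qed.

Lemma eb1_cvg (u : nat -> R) : u n @[n --> \oo] --> +oo -> eb 1 (u n) @[n --> \oo] --> (0:R).
Proof.
move=> cu; have u0 : \forall n \near \oo, 0 < u n by exact: cvgry_gt cu 0.
apply: (@squeeze_cvgr _ _ _ _ (cst 0) (fun n => (u n)^-1)).
- by near=> n; rewrite eb_ge0 eb1_le//; near: n.
- exact: cvg_cst.
- exact/gtr0_cvgV0.
Unshelve. all: by end_near. Qed.

Lemma bs0_cvg i r m x (sg : R) : 0 < r + sg * co i (x - m) ->
  bs 0 n sg i r m x @[n --> \oo] --> (1:R).
Proof. by move=> h; apply: eb0_cvg; exact: bs_arg_cvg. Qed.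

Lemma bs1_cvg i r m x (sg : R) : 0 < r + sg * co i (x - m) ->
  bs 1 n sg i r m x @[n --> \oo] --> (0:R).
Proof. by move=> h; apply: eb1_cvg; exact: bs_arg_cvg. Qed.

Lemma bump2_cvg i r m x : `|co i (x - m)| < r -> bump2 n i r m x @[n --> \oo] --> (1:R).
Proof.
rewrite ltr_norml => /andP[h1 h2]; rewrite -[X in _ --> X]mulr1.
by apply: cvgM; apply: bs0_cvg; lra.
Qed.

Lemma meas_smooth D f : smooth f -> measurable_fun (D : set M2) (f : M2 -> R).
Proof. by move=> sf; apply: measurable_funTS; apply: continuous_meas2; exact: smooth_continuous. Qed.

Lemma inL2_itg_abs D f : meas D -> (@leb2 R D < +oo)%E -> inL2 D f -> itg D (fun x => `|f x|).
Proof. by move=> mD fD fL; apply: itg_abs => //; exact: inL2_itg. Qed.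

(** The cutoff functions of the rectangle converge boundedly to its indicator. *)
Lemma I2_rect_eq0 D g i r s m : meas D -> 0 < r -> 0 < s -> rect i r s m `<=` D -> inL2 D g ->
  (forall psi, test_function D psi -> I2 D (fun x => g x * psi x) = 0) ->
  I2 (rect i r s m) g = 0.
Proof.
move=> mD r0 s0 sub gL H.
pose e n x := 1 * (bump2 n i r m x * bump2 n (rev_ord i) s m x).
have mQ := rect_meas i r s m.
have gQ : inL2 (rect i r s m) g by apply: inL2_sub gL.
have C : I2 (rect i r s m) (fun x => g x * e n x) @[n --> \oo] --> I2 (rect i r s m) g.
  apply: (@I2_dct _ _ _ (fun x => `|g x|)) => //.
  - move=> n; apply: measurable_funM; first exact: inL2_meas gQ.
    by apply: meas_smooth; apply: smooth_mul; [exact: smooth_cst|apply: smooth_mul; exact: smooth_bump2].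
  - exact: inL2_meas gQ.
  - move=> x [h1 h2]; rewrite -[X in _ --> X]mulr1; apply: cvgM; first exact: cvg_cst.
    rewrite -[X in _ --> X]mulr1 /e; under eq_fun do rewrite mul1r.
    by apply: cvgM; exact: bump2_cvg.
  - by apply: inL2_itg_abs => //; exact: rect_fin.
  - move=> n x _; rewrite normrM -[leRHS]mulr1 ler_wpM2l// /e mul1r.
    have /andP[a0 a1] := bump2_01 n i r m x; have /andP[b0 b1] := bump2_01 n (rev_ord i) s m x.
    by rewrite ger0_norm; [exact: mulr_ile1|exact: (mulr_ge0 a0 b0)].
have E n : I2 (rect i r s m) (fun x => g x * e n x) = 0.
  rewrite -(@I2_supp D)//; first by apply: H; apply: test_function_cut => //; exact: smooth_cst.
  move=> x _ nx; rewrite /e mul1r.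
  have [h1|h1] := ltP `|co i (x - m)| r; last by rewrite bump2_supp0// mul0r mulr0.
  have [h2|h2] := ltP `|co (rev_ord i) (x - m)| s; last by rewrite (@bump2_supp0 _ (rev_ord i))// !mulr0.
  by case: nx.
move: C; rewrite (_ : (fun n => _) = cst 0); last by apply/funext.
by move=> C0; apply: (cvg_unique _ C0); [exact: norm_hausdorff|exact: cvg_cst].
Qed.

Lemma smooth_poly (q : {poly R}) i m : smooth (fun x => q.[co i (x - m)]).
Proof.
elim/poly_ind: q => [|q c IH].
  by under eq_fun do rewrite horner0; exact: smooth_cst.
under eq_fun do rewrite hornerMXaddC.
by apply: smooth_add; [apply: smooth_mul => //; exact: smooth_coc|exact: smooth_cst].
Qed.

Lemma d_poly (q : {poly R}) i m x : 'D_(ei i) (fun x => q.[co i (x - m)]) x = q^`().[co i (x - m)].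
Proof.
elim/poly_ind: q => [|q c IH].
  rewrite deriv0 horner0 (_ : (fun x => _) = cst 0) ?derive_cst//.
  by apply/funext => y; rewrite horner0.
rewrite (_ : (fun x => _) = fun x => q.[co i (x - m)] * co i (x - m) + c); last first.
  by apply/funext => y; rewrite hornerMXaddC.
rewrite pdD; [|apply: smooth_mul; [exact: smooth_poly|exact: smooth_coc]|exact: smooth_cst].
rewrite pdM; [|exact: smooth_poly|exact: smooth_coc].
rewrite IH pd_cst pd_coc eqxx derivMXaddC !hornerE; ring.
Qed.

(** A weak derivative may be tested against a polynomial in xi that vanishes on
the two sides of the rectangle orthogonal to i, although this is not a test
function.  The derivative of a cutoff function is of order n near these sides, but
the polynomial is small there; scaled to vanish at the distance r / n.+1 from the
sides it turns [bs 2] into [bs 1], which is bounded and tends to zero, and dominated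
convergence applies.  In the other direction the cutoff is not differentiated. *)
Lemma cutoff_ibp D f f1 i r s m (q : {poly R}) : meas D -> 0 < r -> 0 < s ->
  rect i r s m `<=` D -> inL2 D f -> inL2 D f1 ->
  (forall psi, test_function D psi ->
     I2 D (fun x => f x * 'D_(ei i) psi x) = - I2 D (fun x => f1 x * psi x)) ->
  let xi x := co i (x - m) in
  I2 (rect i r s m) (fun x => f x * (- (2 * xi x) * q.[xi x] + (r ^+ 2 - xi x ^+ 2) * q^`().[xi x]))
  = - I2 (rect i r s m) (fun x => f1 x * ((r ^+ 2 - xi x ^+ 2) * q.[xi x])).
Proof.
move=> mD r0 s0 sub fL f1L H xi.
(* With this half-width rn n + xi and rn n - xi are, up to the factor n.+1, the
   arguments of the two cutoffs. *)
pose rn n : R := r * (1 - n.+1%:R^-1).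
have mQ := rect_meas i r s m.
have fQ : inL2 (rect i r s m) f by apply: inL2_sub fL.
have f1Q : inL2 (rect i r s m) f1 by apply: inL2_sub f1L.
have sxi : smooth xi by exact: smooth_coc.
have sq : smooth (fun x => q.[xi x]) by exact: smooth_poly.
have sdq : smooth (fun x => q^`().[xi x]) by exact: smooth_poly.
have sr (a : R) : smooth (fun x => (a ^+ 2 - xi x ^+ 2)).
  by apply: smooth_sub; [exact: smooth_cst|exact: smooth_exp].
pose P n x := (rn n ^+ 2 - xi x ^+ 2) * q.[xi x].
pose b k n sg := bs k n sg i r m.
pose e n x := bump2 n i r m x * bump2 n (rev_ord i) s m x.
(* The derivative of P n * e n, where t * eb 2 t has become eb 1 t: no factor n is
   left. *)
pose d n x := (- (2 * xi x) * q.[xi x] + (rn n ^+ 2 - xi x ^+ 2) * q^`().[xi x]) * e n x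
   + q.[xi x] * ((rn n - xi x) * b 1 n 1 x * b 0 n (-1) x - (rn n + xi x) * b 0 n 1 x * b 1 n (-1) x)
     * bump2 n (rev_ord i) s m x.
have sP n : smooth (P n) := smooth_mul (sr (rn n)) sq.
have se n : smooth (e n) by apply: smooth_mul; exact: smooth_bump2.
have dE n x : 'D_(ei i) (fun x => P n x * e n x) x = d n x.
  have n0 : n.+1%:R != 0 :> R by rewrite pnatr_eq0.
  have db : 'D_(ei i) (bump2 n (rev_ord i) s m) x = 0.
    rewrite /bump2 pdM; try exact: smooth_bs.
    by rewrite !d_bs (_ : i == rev_ord i = false) ?mulr0 ?mul0r ?mulr0 ?addr0//; case: (ord2P i) => ->; rewrite rev_ord2.
  have db' : 'D_(ei i) (bump2 n i r m) x = bs 0 n 1 i r m x * (n.+1%:R * (-1) * bs 2 n (-1) i r m x)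
      + bs 0 n (-1) i r m x * (n.+1%:R * bs 2 n 1 i r m x).
    rewrite /bump2 pdM; try exact: smooth_bs.
    by rewrite !d_bs eqxx !mulr1.
  have dx2 : 'D_(ei i) (fun x => xi x ^+ 2) x = 2 * xi x.
    rewrite (_ : (fun x => xi x ^+ 2) = fun x => xi x * xi x); last by apply/funext => y; rewrite expr2.
    by rewrite pdM// pd_coc eqxx mulr1 mulrDl mul1r.
  have dP : 'D_(ei i) (P n) x = (rn n ^+ 2 - xi x ^+ 2) * q^`().[xi x] - 2 * xi x * q.[xi x].
    rewrite /P (@pdM _ i (fun x => rn n ^+ 2 - xi x ^+ 2) (fun x => q.[xi x]) x (sr (rn n)) sq).
    rewrite (@pdB _ i (fun=> rn n ^+ 2) (fun x => xi x ^+ 2) x (smooth_cst _) (smooth_exp 2 sxi)).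
    by rewrite (@d_poly q i m x) dx2 pd_cst -/(xi x); ring.
  have de : 'D_(ei i) (e n) x = bump2 n (rev_ord i) s m x * 'D_(ei i) (bump2 n i r m) x.
    by rewrite /e pdM; [rewrite db mulr0 add0r|exact: smooth_bump2|exact: smooth_bump2].
  rewrite (@pdM _ i (P n) (e n) x (sP n) (se n)) de dP db' /d.
  have E1 : (rn n + xi x) * n.+1%:R * bs 2 n 1 i r m x = b 1 n 1 x.
    rewrite /b /bs -mul_eb2 -/(xi x); congr (_ * _); rewrite /rn.
    by field.
  have E2 : (rn n - xi x) * n.+1%:R * bs 2 n (-1) i r m x = b 1 n (-1) x.
    rewrite /b /bs -mul_eb2 -/(xi x); congr (_ * _); rewrite /rn.
    by field.
  rewrite -E1 -E2 /P /b /e /bump2; ring.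
have rn_cvg : rn n @[n --> \oo] --> r.
  rewrite -[X in _ --> X]mulr1; apply: cvgM; first exact: cvg_cst.
  rewrite -[X in _ --> X]subr0; apply: cvgB; first exact: cvg_cst.
  exact: cvg_harmonic.
have rn0 n : 0 <= rn n <= r.
  have h1 : (n.+1%:R^-1 : R) <= 1 by rewrite invf_le1 ?ltr0n// ler1n.
  have h2 : 0 <= (n.+1%:R^-1 : R) by rewrite invr_ge0.
  by rewrite mulr_ge0 ?(ltW r0)//= ?subr_ge0// -[leRHS]mulr1 ler_pM2l//; lra.
have [M M0 HM] := bounded_rect i r s m (smooth_continuous sq).
have [M' M'0 HM'] := bounded_rect i r s m (smooth_continuous sdq).
have e01 n x : 0 <= e n x <= 1.
  have /andP[a0 a1] := bump2_01 n i r m x; have /andP[b0 b1] := bump2_01 n (rev_ord i) s m x.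
  by apply/andP; split; [exact: (mulr_ge0 a0 b0)|exact: mulr_ile1].
have ecvg x : rect i r s m x -> e n x @[n --> \oo] --> (1:R).
  by move=> [h1 h2]; rewrite -[X in _ --> X]mulr1; apply: cvgM; exact: bump2_cvg.
have qb x : rect i r s m x -> `|xi x| <= r /\ `|q.[xi x]| <= M /\ `|q^`().[xi x]| <= M'.
  by move=> [/ltW h1 /ltW h2]; split => //; split; [exact: HM|exact: HM'].
have C1 : I2 (rect i r s m) (fun x => f x * d n x) @[n --> \oo] -->
   I2 (rect i r s m) (fun x => f x * (- (2 * xi x) * q.[xi x] + (r ^+ 2 - xi x ^+ 2) * q^`().[xi x])).
  apply: (@I2_dct _ _ _ (fun x => (2 * r * M + 2 * r ^+ 2 * M' + 4 * r * M) * `|f x|)) => //.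
  - move=> n; apply: measurable_funM; first exact: inL2_meas fQ.
    rewrite (_ : d n = 'D_(ei i) (fun x => P n x * e n x)); last by apply/funext => x; rewrite dE.
    exact: (meas_smooth (smooth_D i (smooth_mul (sP n) (se n)))).
  - apply: measurable_funM; first exact: inL2_meas fQ.
    exact: (meas_smooth (smooth_add (smooth_mul (smooth_opp (smooth_scale 2 sxi)) sq) (smooth_mul (sr r) sdq))).
  - move=> x Qx; have Qx' := Qx; move: Qx' => [+ h2]; rewrite ltr_norml => /andP[h1 h1'].
    apply: cvgM; first exact: cvg_cst.
    set A := - (2 * xi x) * q.[xi x]; set B := q^`().[xi x].
    rewrite [X in _ --> X](_ : _ = (A + (r ^+ 2 - xi x ^+ 2) * B) * 1 +
      q.[xi x] * ((r - xi x) * 0 * 1 - (r + xi x) * 1 * 0) * 1); last by ring.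
    apply: cvgD; apply: cvgM; last exact: bump2_cvg.
    + apply: cvgD; first exact: cvg_cst.
      apply: cvgM; last exact: cvg_cst.
      apply: cvgB; last exact: cvg_cst.
      by rewrite expr2; under eq_fun do rewrite expr2; apply: cvgM.
    + exact: ecvg.
    apply: cvgM; first exact: cvg_cst.
    have p1 : 0 < r + 1 * co i (x - m) by lra.
    have p2 : 0 < r + -1 * co i (x - m) by lra.
    apply: cvgB.
      apply: cvgM; last exact: bs0_cvg.
      apply: cvgM; last exact: bs1_cvg.
      by apply: cvgB => //; exact: cvg_cst.
    apply: cvgM; last exact: bs1_cvg.
    apply: cvgM; last exact: bs0_cvg.
    by apply: cvgD => //; exact: cvg_cst.
  - by apply: itgZ => //; apply: inL2_itg_abs => //; exact: rect_fin.
  - move=> n x Qx; rewrite normrM mulrC ler_wpM2r//.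
    have [hx [hq hq']] := qb x Qx.
    have /andP[e0 e1] := e01 n x.
    have /andP[n0 n1] := rn0 n.
    have /andP[u0 u1] := bump2_01 n (rev_ord i) s m x.
    have hd a : `|a| <= r -> `|rn n + a| <= 2 * r.
      by move=> ha; apply: le_trans (ler_normD _ _) _; rewrite ger0_norm//; lra.
    have hd1 := hd _ hx; have hd2 : `|rn n - xi x| <= 2 * r by apply: hd; rewrite normrN.
    have bb k sg : (k < 2)%N -> `|b k n sg x| <= 1.
      by case: k => [|[|//]] _; rewrite ger0_norm ?eb_ge0 ?eb0_le1 ?eb1_le1.
    have M1 (u v U V : R) : `|u| <= U -> `|v| <= V -> `|u * v| <= U * V.
      by move=> hu hv; rewrite normrM ler_pM.
    have A1 (u v U V : R) : `|u| <= U -> `|v| <= V -> `|u + v| <= U + V.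
      by move=> hu hv; apply: le_trans (ler_normD _ _) _; exact: lerD.
    have e1' : `|e n x| <= 1 by rewrite ger0_norm.
    have u1' : `|bump2 n (rev_ord i) s m x| <= 1 by rewrite ger0_norm.
    apply: (A1).
      rewrite -[leRHS]mulr1; apply: (M1) => //; apply: (A1); apply: (M1) => //.
        by rewrite normrN normrM ger0_norm//; lra.
      apply: le_trans (ler_normB _ _) _; rewrite !normrX mulrDl mul1r.
      by apply: lerD; rewrite lerXn2r ?nnegrE// ?(ltW r0)// ger0_norm.
    rewrite -[leRHS]mulr1; apply: (M1) => //.
    have -> : 4 * r * M = M * (2 * r * 1 * 1 + 2 * r * 1 * 1) by ring.
    apply: (M1) => //; apply: (A1); last rewrite normrN.
      by apply: (M1 _ _ (2 * r * 1) 1); [apply: (M1) => //; exact: bb|exact: bb].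
    by apply: (M1 _ _ (2 * r * 1) 1); [apply: (M1) => //; exact: bb|exact: bb].
have C2 : - I2 (rect i r s m) (fun x => f1 x * (P n x * e n x)) @[n --> \oo] -->
   - I2 (rect i r s m) (fun x => f1 x * ((r ^+ 2 - xi x ^+ 2) * q.[xi x])).
  apply: cvgN.
  apply: (@I2_dct _ _ _ (fun x => (2 * r ^+ 2 * M) * `|f1 x|)) => //.
  - move=> n; apply: measurable_funM; first exact: inL2_meas f1Q.
    exact: (meas_smooth (smooth_mul (sP n) (se n))).
  - apply: measurable_funM; first exact: inL2_meas f1Q.
    exact: (meas_smooth (smooth_mul (sr r) sq)).
  - move=> x Qx; apply: cvgM; first exact: cvg_cst.
    rewrite -[X in _ --> X]mulr1; apply: cvgM; last exact: ecvg.
    apply: cvgM; last exact: cvg_cst.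
    apply: cvgB; last exact: cvg_cst.
    by rewrite expr2; under eq_fun do rewrite expr2; apply: cvgM.
  - by apply: itgZ => //; apply: inL2_itg_abs => //; exact: rect_fin.
  - move=> n x Qx; rewrite normrM mulrC ler_wpM2r//.
    have [hx [hq hq']] := qb x Qx.
    have /andP[e0 e1] := e01 n x.
    have /andP[n0 n1] := rn0 n.
    rewrite normrM (ger0_norm e0) -[leRHS]mulr1 ler_pM//.
    rewrite /P normrM ler_pM//.
    apply: le_trans (ler_normB _ _) _; rewrite !normrX mulrDl mul1r.
    by apply: lerD; rewrite lerXn2r ?nnegrE// ?(ltW r0)// ger0_norm.
apply: (cvg_unique _ C1); first exact: norm_hausdorff.
rewrite (_ : (fun n => _) = (fun n => - I2 (rect i r s m) (fun x => f1 x * (P n x * e n x))))//.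
apply/funext => n.
have eout x : ~ rect i r s m x -> e n x = 0.
  move=> nx; rewrite /e; have [h1|h1] := ltP `|co i (x - m)| r; last by rewrite bump2_supp0// mul0r.
  have [h2|h2] := ltP `|co (rev_ord i) (x - m)| s; last by rewrite (@bump2_supp0 _ (rev_ord i))// !mulr0.
  by case: nx.
have T := @test_function_cut D (P n) n i r s m r0 s0 sub (sP n).
have := H _ T.
rewrite (@I2_supp D (rect i r s m))//; last first.
  move=> x Dx nx; rewrite dE /d eout// mulr0 add0r.
  have [h2|h2] := ltP `|co (rev_ord i) (x - m)| s; last by rewrite (@bump2_supp0 _ (rev_ord i))// !mulr0.
  have [h1|h1] := ltP `|co i (x - m)| r; first by case: nx.
  have bout k sg : r + sg * co i (x - m) <= 0 -> b k n sg x = 0.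
    move=> h; rewrite /b /bs /eb ifF//; apply/negbTE; rewrite -leNgt.
    have : n.+1%:R * (r + sg * co i (x - m)) <= 0 by rewrite pmulr_rle0// ltr0n.
    lra.
  move: h1; rewrite ler_normr => /orP[h1|h1].
    by rewrite !(bout _ (-1)) ?mulr0 ?mul0r ?subr0 ?mulr0 ?mul0r ?mulr0//; lra.
  by rewrite !(bout _ 1) ?mulr0 ?mul0r ?subr0 ?mulr0 ?mul0r ?mulr0//; lra.
rewrite (@I2_supp D (rect i r s m) (fun x => f1 x * _))//; last first.
  by move=> x Dx nx; rewrite -/(e n x) eout// !mulr0.
by move=> <-; apply: I2_eq => x _; rewrite dE.
Qed.
End Cutoff.

(** * The fundamental lemma of the calculus of variations *)

Section FL.
Context {R : realType}.
Local Notation R2 := (R * R)%type.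
Local Notation M2 := (measurableTypeR R * measurableTypeR R)%type.
Implicit Types (f g : R2 -> R) (i j : 'I_2) (x m : R2) (D E : set R2).

(** Bounded open boxes generate the measurable sets, and over a box the integral
is accessible to the cutoff functions. *)
Definition boxes : set (set M2) := [set A | exists a b c d : R,
  A = `]a, b[%classic `*` `]c, d[%classic].

Lemma boxes_gen : (@measurable _ M2) = <<s boxes >>.
Proof.
have itvT : (setT : set R) = \bigcup_n `](- n%:R), n%:R[%classic.
  apply/seteqP; split => // x _; exists (Num.truncn `|x|).+1 => //=.
  rewrite in_itv /= -ltr_norml.
  exact: truncnS_gt.
apply/seteqP; split; last first.
  apply: smallest_sub; first exact: (sigma_algebra_measurable M2).
  by move=> _ [a [b [c [d ->]]]]; apply: measurableX; exact: measurable_itv.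
rewrite measurable_prod_measurableType.
have SA := smallest_sigma_algebra [set: M2] boxes.
have [S0 SC SU] := SA.
have SCT (A : set M2) : <<s boxes >> A -> <<s boxes >> (~` A).
  by move=> /SC; rewrite setTD.
have SI (A B : set M2) : <<s boxes >> A -> <<s boxes >> B -> <<s boxes >> (A `&` B).
  move=> hA hB; rewrite -[A `&` B]setCK; apply: (SCT); rewrite setCI -bigcup2E; apply: (SU) => -[|[|n]] /=.
  - exact: SCT.
  - exact: SCT.
  - exact: S0.
have L1 (A : set R) : measurable (A : set (measurableTypeR R)) -> <<s boxes >> (A `*` setT).
  move=> mA; have sA : (@RGenOpens.G R).-sigma.-measurable (A : set (g_sigma_algebraType (@RGenOpens.G R))).
    by rewrite -(RGenOpens.measurableE R).
  suff H : <<s (@RGenOpens.G R) >> `<=` [set A : set R | <<s boxes >> (A `*` setT)] by exact: (H A sA).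
  apply: smallest_sub; last first.
    move=> _ [a [b ->]] /=; rewrite itvT setX_bigcupr; apply: (SU) => n.
    by apply: sub_gen_smallest; exists a, b, (- n%:R), n%:R.
  split => /=.
  - by rewrite set0X.
  - move=> B hB; rewrite setTD.
    rewrite (_ : ~` B `*` setT = ~` (B `*` setT)); first exact: SCT.
    by apply/seteqP; split => -[u v] /= h; [case: h => h _ [] |split => // Bu; apply: h].
  - move=> F hF; rewrite setX_bigcupl; exact: SU.
have L2 (A : set R) : measurable (A : set (measurableTypeR R)) -> <<s boxes >> (setT `*` A).
  move=> mA; have sA : (@RGenOpens.G R).-sigma.-measurable (A : set (g_sigma_algebraType (@RGenOpens.G R))).
    by rewrite -(RGenOpens.measurableE R).
  suff H : <<s (@RGenOpens.G R) >> `<=` [set A : set R | <<s boxes >> (setT `*` A)] by exact: (H A sA).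
  apply: smallest_sub; last first.
    move=> _ [a [b ->]] /=; rewrite itvT setX_bigcupl; apply: (SU) => n.
    by apply: sub_gen_smallest; exists (- n%:R), n%:R, a, b.
  split => /=.
  - by rewrite setX0.
  - move=> B hB; rewrite setTD.
    rewrite (_ : setT `*` ~` B = ~` (setT `*` B)); first exact: SCT.
    by apply/seteqP; split => -[u v] /= h; [case: h => _ h [] |split => // Bu; apply: h].
  - move=> F hF; rewrite setX_bigcupr; exact: SU.
apply: smallest_sub => // _ [A mA [B mB <-]].
rewrite (_ : A `*` B = (A `*` setT) `&` (setT `*` B)); last first.
  by apply/seteqP; split => -[u v] /=; [move=> [? ?]; split|move=> [[? _] [_ ?]]].
by apply: (SI); [exact: L1|exact: L2].
Qed.

Lemma I2_setU D E f : meas D -> meas E -> itg (D `|` E) f -> D `&` E = set0 ->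
  I2 (D `|` E) f = I2 D f + I2 E f.
Proof.
move=> mD mE fi DE; rewrite /I2 Rintegral_setU//.
by rewrite disj_set2E DE.
Qed.

(** By [I2_rect_eq0] the integral of g vanishes over every box inside the
rectangle; as boxes form a pi-system, it vanishes over every measurable subset. *)
Lemma weak_eq0 r s m g : 0 < r -> 0 < s -> inL2 (rect ord0 r s m) g ->
  (forall psi, test_function (rect ord0 r s m) psi ->
     I2 (rect ord0 r s m) (fun x => g x * psi x) = 0) ->
  ae_eq (@leb2 R) (rect ord0 r s m : set M2) (g : M2 -> R) (cst 0).
Proof.
move=> r0 s0 gL H; set K := rect ord0 r s m.
have mK : meas K by exact: rect_meas.
have gK : itg K g by apply: inL2_itg => //; exact: rect_fin.
have K0 i' r' s' m' : 0 < r' -> 0 < s' -> rect i' r' s' m' `<=` K -> I2 (rect i' r' s' m') g = 0.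
  by move=> ? ? ?; apply: (@I2_rect_eq0 _ K).
have P E : meas E -> I2 (E `&` K) g = 0.
  rewrite /meas boxes_gen => sE.
  apply: (@dynkin_induction _ M2 boxes (fun E => I2 (E `&` K) g = 0) boxes_gen) sE => {E}.
  - move=> _ _ [a [b [c [d ->]]]] [a' [b' [c' [d' ->]]]].
    exists (Num.max a a'), (Num.min b b'), (Num.max c c'), (Num.min d d').
    apply/seteqP; split => -[u v] /=; rewrite !in_itv /=.
      move=> [[/andP[h1 h2] /andP[h3 h4]] [/andP[h5 h6] /andP[h7 h8]]].
      by rewrite !gt_max !lt_min h1 h2 h3 h4 h5 h6 h7 h8.
    move=> [/andP[]]; rewrite !gt_max !lt_min => /andP[-> ->] /andP[-> ->].
    by move=> /andP[/andP[-> ->] /andP[-> ->]].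
  - by rewrite setTI; exact: K0.
  - move=> _ [a [b [c [d ->]]]].
    set a1 := Num.max a (m.1 - r); set b1 := Num.min b (m.1 + r).
    set c1 := Num.max c (m.2 - s); set d1 := Num.min d (m.2 + s).
    have E : (`]a, b[%classic `*` `]c, d[%classic) `&` K = `]a1, b1[%classic `*` `]c1, d1[%classic.
      rewrite /K rect0; apply/seteqP; split => -[u v] /=; rewrite !in_itv /=.
        move=> [[/andP[h1 h2] /andP[h3 h4]] [/andP[h5 h6] /andP[h7 h8]]].
        by rewrite !gt_max !lt_min h1 h2 h3 h4 h5 h6 h7 h8.
      move=> [/andP[]]; rewrite !gt_max !lt_min => /andP[-> ->] /andP[-> ->].
      by move=> /andP[/andP[-> ->] /andP[-> ->]].
    have [ab|ab] := ltP a1 b1; last first.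
      by rewrite E set_itv_ge ?set0X ?/I2 ?Rintegral_set0// bnd_simp -leNgt.
    have [cd|cd] := ltP c1 d1; last first.
      by rewrite E (@set_itv_ge _ _ (BRight c1)) ?setX0 ?/I2 ?Rintegral_set0// bnd_simp -leNgt.
    pose m1 : R2 := ((a1 + b1) / 2, (c1 + d1) / 2).
    have E' : `]a1, b1[%classic `*` `]c1, d1[%classic = rect ord0 ((b1 - a1) / 2) ((d1 - c1) / 2) m1.
      by rewrite rect0 /m1 /=; congr (_ `*` _); apply/seteqP; split => u /=; rewrite !in_itv /= => /andP[? ?]; apply/andP; split; lra.
    rewrite E E'; apply: K0; try lra.
    by rewrite -E' -E; exact: subIsetr.
  - move=> S mS HS.
    have mS1 : meas (S `&` K) by exact: measurableI.
    have mS2 : meas (~` S `&` K) by apply: measurableI => //; exact: measurableC.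
    have EK : (S `&` K) `|` (~` S `&` K) = K by rewrite -setIUl setUCr setTI.
    have := @I2_setU (S `&` K) (~` S `&` K) g mS1 mS2.
    rewrite EK HS add0r => /(_ gK) <-; first exact: K0.
    by apply/seteqP; split => // x [[? _] []].
  - move=> F mF tF HF.
    rewrite /I2 /Rintegral setI_bigcupl integral_bigcup//.
    + rewrite eseries0// => k _ _.
      have := HF k; rewrite /I2 /Rintegral => h.
      rewrite -[LHS]fineK ?h//.
      apply: integrable_fin_num; first exact: measurableI.
      by apply: (itg_sub mK) gK; [exact: measurableI|exact: subIsetr].
    + by apply/trivIsetP => k l _ _ kl; move/trivIsetP : tF => /(_ k l I I kl) h; rewrite setIACA h set0I.
    + by move=> k; exact: measurableI.
    + apply: (itg_sub mK) gK; last by rewrite -setI_bigcupl; exact: subIsetr.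
      by apply: bigcup_measurable => k _; exact: measurableI.
have : ae_eq (@leb2 R) (K : set M2) (EFin \o (g : M2 -> R)) (cst 0%E).
  apply: integral_ae_eq => // E EK mE.
  rewrite integral0 -[LHS]fineK.
    by have := P E mE; rewrite setIidl// /I2 /Rintegral => ->.
  by apply: integrable_fin_num => //; exact: (itg_sub mK) gK.
by apply: filterS => x h Kx; have [] := h Kx.
Qed.

End FL.

(** * Uniform meshes of squares *)

Section Mesh.
Context {R : realType}.
Local Notation R2 := (R * R)%type.
Local Notation M2 := (measurableTypeR R * measurableTypeR R)%type.
Local Notation leb := (@lebesgue_measure R).
Implicit Types (f g : R2 -> R) (i j : 'I_2) (x m c : R2) (D E : set R2) (h : R) (T : {fset R2}).

Lemma eltE i h c : elt h c = crect i h h c.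
Proof.
by case: (ord2P i) => ->; rewrite /elt /crect rev_ord2 /co /=; apply/seteqP; split => x /= [? ?].
Qed.

Definition cell h c : set R2 := rect ord0 h h c.

Lemma cellE i h c : cell h c = rect i h h c.
Proof. by case: (ord2P i) => -> //; rewrite -rect_rev rev_ord2. Qed.

Lemma rect_crect i r s m : rect i r s m `<=` crect i r s m.
Proof. by move=> x [/ltW ? /ltW ?]. Qed.

Lemma cell_elt h c : cell h c `<=` elt h c.
Proof. by rewrite (eltE ord0); exact: rect_crect. Qed.

Lemma line_cvg i x (a : R) : (x + (a * d) *: ei i) @[d --> (0:R)^'+] --> x.
Proof.
apply: cvg_at_right_filter; rewrite -[X in _ --> X]addr0; apply: cvgD; first exact: cvg_cst.
rewrite -[X in _ --> X](scale0r (a *: ei i : R2)).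
under eq_fun do rewrite mulrC -scalerA.
by apply: cvgZr_tmp; exact: cvg_id.
Qed.

(** From a point on a side one leaves the element by an arbitrarily small move
along the normal. *)
Lemma interior_elt h c : 0 < h -> (elt h c)° = cell h c.
Proof.
move=> h0; apply/seteqP; split; last first.
  by rewrite -open_subsetE; [exact: cell_elt|exact: rect_open].
have H i x : (elt h c)° x -> `|co i (x - c)| < h.
  rewrite (eltE i) => ix; have [hx _] := interior_subset ix.
  rewrite lt_neqAle hx andbT; apply/eqP => hE.
  pose a : R := if 0 <= co i (x - c) then 1 else -1.
  have /(_ _ ix) := @line_cvg i x a.
  rewrite /= /nbhs /= => /(@filterI _ (0:R)^'+ _ _ _ (nbhs_right_gt (0:R))).
  move=> /filter_ex[d /= [d0 [hd _]]].
  move: hd; rewrite -addrA [(a * d) *: _ - c]addrC addrA coD coZ co_ei mulr1.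
  rewrite leNgt => /negP; apply.
  move: hE; rewrite /a; case: ifPn => [s0|]; last rewrite -ltNge => s0.
    by rewrite ger0_norm// => ->; rewrite ger0_norm; lra.
  by rewrite ltr0_norm// => hE; rewrite ltr0_norm; lra.
move=> x ix; split; first exact: (H ord0).
exact: H.
Qed.

Lemma ae_leb2_filter : Filter (almost_everywhere (@leb2 R)).
Proof. exact: (@ae_filter_ringOfSetsType _ _ _ (@leb2 R)). Qed.
(* These make statements almost everywhere for [leb2] usable as a filter. *)
Existing Instance ae_leb2_filter.
Hint Extern 0 (Filter (nbhs (almost_everywhere (@leb2 _)))) =>
  (exact: ae_leb2_filter) : typeclass_instances.

Lemma ae_line i (a : R) : {ae @leb2 R, forall x, co i x != a}.
Proof.
pose N : set R2 := if i == ord0 then [set a] `*` setT else setT `*` [set a].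
have mS : measurable ([set a] : set (measurableTypeR R)) by exact: measurable_set1.
exists N; split.
- by rewrite /N; case: ifP => _; apply: measurableX.
- rewrite /N; case: ifP => _; rewrite leb2X// ?[leb [set a]]lebesgue_measure_set1 ?mul0e ?mule0//.
- move=> x /= /negP; rewrite negbK /N /co; case: ifP => _ /eqP <- /=; by split.
Qed.

Lemma ae_seq (s : seq R2) (P : R2 -> R2 -> Prop) :
  (forall c, {ae @leb2 R, forall x, P c x}) -> {ae @leb2 R, forall x, forall c, c \in s -> P c x}.
Proof.
move=> H; elim: s => [|c s IH]; first by apply: aeW => x c; rewrite in_nil.
apply: filterS2 (H c) IH => x Pc Ps c'; rewrite in_cons => /predU1P[->//|]; exact: Ps.
Qed.

Lemma co_onedge h c F x : edge h c F -> edge_set h F x -> `|co F.1 (x - c)| = `|h|.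
Proof.
move=> eF [t _ <-]; rewrite /edge_pt.
have [->|->] : co F.1 (F.2 + t *: ei (rev_ord F.1) - c) = h \/ co F.1 (F.2 + t *: ei (rev_ord F.1) - c) = - h.
- by case: eF => ->; rewrite !coE; [left|right]; ring.
- by [].
- by rewrite normrN.
Qed.

Section OneMesh.
Context (D : set R2) (h : R) (T : {fset R2}) (mesh : uniform_mesh D h T).

Lemma mesh_h0 : 0 < h. Proof. by case: mesh. Qed.

Lemma mesh_open : open D.
Proof. by case: mesh => _ -> _; exact: open_interior. Qed.

Lemma mesh_meas : meas D. Proof. by apply: open_meas; exact: mesh_open. Qed.

Lemma open_in_mesh E : open E -> (forall x, E x -> exists2 c, c \in T & elt h c x) -> E `<=` D.
Proof.
case: mesh => _ -> _ oE H; rewrite -open_subsetE// => x /H[c cT ex]; by exists c.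
Qed.

Lemma mesh_elt x : D x -> exists2 c, c \in T & elt h c x.
Proof. by case: mesh => _ -> _ /interior_subset[c /= cT ex]; exists c. Qed.

Lemma cell_sub c : c \in T -> cell h c `<=` D.
Proof.
move=> cT; apply: open_in_mesh; first exact: rect_open.
by move=> x /cell_elt ?; exists c.
Qed.

Lemma cell_meas c : meas (cell h c). Proof. exact: rect_meas. Qed.

(** The two elements also cover their common edge, so the whole open rectangle
lies in the interior of the union. *)
Lemma patch_sub i c : c \in T -> c + (2 * h) *: ei i \in T ->
  rect i (2 * h) h (c + h *: ei i) `<=` D.
Proof.
move=> cT cT'; apply: open_in_mesh; first exact: rect_open.
move=> x []; rewrite !coE ?mulr0 ?mulr1 ?addr0 => h1 h2.
have [le|gt] := leP (co i x) (co i c + h).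
  exists c => //; rewrite (eltE i); split; rewrite !coE ?mulr0 ?mulr1 ?addr0; last exact: ltW.
  by move: h1; rewrite ler_norml ltr_norml => /andP[? ?]; apply/andP; split; lra.
exists (c + (2 * h) *: ei i) => //; rewrite (eltE i); split; rewrite !coE ?mulr0 ?mulr1 ?addr0; last first.
  exact: ltW.
by move: h1; rewrite ler_norml ltr_norml => /andP[? ?]; apply/andP; split; lra.
Qed.

Lemma mesh_bounded : exists2 M : R, 0 < M & D `<=` rect ord0 M M 0.
Proof.
have h0 := mesh_h0.
suff [M M0 HM] : exists2 M : R, 0 < M & forall c, c \in T -> `|c.1| < M /\ `|c.2| < M.
  exists (M + h) => [|x /mesh_elt[c /HM[h1 h2]]]; first lra.
  rewrite (eltE ord0) => -[]; rewrite rev_ord2 /co /= => h3 h4.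
  by split; rewrite ?rev_ord2 /co /= ?subr0; [have := ler_normD (x.1 - c.1) c.1|have := ler_normD (x.2 - c.2) c.2]; rewrite subrK; lra.
have : exists2 M : R, 0 < M & forall c, c \in enum_fset T -> `|c.1| < M /\ `|c.2| < M.
  elim: (enum_fset T) => [|c s [M M0 IH]]; first by exists 1 => // c; rewrite in_nil.
  exists (M + `|c.1| + `|c.2|) => [|c']; first by have := normr_ge0 c.1; have := normr_ge0 c.2; lra.
  have := normr_ge0 c.1; have := normr_ge0 c.2 => ? ?.
  by rewrite in_cons => /predU1P[->|/IH[? ?]]; split; lra.
by [].
Qed.

Lemma mesh_fin : (@leb2 R D < +oo)%E.
Proof.
have [M M0 HM] := mesh_bounded.
apply: le_lt_trans (rect_fin ord0 M M 0); apply: le_measure => //; rewrite inE.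
  exact: mesh_meas.
exact: rect_meas.
Qed.

(** The cells are disjoint, a common vertex or edge being made of points of the
sides, and they exhaust the domain up to the null lines that carry the sides. *)
Lemma I2_mesh f : itg D f -> I2 D f = \sum_(c <- T) I2 (cell h c) f.
Proof.
move=> fi; have mD := mesh_meas; have h0 := mesh_h0.
pose fc c := f \_ (cell h c).
have R1 E : I2 E f = I2 setT (f \_ E) by rewrite /I2 Rintegral_mkcond.
have iE E : meas E -> itg E f -> itg setT (f \_ E).
  by move=> mE /(integrable_mkcond _ mE); rewrite /itg restrict_EFin.
have ic c : c \in T -> itg setT (fc c).
  move=> cT; apply: iE; first exact: cell_meas.
  exact: (itg_sub mD (cell_meas c) (cell_sub cT)).
have -> : \sum_(c <- T) I2 (cell h c) f = \sum_(c <- T | c \in T) I2 setT (fc c).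
  by rewrite big_seq; apply: eq_bigr => c _; rewrite R1.
rewrite -I2_sum//; last exact: measurableT.
rewrite R1; apply: I2_ae; first exact: measurableT.
- by apply: itg_meas; apply: iE.
- by apply: itg_meas; apply: itg_sum => //; exact: measurableT.
have L : {ae @leb2 R, forall x, forall c, c \in enum_fset T ->
    [/\ co ord0 x != co ord0 c + h, co ord0 x != co ord0 c - h,
        co ord_max x != co ord_max c + h & co ord_max x != co ord_max c - h]}.
  apply: ae_seq => c.
  apply: filterS2 (filterI (ae_line ord0 (co ord0 c + h)) (ae_line ord0 (co ord0 c - h)))
    (filterI (ae_line ord_max (co ord_max c + h)) (ae_line ord_max (co ord_max c - h))).
  by move=> x [? ?] [? ?]; split.
apply: filterS L => x Lx _.
have Lx' i c : c \in T -> `|co i (x - c)| <> h.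
  move=> /Lx [/eqP a1 /eqP a2 /eqP a3 /eqP a4] E.
  have [E1|E1] : co i x = co i c + h \/ co i x = co i c - h.
  - by move: E; rewrite !coE; case: (ger0P (co i x - co i c)) => _ ?; [left|right]; lra.
  - by case: (ord2P i) E1 => ->.
  - by case: (ord2P i) E1 => ->.
have Lelt c : c \in T -> elt h c x -> cell h c x.
  by move=> cT; rewrite (eltE ord0) => -[e1 e2]; split; rewrite lt_neqAle ?e1 ?e2 andbT; apply/eqP; exact: Lx'.
rewrite patchE; case: ifPn => [/set_mem Dx|nDx].
  have [c cT /(Lelt _ cT) cx] := mesh_elt Dx.
  rewrite -big_seq (bigD1_seq c)//= ?fset_uniq// big1_seq ?addr0.
    by rewrite /fc patchE mem_set.
  move=> c' /andP[c'c c'T]; rewrite /fc patchE ifF//; apply/negbTE/negP => /set_mem c'x.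
  case: mesh => _ _ /(_ c c' cT c'T); rewrite eq_sym => /(_ c'c).
  have I : (elt h c `&` elt h c') x by split; exact: cell_elt.
  case=> [E|[a [va _] E]|[F [eF _] E]]; rewrite E in I => //.
    by move: va; rewrite -I => -[+ _]; have := Lx' ord0 _ cT; rewrite /co.
  by have := co_onedge eF I; rewrite (gtr0_norm h0); exact: Lx'.
rewrite big1// => c cT; rewrite /fc patchE ifF//; apply/negbTE/negP => /set_mem cx.
by move/negP: nDx; apply; apply/mem_set/(cell_sub cT).
Qed.

(** If a point in the relative interior of an edge lay in the domain, points just
beyond the edge would belong to another element, and that element would contain the
point too.  The intersection of the two elements is a vertex or a whole edge, which
forces the second element to be the missing neighbour. *)
Lemma no_neighbour i (a : R) c (t : R) : (a = 1 \/ a = -1) -> c \in T ->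
  c + (a * 2 * h) *: ei i \notin T -> `|t| < h ->
  ~ D (c + (a * h) *: ei i + t *: ei (rev_ord i)).
Proof.
move=> aE cT cnT th Dy; set y := _ + _ in Dy.
have h0 := mesh_h0.
have na : `|a| = 1 by case: aE => ->; rewrite ?normrN normr1.
have aa : a * a = 1 by case: aE => ->; lra.
(* The elements that do not contain y are closed, hence avoid a neighbourhood of y. *)
have near_elt (s : seq R2) : nbhs y [set z | forall c', c' \in s -> elt h c' z -> elt h c' y].
  elim: s => [|c' s IH]; first by apply: filterS filterT => z _ c'; rewrite in_nil.
  have [yc|yc] := pselect (elt h c' y).
    by apply: filterS IH => z Hz c''; rewrite in_cons => /predU1P[->//|]; exact: Hz.
  have : nbhs y [set z | ~ elt h c' z].
    apply: open_nbhs_nbhs; split => //.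
    by rewrite (eltE ord0); apply/closed_openC/crect_closed.
  apply: filterS2 IH => z Hz nz c''; rewrite in_cons => /predU1P[->//|]; exact: Hz.
have nD : nbhs y D by apply: open_nbhs_nbhs; split => //; exact: mesh_open.
have := @line_cvg i y a; move=> /(_ _ (filterI nD (near_elt (enum_fset T)))).
rewrite /= /nbhs /= => /(@filterI _ (0:R)^'+ _ _ _ (nbhs_right_gt (0:R))).
move=> /filter_ex[d /= [d0 [/mesh_elt[c' c'T ez] /(_ c' c'T ez) ey]]].
have yc k : co k (y - c) = if k == i then a * h else t.
  rewrite /y !coE; case: (ord2P i) => ->; case: (ord2P k) => ->; rewrite ?rev_ord2 /co /ei /=; ring.
have cc' : c != c'.
  apply/eqP => E; move: ez; rewrite -E (eltE i) => -[+ _].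
  rewrite addrAC coD yc eqxx coZ co_ei mulr1 -mulrDr normrM na mul1r ger0_norm; lra.
have ec : elt h c y.
  have ah : `|a * h| = h by rewrite normrM na mul1r gtr0_norm.
  by rewrite (eltE i); split; rewrite yc ?eqxx ?ah//; case: eqP => _; rewrite ?ah// ltW.
have I : (elt h c `&` elt h c') y by split.
case: mesh => _ _ /(_ c c' cT c'T cc').
have ri : (rev_ord i == i) = false by case: (ord2P i) => ->; rewrite rev_ord2.
case=> [E|[v [[v1 v2] _] E]|[F [eF eF'] E]]; rewrite E in I => //.
  have : `|co (rev_ord i) (y - c)| = h.
    by rewrite (I : y = v); case: (ord2P i) => ->; rewrite rev_ord2 /co.
  by rewrite yc ri => E'; move: th; rewrite E' ltxx.
have := co_onedge eF I; rewrite yc (gtr0_norm h0).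
case: eqP => [Fi _|_ E']; last by move: th; rewrite E' ltxx.
case: I => s _; rewrite /edge_pt Fi => Ey.
have F2 : co i F.2 = co i c + a * h.
  have := congr1 (co i) Ey; rewrite !coE mulr0 addr0 => ->.
  by have := yc i; rewrite eqxx coB => <-; ring.
have FE : F.2 = c + (a * h) *: ei i.
  apply: (@co_inj _ i); rewrite !coE; first by rewrite F2 mulr1.
  by case: eF; rewrite Fi => ->; rewrite !coE; ring.
have : c' = c + (a * 2 * h) *: ei i \/ c' = c.
  move: eF'; rewrite /edge /= Fi FE => -[E'|E'].
    have -> : c' = c + (a * h) *: ei i - h *: ei i by rewrite E' addrK.
    case: aE => ->; [right|left].
      by rewrite mul1r addrK.
    apply: (@co_inj _ i); rewrite !coE; ring.
  have -> : c' = c + (a * h) *: ei i + h *: ei i by rewrite E' subrK.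
  case: aE => ->; [left|right].
    by apply: (@co_inj _ i); rewrite !coE; ring.
  by rewrite mulN1r scaleNr subrK.
by case=> E'; [move: cnT; rewrite -E' c'T|move: cc'; rewrite E' eqxx].
Qed.

End OneMesh.
End Mesh.

(** * Edge integrals and the symmetry of second derivatives *)

Section Lines.
Context {R : realType}.
Local Notation R2 := (R * R)%type.
Local Notation M2 := (measurableTypeR R * measurableTypeR R)%type.
Local Notation leb := (@lebesgue_measure R).
Implicit Types (f g : R2 -> R) (i j : 'I_2) (x m c : R2) (D E : set R2) (h r s : R).

Lemma line_itg i s m f : continuous f ->
  leb.-integrable (`[- s, s]%classic : set (measurableTypeR R)) (EFin \o (fun t => f (m + t *: ei (rev_ord i)))).
Proof. by move=> cf; apply: itg1_cont; exact: line_continuous. Qed.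

Lemma lineD i s m f g : continuous f -> continuous g ->
  line i s m (fun x => f x + g x) = line i s m f + line i s m g.
Proof. by move=> cf cg; rewrite /line RintegralD//; exact: line_itg. Qed.

Lemma lineB i s m f g : continuous f -> continuous g ->
  line i s m (fun x => f x - g x) = line i s m f - line i s m g.
Proof. by move=> cf cg; rewrite /line RintegralB//; exact: line_itg. Qed.

Lemma lineZ i s m a f : continuous f -> line i s m (fun x => a * f x) = a * line i s m f.
Proof. by move=> cf; rewrite /line RintegralZl//; exact: line_itg. Qed.

Lemma line_cst i s m a : 0 < s -> line i s m (fun=> a) = 2 * s * a.
Proof.
move=> s0; rewrite /line Rintegral_cst//= lebesgue_measure_itv /= lte_fin ifT; last lra.
rewrite -EFinB /=; ring.
Qed.

Lemma line_eq i s m f g : (forall t, - s <= t <= s -> f (m + t *: ei (rev_ord i)) = g (m + t *: ei (rev_ord i))) ->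
  line i s m f = line i s m g.
Proof. by move=> H; apply: eq_Rintegral => t /set_mem /=; rewrite in_itv /=; exact: H. Qed.

Lemma line_eq_oo i s m f g : continuous f -> continuous g ->
  (forall t, - s < t < s -> f (m + t *: ei (rev_ord i)) = g (m + t *: ei (rev_ord i))) ->
  line i s m f = line i s m g.
Proof.
move=> cf cg H; rewrite /line -!I1_oo_cc; try exact: line_continuous.
by apply: eq_Rintegral => t /set_mem /=; rewrite in_itv /=; exact: H.
Qed.

Lemma line_le i s m f g : continuous f -> continuous g ->
  (forall t, - s <= t <= s -> f (m + t *: ei (rev_ord i)) <= g (m + t *: ei (rev_ord i))) ->
  line i s m f <= line i s m g.
Proof.
by move=> cf cg H; apply: le_Rintegral => //; try exact: line_itg.
Qed.

Lemma line_ftc i s m f : 0 < s -> smooth f ->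
  line i s m ('D_(ei (rev_ord i)) f) = f (m + s *: ei (rev_ord i)) - f (m - s *: ei (rev_ord i)).
Proof.
move=> s0 sf; rewrite /line.
have dF t : is_derive t (1:R) (fun t => f (m + t *: ei (rev_ord i)))
    ('D_(ei (rev_ord i)) f (m + t *: ei (rev_ord i))) by exact: smooth_line.
rewrite (int_derive _ _ dF) ?scaleNr//; first lra.
apply: (@line_continuous _ ('D_(ei (rev_ord i)) f)).
by apply: smooth_continuous; exact: smooth_D.
Qed.

Lemma I2_rect_cst i r s m a : 0 < r -> 0 < s -> I2 (rect i r s m) (fun=> a) = 4 * r * s * a.
Proof.
move=> r0 s0.
have sf : smooth (fun x => a * co i (x - m)) by apply: smooth_scale; exact: smooth_coc.
have := gauss i m r0 s0 sf.
rewrite (_ : 'D_(ei i) _ = fun=> a); last first.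
  by apply/funext => x; rewrite pdZ ?pd_coc ?eqxx ?mulr1//; exact: smooth_coc.
move=> ->.
have E1 : line i s (m + r *: ei i) (fun x => a * co i (x - m)) = line i s (m + r *: ei i) (fun=> a * r).
  by apply: line_eq => t _; rewrite !coE; ring.
have E2 : line i s (m - r *: ei i) (fun x => a * co i (x - m)) = line i s (m - r *: ei i) (fun=> - (a * r)).
  by apply: line_eq => t _; rewrite !coE; ring.
rewrite E1 E2 !line_cst//; ring.
Qed.

(** Where a continuous function is positive, so is its integral over a small
square. *)
Lemma cont_rect_le0 f : continuous f ->
  (forall m r, 0 < r -> I2 (rect ord0 r r m) f <= 0) -> forall x, f x <= 0.
Proof.
move=> cf H x; rewrite leNgt; apply/negP => fx0.
have : nbhs x [set y | f x / 2 < f y].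
  have N : nbhs (f x) [set z | f x / 2 < z] by apply: lt_nbhsr; lra.
  exact: cf N.
rewrite -nbhs_ballE => -[e /= e0 He].
have := H x e e0; rewrite leNgt => /negP; apply.
apply: (@lt_le_trans _ _ (I2 (rect ord0 e e x) (fun=> f x / 2))).
  by rewrite I2_rect_cst// mulr_gt0//; [rewrite !mulr_gt0|lra].
apply: I2_le; first exact: rect_meas.
- by apply: itg_cont => y; exact: cvg_cst.
- exact: itg_cont.
move=> y [h1 h2]; apply: ltW; apply: He.
rewrite /co /= in h1; rewrite rev_ord2 /co /= in h2.
by split; rewrite /ball /= distrC.
Qed.

Lemma cont_rect_eq f g : continuous f -> continuous g ->
  (forall m r, 0 < r -> I2 (rect ord0 r r m) f = I2 (rect ord0 r r m) g) -> f = g.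
Proof.
move=> cf cg H.
have le (u v : R2 -> R) : continuous u -> continuous v ->
    (forall m r, 0 < r -> I2 (rect ord0 r r m) u = I2 (rect ord0 r r m) v) -> forall x, u x <= v x.
  move=> cu cv E x; rewrite -subr_le0.
  have cw : continuous (fun x => u x - v x) by move=> y; apply: cvgB; [exact: cu|exact: cv].
  apply: (cont_rect_le0 cw) => m r r0.
  by rewrite I2B ?E ?subrr//; [exact: rect_meas|exact: itg_cont|exact: itg_cont].
apply/funext => x; apply/eqP; rewrite eq_le !le// => m r r0.
by rewrite H.
Qed.

(** The integrals of both mixed derivatives over a square are the same
alternating sum of the values of f at the vertices, and a continuous function is
determined by its integrals over squares. *)
Lemma schwarz i j f : smooth f -> 'D_(ei i) ('D_(ei j) f) = 'D_(ei j) ('D_(ei i) f).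
Proof.
move=> sf; have [->//|ij] := eqVneq i j.
have {ij} -> : j = rev_ord i.
  by move: ij; case: (ord2P i) => ->; case: (ord2P j) => -> //; rewrite rev_ord2.
have sD k l : smooth ('D_(ei k) ('D_(ei l) f)) by apply: smooth_D; exact: smooth_D.
have eqI k m r : 0 < r -> I2 (rect ord0 r r m) ('D_(ei k) ('D_(ei (rev_ord k)) f)) =
   f (m + r *: ei k + r *: ei (rev_ord k)) - f (m + r *: ei k - r *: ei (rev_ord k))
   - (f (m - r *: ei k + r *: ei (rev_ord k)) - f (m - r *: ei k - r *: ei (rev_ord k))).
  move=> r0; have sl := smooth_D (rev_ord k) sf; rewrite -/(cell r m) (cellE k) (gauss k m r0 r0 sl).
  by rewrite !line_ftc.
apply: (cont_rect_eq (smooth_continuous (sD _ _)) (smooth_continuous (sD _ _))).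
move=> m r r0; have E2 := eqI (rev_ord i) m r r0; rewrite rev_ordK in E2.
apply: (etrans (eqI i m r r0)); apply/esym; apply: (etrans E2).
set a := r *: ei i; set b := r *: ei (rev_ord i).
rewrite (addrAC m b a) (addrAC m b (- a)) (addrAC m (- b) a) (addrAC m (- b) (- a)); ring.
Qed.

Lemma pderiv_perm (s s' : seq 'I_2) f : smooth f -> perm_eq s s' -> pderiv s f = pderiv s' f.
Proof.
move=> sf; elim: s s' => [|i s IH] s'.
  by case: s' => [//|k l] /perm_size.
move=> p; have is' : i \in s' by rewrite -(perm_mem p) mem_head.
have [s1 [s2 E]] : exists s1 s2 : seq 'I_2, s' = s1 ++ i :: s2 by case/splitPr: is' => t1 t2; exists t1, t2.
have ps : perm_eq s (s1 ++ s2).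
  by rewrite -(perm_cons i) (perm_trans p)// E perm_catC /= perm_cons perm_catC.
rewrite /= (IH _ ps) E !pderiv_cat /=.
elim: s1 {E p ps} => [//|k s1 IH1] /=.
have sm : smooth (pderiv s1 (pderiv s2 f)) by apply: smooth_pderiv; exact: smooth_pderiv.
exact: (etrans (@schwarz i k _ sm) (congr1 (fun g => 'D_(ei k) g) IH1)).
Qed.

End Lines.

(** * Weak derivatives *)

Section Weak.
Context {R : realType}.
Local Notation R2 := (R * R)%type.
Local Notation M2 := (measurableTypeR R * measurableTypeR R)%type.
Local Notation leb := (@lebesgue_measure R).
Implicit Types (f g u psi phi : R2 -> R) (i j : 'I_2) (x m c : R2) (D E : set R2) (h r : R) (s : seq 'I_2).

Lemma test_smooth D psi : test_function D psi -> smooth psi.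
Proof. by case. Qed.

Lemma test_out D psi x : test_function D psi -> ~ D x -> psi x = 0.
Proof.
move=> [_ _ sub] nD; apply/eqP; apply/negPn/negP => nz.
by apply/nD/sub; exact: subset_closure.
Qed.

Lemma test_D D psi i : test_function D psi -> test_function D ('D_(ei i) psi).
Proof.
move=> [sp cp sub].
have incl : closure [set x | 'D_(ei i) psi x != 0] `<=` closure [set x | psi x != 0].
  have /closure_id -> : closed (closure [set x | psi x != 0]) by exact: closed_closure.
  apply: closureS => x /=; apply: contraNP => nx.
  have : nbhs x (~` closure [set x | psi x != 0]).
    by apply: open_nbhs_nbhs; split => //; exact/closed_openC/closed_closure.
  move=> N; apply/eqP; rewrite (@near_eq_derive _ _ _ psi (cst 0) x (ei i)); first exact: derive_cst.
  apply: filterS N => y ny /=; apply/eqP/negPn/negP => nz; apply: ny.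
  exact: subset_closure.
split; first exact: smooth_D.
  by apply: (subclosed_compact _ cp incl); exact: closed_closure.
exact: subset_trans incl sub.
Qed.

Lemma test_pderiv D psi s : test_function D psi -> test_function D (pderiv s psi).
Proof. by move=> tp; elim: s => //= i s; exact: test_D. Qed.

Lemma test_sub D E psi : E `<=` D -> test_function E psi -> test_function D psi.
Proof. by move=> ED [? ? s]; split => //; exact: subset_trans ED. Qed.

Section Bounded.
Context (D : set R2) (M : R).
Context (mD : meas D) (M0 : 0 < M) (DM : D `<=` rect ord0 M M 0).

Lemma bounded_smooth_inL2 f : smooth f -> inL2 D f.
Proof.
move=> sf; apply: (@inL2_sub _ (rect ord0 M M 0)) => //; first exact: rect_meas.
by apply: inL2_cont; exact: smooth_continuous.
Qed.

(** The product of f and the test function vanishes outside the domain, so the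
integrals may be taken over a large square, on whose sides there is no boundary
term. *)
Lemma ibp_test f psi i : smooth f -> test_function D psi ->
  I2 D (fun x => f x * 'D_(ei i) psi x) = - I2 D (fun x => 'D_(ei i) f x * psi x).
Proof.
move=> sf tp; have sp := test_smooth tp.
have td := test_D i tp.
have mQ := rect_meas ord0 M M (0 : R2).
have H g : (forall x, ~ D x -> g x = 0) -> I2 D g = I2 (rect ord0 M M 0) g.
  by move=> g0; apply/esym; apply: I2_supp => // x _; exact: g0.
rewrite H; last by move=> x nD; rewrite (test_out td nD) mulr0.
rewrite [in RHS]H; last by move=> x nD; rewrite (test_out tp nD) mulr0.
have sg : smooth (fun x => f x * psi x) by exact: smooth_mul.
have out x : `|co i x| = M -> f x * psi x = 0.
  move=> xM; rewrite (test_out tp) ?mulr0// => /DM; rewrite -/(cell M 0) (cellE i) => -[].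
  by rewrite subr0 xM ltxx.
have := gauss i (0 : R2) M0 M0 sg.
have z1 : line i M (0 + M *: ei i) (fun x => f x * psi x) = 0.
  rewrite (@line_eq _ _ _ _ _ (fun=> 0)) ?line_cst ?mulr0// => t _.
  by apply: out; rewrite !coE mulr0 addr0 mulr1 /co /= if_same add0r gtr0_norm.
have z2 : line i M (0 - M *: ei i) (fun x => f x * psi x) = 0.
  rewrite (@line_eq _ _ _ _ _ (fun=> 0)) ?line_cst ?mulr0// => t _.
  by apply: out; rewrite !coE mulr0 addr0 mulr1 /co /= if_same add0r normrN gtr0_norm.
rewrite z1 z2 subrr -(cellE i M 0).
have sfp : continuous (fun x => f x * 'D_(ei i) psi x).
  exact: (smooth_continuous (smooth_mul sf (smooth_D i sp))).
have spf : continuous (fun x => 'D_(ei i) f x * psi x).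
  exact: (smooth_continuous (smooth_mul (smooth_D i sf) sp)).
rewrite (@I2_eq _ _ ('D_(ei i) _) (fun x => f x * 'D_(ei i) psi x + 'D_(ei i) f x * psi x)); last first.
  by move=> x _; rewrite pdM// mulrC [psi x * _]mulrC addrC [RHS]addrC addrC.
rewrite I2D//; [|exact: itg_cont|exact: itg_cont].
by rewrite /cell => /eqP; rewrite addr_eq0 => /eqP.
Qed.

Lemma is_wderiv_smooth f s : smooth f -> is_wderiv D s f (pderiv s f).
Proof.
move=> sf; split; first by apply: bounded_smooth_inL2; exact: smooth_pderiv.
elim/last_ind: s f sf => [|s i IH] f sf psi tp; first by rewrite expr0 mul1r.
rewrite !pderiv_rcons size_rcons exprS mulN1r mulNr -IH//; last exact: smooth_D.
rewrite /dotL2 -/(I2 D _) -/(I2 D (fun x => 'D_(ei i) f x * _)).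
have -> : pderiv s ('D_(ei i) psi) = 'D_(ei i) (pderiv s psi).
  rewrite -pderiv_rcons -[RHS]/(pderiv (i :: s) psi).
  by apply: pderiv_perm; [exact: test_smooth tp|rewrite perm_rcons].
by apply: ibp_test => //; exact: test_pderiv.
Qed.

Lemma is_wderivB f f' s g g' : inL2 D f -> inL2 D f' ->
  is_wderiv D s f g -> is_wderiv D s f' g' -> is_wderiv D s (f \- f') (fun x => g x - g' x).
Proof.
move=> fL fL' [gL H] [gL' H']; split; first exact: inL2B.
move=> psi tp; have := H psi tp; have := H' psi tp.
have pL : inL2 D psi by apply: bounded_smooth_inL2; exact: test_smooth tp.
have pL' : inL2 D (pderiv s psi) by apply: bounded_smooth_inL2; exact: test_smooth (test_pderiv s tp).
rewrite /dotL2 -!/(I2 D _) => E' E.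
rewrite (@I2_eq _ _ (fun x => (f \- f') x * _) (fun x => f x * pderiv s psi x - f' x * pderiv s psi x)); last first.
  by move=> x _; rewrite mulrBl.
rewrite (@I2_eq _ _ (fun x => (g x - g' x) * _) (fun x => g x * psi x - g' x * psi x)); last first.
  by move=> x _; rewrite mulrBl.
by rewrite !I2B ?E ?E' ?mulrBr//; exact: inL2_itgM.
Qed.

End Bounded.

Lemma wderiv_spec D s f : (exists g, is_wderiv D s f g) -> is_wderiv D s f (wderiv D s f).
Proof. by move=> H; rewrite /wderiv; exact: (xgetPex _ H). Qed.

Lemma is_wderiv_sub D E s f g : meas D -> meas E -> E `<=` D ->
  is_wderiv D s f g -> is_wderiv E s f g.
Proof.
move=> mD mE ED [gL H]; split; first exact: inL2_sub gL.
move=> psi tp; have := H psi (test_sub ED tp).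
rewrite /dotL2 -!/(I2 D _) -!/(I2 E _) !(@I2_supp _ D E)//.
- by move=> x _ nE; rewrite (test_out tp nE) mulr0.
- by move=> x _ nE; rewrite (test_out (test_pderiv s tp) nE) mulr0.
Qed.

Lemma is_wderiv_ae h c s f g g' : 0 < h -> inL2 (cell h c) f ->
  is_wderiv (cell h c) s f g -> is_wderiv (cell h c) s f g' ->
  ae_eq (@leb2 R) (cell h c : set M2) (g : M2 -> R) g'.
Proof.
move=> h0 fL [gL H] [gL' H'].
have mK : meas (cell h c) by exact: rect_meas.
have : ae_eq (@leb2 R) (cell h c : set M2) ((fun x => g x - g' x) : M2 -> R) (cst 0).
  apply: weak_eq0 => //; first exact: inL2B.
  move=> psi tp; have := H psi tp; rewrite (H' psi tp) => /mulfI.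
  have pL : inL2 (cell h c) psi by apply: inL2_cont; apply: smooth_continuous; exact: test_smooth tp.
  rewrite expf_neq0 ?oppr_eq0 ?oner_eq0// => /(_ isT).
  rewrite /dotL2 -!/(I2 _ _) => E.
  rewrite (@I2_eq _ _ _ (fun x => g x * psi x - g' x * psi x)) => [|x _]; last by rewrite mulrBl.
  by rewrite I2B ?E ?subrr//; exact: inL2_itgM.
by apply: filterS => x Hx Kx; apply/eqP; rewrite -subr_eq0; apply/eqP; exact: Hx.
Qed.

(** As [wderiv] is an arbitrary choice among the weak derivatives, this uniqueness
is the only access to its values. *)
Lemma wderiv_cell_ae h c s f g : 0 < h -> inL2 (cell h c) f -> is_wderiv (cell h c) s f g ->
  ae_eq (@leb2 R) (cell h c : set M2) (wderiv (cell h c) s f : M2 -> R) g.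
Proof.
move=> h0 fL Hg; have Hw := wderiv_spec (ex_intro (is_wderiv (cell h c) s f) g Hg).
exact: (is_wderiv_ae h0 fL Hw Hg).
Qed.

End Weak.

(** * Density of test functions and identities for the eigenfunction *)

Section Density.
Context {R : realType}.
Local Notation R2 := (R * R)%type.
Local Notation M2 := (measurableTypeR R * measurableTypeR R)%type.
Implicit Types (f g psi phi : R2 -> R) (i j : 'I_2) (x m c : R2) (E : set R2) (r : R) (s : seq 'I_2).

Definition L2cvg E (a_ : nat -> R2 -> R) (a : R2 -> R) : Prop :=
  [/\ forall n, inL2 E (a_ n), inL2 E a & I2 E (fun x => (a x - a_ n x) ^+ 2) @[n --> \oo] --> (0:R)].

Lemma L2cvg_cst E g : meas E -> inL2 E g -> L2cvg E (fun=> g) g.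
Proof.
move=> mE gL; split => //.
rewrite (_ : (fun n => _) = cst 0); first exact: cvg_cst.
apply/funext => n /=; rewrite -[RHS](I2_0 E); congr I2; apply/funext => x.
by rewrite subrr expr0n.
Qed.

Lemma L2cvg_sub D E a_ a : meas D -> meas E -> E `<=` D -> L2cvg D a_ a -> L2cvg E a_ a.
Proof.
move=> mD mE ED [aL_ aL c]; split.
- by move=> n; exact: inL2_sub (aL_ n).
- exact: inL2_sub aL.
apply: squeeze_cvgr c; last exact: (@cvg_cst _ (0:R)).
near=> n; rewrite I2_ge0/=; last by move=> x _; exact: sqr_ge0.
apply: I2_subset => //; last by move=> x _; exact: sqr_ge0.
by apply: inL2_sq; apply: inL2B.
Unshelve. all: by end_near. Qed.

Lemma cvg0_sqr (x y : nat -> R) : (forall n, x n ^+ 2 <= y n) -> y n @[n --> \oo] --> (0:R) ->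
  x n @[n --> \oo] --> (0:R).
Proof.
move=> xy cy; apply/cvgrPdist_lt => e e0; near=> n.
rewrite sub0r normrN -(ltr_pXn2r (n := 2))// ?nnegrE ?(ltW e0)//.
rewrite -normrX ger0_norm ?sqr_ge0//; apply: le_lt_trans (xy n) _.
have : `|0 - y n| < e ^+ 2 by near: n; move/cvgrPdist_lt: cy; apply; rewrite exprn_gt0.
rewrite sub0r normrN; exact: le_lt_trans (ler_norm _).
Unshelve. all: by end_near. Qed.

Lemma L2cvg_I2 E a_ a b_ b : meas E -> L2cvg E a_ a -> L2cvg E b_ b ->
  I2 E (fun x => a_ n x * b_ n x) @[n --> \oo] --> I2 E (fun x => a x * b x).
Proof.
move=> mE [aL_ aL ca] [bL_ bL cb].
have dA n : inL2 E (fun x => a x - a_ n x) by apply: inL2B.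
have dB n : inL2 E (fun x => b x - b_ n x) by apply: inL2B.
have c1 : I2 E (fun x => (a x - a_ n x) * (b x - b_ n x)) @[n --> \oo] --> (0:R).
  apply: (@cvg0_sqr _ (fun n => I2 E (fun x => (a x - a_ n x) ^+ 2) * I2 E (fun x => (b x - b_ n x) ^+ 2))).
    by move=> n; exact: cauchy_schwarz.
  by rewrite -[X in _ --> X](mulr0 0); exact: cvgM.
have c2 : I2 E (fun x => (a x - a_ n x) * b x) @[n --> \oo] --> (0:R).
  apply: (@cvg0_sqr _ (fun n => I2 E (fun x => (a x - a_ n x) ^+ 2) * I2 E (fun x => b x ^+ 2))).
    by move=> n; exact: cauchy_schwarz.
  by rewrite -[X in _ --> X](mul0r (I2 E (fun x => b x ^+ 2))); apply: cvgM => //; exact: cvg_cst.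
have c3 : I2 E (fun x => a x * (b x - b_ n x)) @[n --> \oo] --> (0:R).
  apply: (@cvg0_sqr _ (fun n => I2 E (fun x => a x ^+ 2) * I2 E (fun x => (b x - b_ n x) ^+ 2))).
    by move=> n; exact: cauchy_schwarz.
  by rewrite -[X in _ --> X](mulr0 (I2 E (fun x => a x ^+ 2))); apply: cvgM => //; exact: cvg_cst.
rewrite (_ : (fun n => I2 E (fun x => a_ n x * b_ n x)) = (fun n =>
  I2 E (fun x => a x * b x) + I2 E (fun x => (a x - a_ n x) * (b x - b_ n x)) -
  (I2 E (fun x => (a x - a_ n x) * b x) + I2 E (fun x => a x * (b x - b_ n x))))); last first.
  apply/funext => n.
  have i1 : itg E (fun x => a x * b x) by exact: inL2_itgM.
  have i2 : itg E (fun x => (a x - a_ n x) * (b x - b_ n x)) by exact: inL2_itgM.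
  have i3 : itg E (fun x => (a x - a_ n x) * b x) by exact: inL2_itgM.
  have i4 : itg E (fun x => a x * (b x - b_ n x)) by exact: inL2_itgM.
  rewrite -I2D// -I2D// -I2B//; [|exact: itgD|exact: itgD].
  by congr I2; apply/funext => x; ring.
rewrite -[X in _ --> X]subr0 -[X in _ --> _ - X](addr0 0) -[X in _ --> X - _]addr0.
by apply: cvgB; apply: cvgD => //; exact: cvg_cst.
Qed.

Lemma L2cvg_sqr E a_ a : meas E -> L2cvg E a_ a ->
  I2 E (fun x => a_ n x ^+ 2) @[n --> \oo] --> I2 E (fun x => a x ^+ 2).
Proof.
move=> mE ca; have := L2cvg_I2 mE ca ca.
by under eq_fun do (under [X in I2 _ X]eq_fun do rewrite -expr2); under [X in _ --> I2 _ X]eq_fun do rewrite -expr2.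
Qed.

Section OneMesh.
Context (D : set R2) (h : R) (T : {fset R2}) (mesh : uniform_mesh D h T).
Let mD : meas D := mesh_meas mesh.

Lemma I2_mesh_ae f g : itg D f -> itg D g ->
  (forall c, c \in T -> ae_eq (@leb2 R) (cell h c : set M2) (f : M2 -> R) g) -> I2 D f = I2 D g.
Proof.
move=> fi gi H; rewrite (I2_mesh mesh fi) (I2_mesh mesh gi) big_seq [RHS]big_seq.
apply: eq_bigr => c cT; have sub := cell_sub mesh cT; have mK := cell_meas h c.
by apply: I2_ae => //; [apply: itg_meas; exact: itg_sub fi|apply: itg_meas; exact: itg_sub gi|exact: H].
Qed.

Context (u : R2 -> R).

(** On the empty index this is u itself and not another representative of its
class.  The definition is locked because unification would otherwise unfold
[wderiv]. *)
Definition U s : R2 -> R := locked (if s is [::] then u else wderiv D s u).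

Lemma U_nil : U [::] = u. Proof. by rewrite /U -lock. Qed.

Lemma is_wderiv_nil f : inL2 D f -> is_wderiv D [::] f f.
Proof. by move=> fL; split => // psi _; rewrite expr0 mul1r. Qed.

Lemma U_spec n s : inH n D u -> (size s <= n)%N -> is_wderiv D s u (U s).
Proof.
move=> [uL H] sn; rewrite /U -lock; case: s sn => [|i s] sn; first exact: is_wderiv_nil.
by apply: wderiv_spec; exact: H.
Qed.

Lemma U_L2 n s : inH n D u -> (size s <= n)%N -> inL2 D (U s).
Proof. by move=> H sn; have [] := U_spec H sn. Qed.

Lemma U_test n s psi : inH n D u -> (size s <= n)%N -> test_function D psi ->
  I2 D (fun x => u x * pderiv s psi x) = (-1) ^+ size s * I2 D (fun x => U s x * psi x).
Proof. by move=> H sn tp; have [_] := U_spec H sn; apply. Qed.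

Lemma U_ibp n s s' i psi : inH n D u -> (size s < n)%N -> perm_eq s' (rcons s i) ->
  test_function D psi ->
  I2 D (fun x => U s x * 'D_(ei i) psi x) = - I2 D (fun x => U s' x * psi x).
Proof.
move=> H sn p tp.
have ss' : size s' = (size s).+1 by rewrite (perm_size p) size_rcons.
have s'n : (size s' <= n)%N by rewrite ss'.
have := U_test H s'n tp; have := U_test H (ltnW sn) (test_D i tp).
rewrite -pderiv_rcons (pderiv_perm (test_smooth tp) p) => -> .
rewrite ss' exprS mulN1r mulNr => E.
have s0 : (-1) ^+ size s != 0 :> R by rewrite expf_neq0// oppr_eq0 oner_eq0.
by apply: (mulfI s0); rewrite E mulrN.
Qed.

(** The definition of H^2_0 provides test functions close to u in the norm of
weak derivatives; uniqueness of weak derivatives identifies those of the difference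
with the differences of derivatives. *)
Lemma dense_seq : inH0 2 D u -> exists phi : nat -> R2 -> R,
  (forall n, test_function D (phi n)) /\
  forall s, (size s <= 2)%N -> L2cvg D (fun n => pderiv s (phi n)) (U s).
Proof.
move=> [uH dens].
have h0 := mesh_h0 mesh.
have [M M0 DM] := mesh_bounded mesh.
have /choice[phi Hphi] : forall n : nat, exists phi, test_function D phi /\ normH 2 D (u \- phi) < n.+1%:R^-1.
  by move=> n; have [|phi ? ?] := dens (n.+1%:R^-1); [rewrite invr_gt0 ltr0n|exists phi].
exists phi; split; first by move=> n; have [] := Hphi n.
move=> s s2.
have uL : inL2 D u by case: uH.
have UsL := U_L2 uH s2.
have pL n : inL2 D (pderiv s (phi n)).
  apply: (bounded_smooth_inL2 mD DM); apply: smooth_pderiv; apply: (@test_smooth _ D).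
  by have [] := Hphi n.
split => //.
pose w n := wderiv D s (u \- phi n).
have sm n : smooth (phi n) by apply: (@test_smooth _ D); have [] := Hphi n.
have Hw n : is_wderiv D s (u \- phi n) (fun x => U s x - pderiv s (phi n) x).
  apply: (is_wderivB mD DM uL).
  - exact: (bounded_smooth_inL2 mD DM).
  - exact: (U_spec uH).
  - exact: (is_wderiv_smooth mD M0 DM).
have Hw' n : is_wderiv D s (u \- phi n) (w n).
  by apply: wderiv_spec; exists (fun x => U s x - pderiv s (phi n) x).
have E n : I2 D (fun x => (U s x - pderiv s (phi n) x) ^+ 2) = I2 D (fun x => w n x ^+ 2).
  apply: I2_mesh_ae.
  - by apply: inL2_sq; apply: inL2B.
  - by apply: inL2_sq; case: (Hw' n).
  move=> c cT; have sub := cell_sub mesh cT; have mK := cell_meas h c.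
  have upL : inL2 (cell h c) (u \- phi n).
    apply: (inL2_sub mD) => //; apply: inL2B => //; exact: (bounded_smooth_inL2 mD DM).
  have := is_wderiv_ae h0 upL (is_wderiv_sub mD mK sub (Hw n)) (is_wderiv_sub mD mK sub (Hw' n)).
  by apply: filterS => x Hx Kx; rewrite (Hx Kx).
have B n : I2 D (fun x => (U s x - pderiv s (phi n) x) ^+ 2) <= n.+1%:R^-1.
  rewrite E; have [_ nH] := Hphi n.
  have N0 (t : seq 'I_2) : 0 <= normL2 D (wderiv D t (u \- phi n)) ^+ 2 by exact: sqr_ge0.
  have -> : I2 D (fun x => w n x ^+ 2) = normL2 D (w n) ^+ 2.
    rewrite /normL2 sqr_sqrtr; first by rewrite /dotL2 -/(I2 _ _); apply: I2_eq => x _; rewrite expr2.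
    by apply: I2_ge0 => x _; rewrite -expr2 sqr_ge0.
  apply: (@le_trans _ _ (normH 2 D (u \- phi n) ^+ 2)).
    rewrite /normH [leRHS]sqr_sqrtr; last by apply: sumr_ge0 => k _; apply: sumr_ge0 => t _; exact: N0.
    have s3 : (size s < 3)%N by [].
    rewrite (bigD1 (Ordinal s3))//= (bigD1 (in_tuple s))//= -/(w n) -addrA lerDl.
    by apply: addr_ge0; apply: sumr_ge0 => k _; rewrite ?sumr_ge0// => t _; exact: N0.
  have nH0 : 0 <= normH 2 D (u \- phi n) by exact: sqrtr_ge0.
  have i1 : (n.+1%:R^-1 : R) <= 1 by rewrite invf_le1 ?ltr0n// ler1n.
  by rewrite expr2; apply: le_trans (_ : _ <= normH 2 D (u \- phi n)) (ltW nH); rewrite ler_piMr// (le_trans (ltW nH)).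
apply: (@squeeze_cvgr _ _ _ _ (cst 0) (fun n => n.+1%:R^-1)).
- by near=> n; rewrite B andbT; apply: I2_ge0 => x _; exact: sqr_ge0.
- exact: cvg_cst.
- exact: cvg_harmonic.
Unshelve. all: by end_near. Qed.

Lemma eq_of_cvg (x y : nat -> R) (a b : R) : (forall n, x n = y n) ->
  x n @[n --> \oo] --> a -> y n @[n --> \oo] --> b -> a = b.
Proof.
move=> /funext -> ca cb; apply: (cvg_unique _ ca cb); exact: norm_hausdorff.
Qed.

(** If phi is a test function, replacing one factor d_ii u, respectively d_ij u, by
the derivative of phi turns both sides into minus the pairing of d_ijj u with
d_i phi; then phi tends to u. *)
Lemma U_mixed i j : inH0 2 D u -> inH 4 D u ->
  I2 D (fun x => U [:: i; i] x * U [:: j; j] x) =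
  I2 D (fun x => U [:: i; j] x ^+ 2).
Proof.
move=> u0 u4.
have [phi [tphi cphi]] := dense_seq u0.
have cst s : (size s <= 4)%N -> L2cvg D (fun=> U s) (U s) by move=> ?; apply: L2cvg_cst => //; exact: U_L2 u4 _.
have SQ : I2 D (fun x => U [:: i; j] x * U [:: i; j] x) = I2 D (fun x => U [:: i; j] x ^+ 2).
  by apply: I2_eq => x _; rewrite expr2.
apply: (etrans _ SQ).
apply: (eq_of_cvg _ (L2cvg_I2 mD (cphi [:: i; i] isT) (cst [:: j; j] isT))
                 (L2cvg_I2 mD (cphi [:: i; j] isT) (cst [:: i; j] isT))) => n.
have t1 := test_D i (tphi n).
have E1 := U_ibp (s := [:: j; j]) (s' := [:: i; j; j]) (i := i) u4 isT _ t1.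
have E2 := U_ibp (s := [:: i; j]) (s' := [:: i; j; j]) (i := j) u4 isT _ t1.
have P1 : perm_eq [:: i; j; j] (rcons [:: j; j] i) by rewrite /= -(cat1s i) perm_catC.
have PF : pderiv [:: i; j] (phi n) = pderiv [:: j; i] (phi n).
  apply: pderiv_perm; first exact: test_smooth (tphi n).
  by rewrite -(cat1s i) perm_catC.
have moment_product_limit : I2 D (fun x => pderiv [:: i; i] (phi n) x * U [:: j; j] x) =
   I2 D (fun x => U [:: j; j] x * 'D_(ei i) ('D_(ei i) (phi n)) x).
  by apply: I2_eq => x _; rewrite mulrC.
have S2 : I2 D (fun x => pderiv [:: j; i] (phi n) x * U [:: i; j] x) =
   I2 D (fun x => U [:: i; j] x * 'D_(ei j) ('D_(ei i) (phi n)) x).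
  by apply: I2_eq => x _; rewrite mulrC.
apply: (etrans moment_product_limit); apply: (etrans (E1 P1)); apply: (etrans (esym (E2 (perm_refl _)))).
apply: (etrans (esym S2)).
exact: (congr1 (fun g => I2 D (fun x => g x * U [:: i; j] x)) (esym PF)).
Qed.

(** If the second-order factor is replaced by the derivative of a test function
phi, both sides equal the pairing of u with the sixth derivative d_iiiijj phi. *)
Lemma U_fourth i j : inH0 2 D u -> inH 4 D u ->
  I2 D (fun x => U [:: j; j] x * U [:: i; i; i; i] x) =
  I2 D (fun x => U [:: i; i] x * U [:: i; i; j; j] x).
Proof.
move=> u0 u4.
have [phi [tphi cphi]] := dense_seq u0.
have cst s : (size s <= 4)%N -> L2cvg D (fun=> U s) (U s) by move=> ?; apply: L2cvg_cst => //; exact: U_L2 u4 _.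
apply: (eq_of_cvg _ (L2cvg_I2 mD (cphi [:: j; j] isT) (cst [:: i; i; i; i] isT))
                 (L2cvg_I2 mD (cphi [:: i; i] isT) (cst [:: i; i; j; j] isT))) => n.
have E1 := U_test (s := [:: i; i; i; i]) u4 isT (test_pderiv [:: j; j] (tphi n)).
have E2 := U_test (s := [:: i; i; j; j]) u4 isT (test_pderiv [:: i; i] (tphi n)).
have S4 a : (-1) ^+ 4 * a = a :> R by rewrite -signr_odd expr0 mul1r.
have PF : pderiv [:: i; i; i; i] (pderiv [:: j; j] (phi n)) = pderiv [:: i; i; j; j] (pderiv [:: i; i] (phi n)).
  have := @pderiv_perm _ [:: i; i; i; i; j; j] [:: i; i; j; j; i; i] (phi n) (test_smooth (tphi n)).
  apply; rewrite !perm_cons -[X in perm_eq X]/([:: i; i] ++ [:: j; j]) perm_catC; exact: perm_refl.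
have moment_product_limit : I2 D (fun x => pderiv [:: j; j] (phi n) x * U [:: i; i; i; i] x) =
   I2 D (fun x => U [:: i; i; i; i] x * pderiv [:: j; j] (phi n) x).
  by apply: I2_eq => x _; rewrite mulrC.
have S2 : I2 D (fun x => pderiv [:: i; i] (phi n) x * U [:: i; i; j; j] x) =
   I2 D (fun x => U [:: i; i; j; j] x * pderiv [:: i; i] (phi n) x).
  by apply: I2_eq => x _; rewrite mulrC.
apply: (etrans moment_product_limit); apply: (etrans (esym (etrans E1 (S4 _)))).
apply: (etrans (congr1 (fun g => I2 D (fun x => u x * g x)) PF)).
exact: (etrans (etrans E2 (S4 _)) (esym S2)).
Qed.

(** Integrating psi^2 by parts against the coordinate x_i gives
|psi|^2 = -2 (x_i psi, d_i psi), and x_i is bounded on the domain. *)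
Lemma poincare i : exists2 C : R, 0 < C & forall psi, test_function D psi ->
  I2 D (fun x => psi x ^+ 2) <= C * I2 D (fun x => 'D_(ei i) psi x ^+ 2).
Proof.
have [M M0 DM] := mesh_bounded mesh.
exists (4 * M ^+ 2) => [|psi tp]; first by rewrite mulr_gt0// exprn_gt0.
have sp := test_smooth tp; have tD := test_D i tp; have sD := test_smooth tD.
have sx : smooth (fun x => co i x * psi x) by apply: smooth_mul => //; exact: smooth_co.
have := ibp_test mD M0 DM i sx tp.
rewrite (@I2_eq _ _ (fun x => 'D_(ei i) (fun y => co i y * psi y) x * psi x) (fun x => psi x ^+ 2 + co i x * psi x * 'D_(ei i) psi x)); last first.
  move=> x _; rewrite /= pdM//; last exact: smooth_co.
  have [_ ->] := is_derive_co i (ei i) x.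
  by rewrite co_ei; ring.
have L1 : inL2 D (fun x => co i x * psi x) by exact: (bounded_smooth_inL2 mD DM).
have L2 : inL2 D ('D_(ei i) psi) by exact: (bounded_smooth_inL2 mD DM).
have L3 : inL2 D psi by exact: (bounded_smooth_inL2 mD DM).
rewrite I2D//; [|exact: inL2_sq|exact: inL2_itgM].
set A := I2 D (fun x => psi x ^+ 2); set B := I2 D (fun x => _ * _); set C := I2 D (fun x => 'D_(ei i) psi x ^+ 2) => E.
(* A = |psi|^2, B = (x_i psi, d_i psi) and C = |d_i psi|^2. *)
have AB : A = - (2 * B) by lra.
have := cauchy_schwarz mD L1 L2; rewrite -/B -/C => CS.
have A0 : 0 <= A by apply: I2_ge0 => x _; exact: sqr_ge0.
have C0 : 0 <= C by apply: I2_ge0 => x _; exact: sqr_ge0.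
have xA : I2 D (fun x => (co i x * psi x) ^+ 2) <= M ^+ 2 * A.
  rewrite /A -I2Z//; last exact: inL2_sq.
  apply: I2_le => //; [exact: inL2_sq|by apply: itgZ => //; exact: inL2_sq|].
  move=> x Dx; rewrite exprMn ler_wpM2r ?sqr_ge0//.
  have := DM x Dx; rewrite -/(cell M 0) (cellE i) => -[]; rewrite subr0 => /ltW h1 _.
  by rewrite -(real_normK (num_real (co i x))) lerXn2r ?nnegrE ?(ltW M0).
have [A00|An0] := eqVneq A 0; first by rewrite A00 mulr_ge0// mulr_ge0// exprn_ge0// ltW.
have {An0} A1 : 0 < A by rewrite lt_def An0.
have : A ^+ 2 <= 4 * (M ^+ 2 * A * C).
  rewrite AB sqrrN exprMn -AB (_ : 2 ^+ 2 = 4 :> R); last by ring.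
  rewrite ler_pM2l//; apply: le_trans CS _; exact: ler_wpM2r.
rewrite expr2 => H; rewrite -(ler_pM2l A1); apply: le_trans H _.
by rewrite le_eqVlt; apply/orP; left; apply/eqP; ring.
Qed.

(** Poincare's inequality in direction j and then in direction i bounds |u| by
|d_ij u|. *)
Lemma U_mixed_gt0 i j : inH0 2 D u -> 0 < I2 D (fun x => u x ^+ 2) ->
  0 < I2 D (fun x => U [:: i; j] x ^+ 2).
Proof.
move=> u0 upos.
have [phi [tphi cphi]] := dense_seq u0.
have [C1 C1_0 H1] := poincare i; have [C2 C2_0 H2] := poincare j.
have le : I2 D (fun x => u x ^+ 2) <= C2 * (C1 * I2 D (fun x => U [:: i; j] x ^+ 2)).
  have c1 := L2cvg_sqr mD (cphi [::] isT); rewrite U_nil in c1.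
  have c2 := L2cvg_sqr mD (cphi [:: i; j] isT).
  have c3 : C2 * (C1 * I2 D (fun x => pderiv [:: i; j] (phi n) x ^+ 2)) @[n --> \oo] -->
      C2 * (C1 * I2 D (fun x => U [:: i; j] x ^+ 2)).
    by apply: cvgM; [exact: cvg_cst|apply: cvgM => //; exact: cvg_cst].
  apply: (ler_cvg_to c1 c3); near=> n.
  apply: le_trans (H2 _ (tphi n)) _; rewrite ler_pM2l//.
  exact: (H1 _ (test_D j (tphi n))).
have := lt_le_trans upos le; rewrite pmulr_rgt0// pmulr_rgt0//.
Unshelve. all: by end_near. Qed.

End OneMesh.
End Density.

(** * Jumps of first moments between neighbouring cells *)

Section Kernel.
Context {R : realType}.
Local Notation R2 := (R * R)%type.
Local Notation M2 := (measurableTypeR R * measurableTypeR R)%type.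
Implicit Types (f g psi phi : R2 -> R) (i j : 'I_2) (x m c : R2) (E : set R2) (h r s : R).

(** Polynomials that vanish at r and -r. *)
Definition cutoff (r : R) (q : {poly R}) : {poly R} := ((r ^+ 2)%:P - 'X^2) * q.

Lemma cutoff_horner r q t : (cutoff r q).[t] = (r ^+ 2 - t ^+ 2) * q.[t].
Proof. by rewrite /cutoff !hornerE. Qed.

Lemma cutoff_deriv r q t : (cutoff r q)^`().[t] = - (2 * t) * q.[t] + (r ^+ 2 - t ^+ 2) * q^`().[t].
Proof. by rewrite /cutoff derivM derivB derivC derivXn sub0r /= !hornerE /=; ring. Qed.

Lemma cutoff_ibp1 D f f1 i r s m (q : {poly R}) : meas D -> 0 < r -> 0 < s ->
  rect i r s m `<=` D -> inL2 D f -> inL2 D f1 ->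
  (forall psi, test_function D psi ->
     I2 D (fun x => f x * 'D_(ei i) psi x) = - I2 D (fun x => f1 x * psi x)) ->
  I2 (rect i r s m) (fun x => f x * (cutoff r q)^`().[co i (x - m)]) =
  - I2 (rect i r s m) (fun x => f1 x * (cutoff r q).[co i (x - m)]).
Proof.
move=> mD r0 s0 sub fL f1L H.
have := cutoff_ibp q mD r0 s0 sub fL f1L H.
rewrite /= => E; apply: (etrans _ (etrans E _)); last congr (- _).
  by congr I2; apply/funext => x; rewrite cutoff_deriv.
by congr I2; apply/funext => x; rewrite cutoff_horner.
Qed.

(** A double zero at both ends lets both derivatives be moved. *)
Lemma cutoff_ibp2 D f f1 g i r s m (q : {poly R}) : meas D -> 0 < r -> 0 < s ->
  rect i r s m `<=` D -> inL2 D f -> inL2 D f1 -> inL2 D g ->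
  (forall psi, test_function D psi ->
     I2 D (fun x => f x * 'D_(ei i) psi x) = - I2 D (fun x => f1 x * psi x)) ->
  (forall psi, test_function D psi ->
     I2 D (fun x => f1 x * 'D_(ei i) psi x) = - I2 D (fun x => g x * psi x)) ->
  I2 (rect i r s m) (fun x => f x * (cutoff r (cutoff r q))^`()^`().[co i (x - m)]) =
  I2 (rect i r s m) (fun x => g x * (cutoff r (cutoff r q)).[co i (x - m)]).
Proof.
move=> mD r0 s0 sub fL f1L gL H H1.
have E : (cutoff r (cutoff r q))^`() = cutoff r (- 2%:P * 'X * q *+ 2 + ((r ^+ 2)%:P - 'X^2) * q^`()).
  rewrite /cutoff !derivM !derivB !derivC !derivXn sub0r /= ?expr1 mulr2n; ring.
rewrite E (cutoff_ibp1 _ mD r0 s0 sub fL f1L H) -E.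
by rewrite (cutoff_ibp1 _ mD r0 s0 sub f1L gL H1) opprK.
Qed.

Lemma I2_patch h i c F : 0 < h -> itg (rect i (2 * h) h (c + h *: ei i)) F ->
  I2 (rect i (2 * h) h (c + h *: ei i)) F = I2 (cell h c) F + I2 (cell h (c + (2 * h) *: ei i)) F.
Proof.
move=> h0 iF; set Q := rect i _ _ _ in iF *; set c' := c + _.
have mQ : meas Q by exact: rect_meas.
have mK d : meas (cell h d) by exact: rect_meas.
have in1 x : cell h c x <-> [/\ - h < co i x - co i c, co i x - co i c < h & `|co (rev_ord i) x - co (rev_ord i) c| < h].
  rewrite (cellE i); rewrite /rect /= !coB ltr_norml.
  by split => [[/andP[? ?] ?]|[? ? ?]]; split => //; apply/andP.
have in2 x : cell h c' x <-> [/\ h < co i x - co i c, co i x - co i c < 3 * h & `|co (rev_ord i) x - co (rev_ord i) c| < h].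
  rewrite (cellE i) /rect /c' /=; rewrite !coE !mulr0 !mulr1 !addr0 ltr_norml.
  by split => [[/andP[? ?] ?]|[? ? ?]]; split => //; try apply/andP; try split; lra.
have in3 x : Q x <-> [/\ - h < co i x - co i c, co i x - co i c < 3 * h & `|co (rev_ord i) x - co (rev_ord i) c| < h].
  rewrite /Q /rect /=; rewrite !coE !mulr0 !mulr1 !addr0 ltr_norml.
  by split => [[/andP[? ?] ?]|[? ? ?]]; split => //; try apply/andP; try split; lra.
have s1 : cell h c `<=` Q by move=> x /in1[? ? ?]; apply/in3; split => //; lra.
have s2 : cell h c' `<=` Q by move=> x /in2[? ? ?]; apply/in3; split => //; lra.
have iE E : meas E -> itg E F -> itg setT (F \_ E).
  by move=> mE /(integrable_mkcond _ mE); rewrite /itg restrict_EFin.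
have R1 E : I2 E F = I2 setT (F \_ E) by rewrite /I2 Rintegral_mkcond.
have i1 := iE _ (mK c) (itg_sub mQ (mK c) s1 iF).
have i2 := iE _ (mK c') (itg_sub mQ (mK c') s2 iF).
rewrite !R1 -I2D//; last exact: measurableT.
apply: I2_ae; first exact: measurableT.
- by apply: itg_meas; exact: iE.
- by apply: itg_meas; apply: itgD => //; exact: measurableT.
have := ae_line i (co i c + h); apply: (@filterS _ _ ae_leb2_filter) => x /eqP nx _.
rewrite !patchE; case: ifPn => [/set_mem/in3[q1 q2 q3]|nQ].
  have [lt|gt|eq] := ltgtP (co i x) (co i c + h).
  - rewrite mem_set; last by apply/in1; split => //; lra.
    by rewrite ifF ?addr0//; apply/negbTE/negP => /set_mem/in2[]; lra.
  - rewrite [X in _ = _ + X]ifT; last by apply/mem_set/in2; split => //; lra.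
    by rewrite ifF ?add0r//; apply/negbTE/negP => /set_mem/in1[]; lra.
  - by case: nx.
rewrite !ifF ?addr0//; apply/negbTE/negP => /set_mem.
  by move=> /s2 /mem_set; apply/negP.
by move=> /s1 /mem_set; apply/negP.
Qed.

Definition mom i h c f : R := I2 (cell h c) (fun x => co i (x - c) * f x).

(** [kapR] and [kapL] are the kernel of the jump of a moment between two
neighbours, on the cell before and on the cell after the common edge: at distance d
from that edge both equal (2h - d)^2 (h + d) / 6. *)
Definition kapR h (t : R) : R := (h + t) ^+ 2 * (2 * h - t) / 6.
Definition kapL h (t : R) : R := (h - t) ^+ 2 * (2 * h + t) / 6.

Lemma kap_sum h t : kapR h t + kapL h t = 2 * h ^+ 3 / 3.
Proof. by rewrite /kapR /kapL; field. Qed.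

Lemma kap_ge0 h t : `|t| <= h -> 0 <= kapR h t /\ 0 <= kapL h t.
Proof.
rewrite ler_norml => /andP[? ?]; split; rewrite /kapR /kapL mulr_ge0// mulr_ge0 ?sqr_ge0//; lra.
Qed.

Lemma inL2_smM E f g i r s m : E = rect i r s m -> smooth g -> inL2 E f -> inL2 E (fun x => f x * g x).
Proof.
move=> -> sg fL; have := inL2_contM (smooth_continuous sg) fL.
by congr inL2; apply/funext => x; rewrite mulrC.
Qed.

(** The kernel has second derivative -xi on the first cell and xi on the second,
so the claim is a twofold integration by parts.  The kernel is only piecewise
polynomial: it is split into a polynomial on the union of the two cells and one on
each cell, each having double zeros at both ends of its interval. *)
Lemma moment_jump (D : set R2) f f1 g i h c : meas D -> 0 < h ->
  rect i (2 * h) h (c + h *: ei i) `<=` D -> inL2 D f -> inL2 D f1 -> inL2 D g ->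
  (forall psi, test_function D psi ->
     I2 D (fun x => f x * 'D_(ei i) psi x) = - I2 D (fun x => f1 x * psi x)) ->
  (forall psi, test_function D psi ->
     I2 D (fun x => f1 x * 'D_(ei i) psi x) = - I2 D (fun x => g x * psi x)) ->
  cell h c `<=` D -> cell h (c + (2 * h) *: ei i) `<=` D ->
  mom i h (c + (2 * h) *: ei i) f - mom i h c f =
  I2 (cell h c) (fun x => g x * kapR h (co i (x - c))) +
  I2 (cell h (c + (2 * h) *: ei i)) (fun x => g x * kapL h (co i (x - (c + (2 * h) *: ei i)))).
Proof.
move=> mD h0 subQ fL f1L gL H H1 sub sub'; set c' := c + _ in sub' *.
set Q := rect _ _ _ _ in subQ.
have hh0 : 0 < 2 * h by rewrite mulr_gt0.
have h2n0 : 24 * h != 0 by rewrite mulf_neq0// gt_eqF.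
have EQ := cutoff_ibp2 1%:P mD hh0 h0 subQ fL f1L gL H H1.
have subi d : cell h d `<=` D -> rect i h h d `<=` D by rewrite (cellE i).
have Ec d (sd : cell h d `<=` D) := cutoff_ibp2 1%:P mD h0 h0 (subi d sd) fL f1L gL H H1.
have Wv r t : (cutoff r (cutoff r 1%:P)).[t] = (r ^+ 2 - t ^+ 2) ^+ 2.
  by rewrite !cutoff_horner hornerC mulr1 expr2.
have Wd r t : (cutoff r (cutoff r 1%:P))^`()^`().[t] = 12 * t ^+ 2 - 4 * r ^+ 2.
  have -> : cutoff r (cutoff r 1%:P) = (r ^+ 4)%:P - (2 * r ^+ 2)%:P * 'X^2 + 'X^4.
    rewrite /cutoff mulr1 !polyC_exp polyCM; ring.
  rewrite !(derivD, derivN, derivM, derivC, derivXn, derivMn, derivX) /= !hornerE /=.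
  by rewrite !(hornerMn, hornerE) /= ?expr1; ring.
have cvi d : I2 (rect i h h d) = I2 (cell h d) by rewrite -cellE.
have sp m (p : {poly R}) : smooth (fun x => p.[co i (x - m)]) by exact: smooth_poly.
have fQ : inL2 Q f by apply: inL2_sub fL => //; exact: rect_meas.
have gQ : inL2 Q g by apply: inL2_sub gL => //; exact: rect_meas.
have iQ F m (p : {poly R}) : inL2 Q F -> itg Q (fun x => F x * p.[co i (x - m)]).
  move=> FL; apply: inL2_itg; [exact: rect_meas|exact: rect_fin|].
  exact: (inL2_smM (erefl Q)).
rewrite (I2_patch h0 (iQ _ _ _ fQ)) (I2_patch h0 (iQ _ _ _ gQ)) in EQ.
have Lc d F : cell h d `<=` D -> inL2 D F -> inL2 (cell h d) F.
  by move=> sd FL; apply: inL2_sub FL => //; exact: rect_meas.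
have ic d F (p : {poly R}) m : cell h d `<=` D -> inL2 D F -> itg (cell h d) (fun x => F x * p.[co i (x - m)]).
  move=> sd FL; apply: inL2_itg; [exact: rect_meas|exact: rect_fin|].
  apply: (inL2_smM (erefl (rect ord0 h h d))) => //; exact: Lc.
have co1 x : co i (x - (c + h *: ei i)) = co i (x - c) - h by rewrite !coE; ring.
have co2 x : co i (x - (c + h *: ei i)) = co i (x - c') + h by rewrite /c' !coE; ring.
(* On either cell the kernel is (W2 - W1) / (24 h). *)
pose W2 := cutoff (2 * h) (cutoff (2 * h) 1%:P); pose W1 := cutoff h (cutoff h 1%:P).
have mc d : meas (cell h d) by exact: rect_meas.
have comb d F (p1 p2 : {poly R}) m1 m2 (G : R2 -> R) : cell h d `<=` D -> inL2 D F ->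
    (forall x, G x = (24 * h)^-1 * (F x * p1.[co i (x - m1)]) - (24 * h)^-1 * (F x * p2.[co i (x - m2)])) ->
    I2 (cell h d) G = (24 * h)^-1 * (I2 (cell h d) (fun x => F x * p1.[co i (x - m1)]) - I2 (cell h d) (fun x => F x * p2.[co i (x - m2)])).
  move=> sd FL /funext ->; rewrite I2B//; [|by apply: itgZ => //; exact: ic|by apply: itgZ => //; exact: ic].
  by rewrite !I2Z ?mulrBr//; exact: ic.
pose mm := c + h *: ei i.
rewrite (comb c g W2 W1 mm c) //; last first.
  by move=> x; rewrite !Wv co1 /kapR; field; rewrite gt_eqF.
rewrite (comb c' g W2 W1 mm c') //; last first.
  by move=> x; rewrite !Wv co2 /kapL; field; rewrite gt_eqF.
rewrite /mom (comb c' f W2^`()^`() W1^`()^`() mm c') //; last first.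
  by move=> x; rewrite !Wd co2; field; rewrite gt_eqF.
have -> : I2 (cell h c) (fun x => co i (x - c) * f x) = - I2 (cell h c) (fun x => - (co i (x - c)) * f x).
  rewrite -I2N//; first by apply: I2_eq => x _; rewrite mulNr opprK.
  have := ic c f (- 'X) c sub fL; congr itg; apply/funext => x.
  by rewrite !hornerE mulrC.
rewrite (comb c f W2^`()^`() W1^`()^`() mm c) //; last first.
  by move=> x; rewrite !Wd co1; field; rewrite gt_eqF.
have E1 := Ec c sub; have E2 := Ec c' sub'; rewrite !cvi in E1 E2.
rewrite -/W1 in E1 E2; rewrite -/W2 -/mm in EQ.
rewrite E1 E2; have aux (k a a' b b' A A' : R) : a + a' = A + A' ->
    k * (a' - b') - - (k * (a - b)) = k * (A - b) + k * (A' - b').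
  by move=> /(canRL (addKr a)) ->; ring.
exact: aux EQ.
Qed.

End Kernel.

(** * First moments of mixed derivatives as differences over edges *)

Section Edge.
Context {R : realType}.
Local Notation R2 := (R * R)%type.
Local Notation M2 := (measurableTypeR R * measurableTypeR R)%type.
Implicit Types (f g psi phi : R2 -> R) (i j : 'I_2) (x m c : R2) (E : set R2) (h r : R).

(** The difference of this functional over two opposite edges is a moment of the
mixed derivative ([mom_edges]), and for smooth phi it is close to a multiple of
d_jj phi ([edge_mom_approx]). *)
Definition edge_mom i h m phi : R :=
  line i h m (fun x => co (rev_ord i) (x - m) * 'D_(ei (rev_ord i)) phi x).

Lemma rev_neq i : (i == rev_ord i) = false.
Proof. by case: (ord2P i) => ->; rewrite rev_ord2. Qed.

Lemma smooth_coM j m phi : smooth phi -> smooth (fun x => co j (x - m) * phi x).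
Proof. by move=> ?; apply: smooth_mul => //; exact: smooth_coc. Qed.

Lemma pd_coM i j m phi x : smooth phi ->
  'D_(ei i) (fun y => co j (y - m) * phi y) x = (i == j)%:R * phi x + co j (x - m) * 'D_(ei i) phi x.
Proof.
move=> sp; apply: etrans; first by apply: pdM => //; exact: smooth_coc.
by rewrite addrC; congr (_ + _); rewrite mulrC; congr (_ * _); exact: pd_coc.
Qed.

Lemma mom_edges i h c phi : 0 < h -> smooth phi ->
  mom (rev_ord i) h c ('D_(ei i) ('D_(ei (rev_ord i)) phi)) =
  edge_mom i h (c + h *: ei i) phi - edge_mom i h (c - h *: ei i) phi.
Proof.
move=> h0 sp; have sj : smooth ('D_(ei (rev_ord i)) phi) by exact: smooth_D.
pose F x := co (rev_ord i) (x - c) * 'D_(ei (rev_ord i)) phi x.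
have sF : smooth F by exact: smooth_coM.
have -> : mom (rev_ord i) h c ('D_(ei i) ('D_(ei (rev_ord i)) phi)) = I2 (rect i h h c) ('D_(ei i) F).
  rewrite /mom (cellE i); apply: I2_eq => x _; apply/esym; apply: etrans.
    exact: pd_coM.
  by rewrite rev_neq mul0r add0r.
rewrite (@gauss R i h h c F h0 h0 sF); congr (_ - _); apply: line_eq => t _.
  by rewrite /F; congr (_ * _); rewrite !coE; ring.
by rewrite /F; congr (_ * _); rewrite !coE; ring.
Qed.

(** Two applications of Green's formula, with weights chosen so that the only
boundary term left is the one on the edge considered, express the edge functional by
second derivatives on the cell alone. *)
Lemma edge_mom_cell i h c (pj A B : R2 -> R) (a : R) : 0 < h -> (a = 1 \/ a = -1) -> smooth pj ->
  (forall x, 'D_(ei (rev_ord i)) pj x = A x) -> (forall x, 'D_(ei i) pj x = B x) ->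
  2 * h * line i h (c + (a * h) *: ei i) (fun x => co (rev_ord i) (x - (c + (a * h) *: ei i)) * pj x) =
  I2 (cell h c) (fun x => (h ^+ 2 - co (rev_ord i) (x - c) ^+ 2) / 2 * A x)
  + I2 (cell h c) (fun x => (co i (x - c) + a * h) * co (rev_ord i) (x - c) * B x).
Proof.
move=> h0 ha sj; set j := rev_ord i => eA eB.
have ji : rev_ord j = i by rewrite /j rev_ordK.
(* F vanishes on the two edges orthogonal to j, and Y below on the edge opposite to
   the one considered. *)
pose F x := (h ^+ 2 - co j (x - c) ^+ 2) / 2 * pj x.
pose F1 x := (h ^+ 2 - co j (x - c) ^+ 2) / 2.
have sF1 : smooth F1.
  have -> : F1 = fun x => 2^-1 * (h ^+ 2 - co j (x - c) ^+ 2) by apply/funext => x; rewrite /F1 mulrC.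
  by apply: smooth_scale; apply: smooth_sub; [exact: smooth_cst|apply: smooth_exp; exact: smooth_coc].
have sF : smooth F by exact: smooth_mul.
have dF1 x : 'D_(ei j) F1 x = - co j (x - c).
  have -> : F1 = fun x => 2^-1 * (h ^+ 2 - co j (x - c) * co j (x - c)).
    by apply/funext => y; rewrite /F1 mulrC expr2.
  apply: etrans; first apply: pdZ.
    by apply: smooth_sub; [exact: smooth_cst|apply: smooth_mul; exact: smooth_coc].
  have -> : 'D_(ei j) (fun y : R2 => h ^+ 2 - co j (y - c) * co j (y - c)) x = - (2 * co j (x - c)).
    apply: etrans; first by apply: pdB; [exact: smooth_cst|apply: smooth_mul; exact: smooth_coc].
    rewrite pd_cst sub0r; congr (- _); apply: etrans; first exact: (@pd_coM j j c _ x (smooth_coc _ _)).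
    by rewrite [X in _ + _ * X]pd_coc eqxx /=; ring.
  by field.
have G1 := @gauss R j h h c F h0 h0 sF.
have Z a' : (a' = h \/ a' = - h) -> line j h (c + a' *: ei j) F = 0.
  move=> ha'; transitivity (line j h (c + a' *: ei j) (fun=> 0)); last by rewrite line_cst// mulr0.
  apply: line_eq => t _; rewrite /F !coE.
  by case: ha' => ->; ring.
rewrite Z in G1; last by left.
rewrite -scaleNr Z in G1; last by right.
pose X x := co i (x - c) + a * h.
have sX : smooth X by apply: smooth_add; [exact: smooth_coc|exact: smooth_cst].
have sy : smooth (fun x => co j (x - c) * pj x) by exact: smooth_coM.
pose Y x := X x * (co j (x - c) * pj x).
have sY : smooth Y by exact: smooth_mul.
have dX x : 'D_(ei i) X x = 1.
  apply: etrans; first by apply: pdD; [exact: smooth_coc|exact: smooth_cst].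
  by rewrite pd_cst pd_coc eqxx addr0.
have G2 := @gauss R i h h c Y h0 h0 sY.
have cont f : smooth f -> itg (cell h c) f by move=> sf; apply: itg_cont; exact: smooth_continuous.
have mc : meas (cell h c) by exact: rect_meas.
have sA : smooth A by rewrite -(funext eA); exact: smooth_D.
have sB : smooth B by rewrite -(funext eB); exact: smooth_D.
have dF x : 'D_(ei j) F x = F1 x * A x - co j (x - c) * pj x.
  by rewrite (@pdM R j F1 pj x sF1 sj) dF1 eA mulrN [pj x * _]mulrC.
have dY x : 'D_(ei i) Y x = X x * co j (x - c) * B x + co j (x - c) * pj x.
  rewrite (@pdM R i X (fun x => co j (x - c) * pj x) x sX sy) dX mulr1.
  by rewrite (@pd_coM i j c pj x sj) eB /j rev_neq mul0r add0r mulrA.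
rewrite -cellE (_ : 'D_(ei j) F = fun x => F1 x * A x - co j (x - c) * pj x) in G1; last exact/funext.
rewrite -cellE (_ : 'D_(ei i) Y = fun x => X x * co j (x - c) * B x + co j (x - c) * pj x) in G2; last exact/funext.
have sFA : smooth (fun x => F1 x * A x) := smooth_mul sF1 sA.
have sXB : smooth (fun x => X x * co j (x - c) * B x) := smooth_mul (smooth_mul sX (smooth_coc j c)) sB.
rewrite (I2B mc (cont _ sFA) (cont _ sy)) in G1; rewrite (I2D mc (cont _ sXB) (cont _ sy)) in G2.
have L a' : line i h (c + a' *: ei i) Y = (a' + a * h) * line i h (c + a' *: ei i) (fun x => co (rev_ord i) (x - (c + a' *: ei i)) * pj x).
  rewrite -lineZ; last by apply: smooth_continuous; exact: smooth_coM.
  apply: line_eq => t _; rewrite /Y /X -/j.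
  rewrite (_ : co i _ = a'); last by rewrite !coE; ring.
  congr (_ * (_ * _)); rewrite !coE; ring.
rewrite -scaleNr !L in G2.
rewrite -[I2 _ _]/(I2 (cell h c) (fun x => F1 x * A x)).
rewrite (_ : I2 (cell h c) (fun x => F1 x * A x) = I2 (cell h c) (fun x => co j (x - c) * pj x)); last first.
  by apply/eqP; rewrite -subr_eq0 G1 subrr.
rewrite [RHS]addrC; apply: (etrans _ (esym G2)).
by case: ha => ->; rewrite ?mulN1r ?mul1r; ring.
Qed.

Lemma cs_cell h c (G A : R2 -> R) (M : R) : 0 < h -> continuous G -> inL2 (cell h c) A ->
  (forall x, cell h c x -> `|G x| <= M) ->
  I2 (cell h c) (fun x => G x * A x) ^+ 2 <= 4 * h ^+ 2 * M ^+ 2 * I2 (cell h c) (fun x => A x ^+ 2).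
Proof.
move=> h0 sG AL bG; have mc : meas (cell h c) by exact: rect_meas.
have GL : inL2 (cell h c) G by exact: inL2_cont.
apply: le_trans (cauchy_schwarz mc GL AL) _; apply: ler_wpM2r; first by apply: I2_ge0 => x _; exact: sqr_ge0.
have -> : 4 * h ^+ 2 * M ^+ 2 = I2 (cell h c) (fun=> M ^+ 2) by rewrite I2_rect_cst//; ring.
apply: I2_le => //; [exact: inL2_sq|by apply: itg_cst => //; exact: rect_fin|].
move=> x cx; rewrite -(real_normK (num_real (G x))) lerXn2r// ?nnegrE//; last exact: bG.
exact: le_trans (normr_ge0 _) (bG _ cx).
Qed.

Lemma cellP h c x i : cell h c x -> `|co i (x - c)| < h.
Proof. by rewrite (cellE i) => -[]. Qed.

(** Cauchy-Schwarz in [edge_mom_cell]. *)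
Lemma edge_mom_sq i h c phi (a : R) : 0 < h -> (a = 1 \/ a = -1) -> smooth phi ->
  edge_mom i h (c + (a * h) *: ei i) phi ^+ 2 <=
  8 * h ^+ 4 * (I2 (cell h c) (fun x => pderiv [:: rev_ord i; rev_ord i] phi x ^+ 2)
              + I2 (cell h c) (fun x => pderiv [:: i; rev_ord i] phi x ^+ 2)).
Proof.
move=> h0 ha sp.
have EM := @edge_mom_cell i h c (pderiv [:: rev_ord i] phi) (pderiv [:: rev_ord i; rev_ord i] phi)
  (pderiv [:: i; rev_ord i] phi) a h0 ha (smooth_pderiv _ sp) (fun=> erefl) (fun=> erefl).
set T := edge_mom _ _ _ _; rewrite -[line _ _ _ _]/T in EM.
have sA := smooth_pderiv [:: rev_ord i; rev_ord i] sp; have sB := smooth_pderiv [:: i; rev_ord i] sp.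
move: sA sB EM; move: (pderiv [:: rev_ord i; rev_ord i] phi) (pderiv [:: i; rev_ord i] phi) => A B sA sB.
set X := I2 _ _; set Y := I2 _ _ => EM.
have L f : smooth f -> inL2 (cell h c) f by move=> sf; apply: inL2_cont; exact: smooth_continuous.
have XA : X ^+ 2 <= 4 * h ^+ 2 * (h ^+ 2 / 2) ^+ 2 * I2 (cell h c) (fun x => A x ^+ 2).
  apply: (cs_cell h0 _ (L _ sA)).
    have -> : (fun x => (h ^+ 2 - co (rev_ord i) (x - c) ^+ 2) / 2) = (fun x => 2^-1 * (h ^+ 2 - co (rev_ord i) (x - c) ^+ 2)).
      by apply/funext => x; rewrite mulrC.
    apply: smooth_continuous; apply: smooth_scale; apply: smooth_sub; first exact: smooth_cst.
    by apply: smooth_exp; exact: smooth_coc.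
  move=> x /(@cellP _ _ _ (rev_ord i)); rewrite ltr_norml ler_norml => /andP[? ?]; apply/andP; split; nra.
have YB : Y ^+ 2 <= 4 * h ^+ 2 * (2 * h ^+ 2) ^+ 2 * I2 (cell h c) (fun x => B x ^+ 2).
  apply: (cs_cell h0 _ (L _ sB)).
    apply: smooth_continuous; apply: smooth_mul; last exact: smooth_coc.
    by apply: smooth_add; [exact: smooth_coc|exact: smooth_cst].
  move=> x cx; rewrite normrM; have /ltW H2 := @cellP _ _ _ (rev_ord i) cx.
  have -> : 2 * h ^+ 2 = (2 * h) * h by ring.
  apply: ler_pM => //; have := @cellP _ _ _ i cx.
  by rewrite ltr_norml ler_norml => /andP[? ?]; apply/andP; split; case: ha => ->; lra.
have A0 : 0 <= I2 (cell h c) (fun x => A x ^+ 2) by apply: I2_ge0 => x _; exact: sqr_ge0.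
have B0 : 0 <= I2 (cell h c) (fun x => B x ^+ 2) by apply: I2_ge0 => x _; exact: sqr_ge0.
move: A0 B0 XA YB; move: (I2 _ (fun x => A x ^+ 2)) (I2 _ (fun x => B x ^+ 2)) => IA IB A0 B0 XA YB.
have p : 0 < 4 * h ^+ 2 by rewrite mulr_gt0// exprn_gt0.
rewrite -(ler_pM2l p).
have -> : 4 * h ^+ 2 * T ^+ 2 = (X + Y) ^+ 2 by rewrite -EM; ring.
have S2 : (X + Y) ^+ 2 <= 2 * X ^+ 2 + 2 * Y ^+ 2 by have := sqr_ge0 (X - Y); nra.
have q : 0 <= h ^+ 6 * IA by rewrite mulr_ge0// exprn_ge0// ltW.
have q' : 0 <= h ^+ 6 * IB by rewrite mulr_ge0// exprn_ge0// ltW.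
have e1 : 4 * h ^+ 2 * (h ^+ 2 / 2) ^+ 2 * IA = h ^+ 6 * IA by field.
have e2 : 4 * h ^+ 2 * (2 * h ^+ 2) ^+ 2 * IB = 16 * (h ^+ 6 * IB) by ring.
have -> : 4 * h ^+ 2 * (8 * h ^+ 4 * (IA + IB)) = 32 * (h ^+ 6 * IA) + 32 * (h ^+ 6 * IB) by ring.
rewrite e1 in XA; rewrite e2 in YB; lra.
Qed.

(** Integrating t d_j psi by parts along the edge gives the integral of d_jj psi
against the positive weight (h^2 - t^2) / 2, whose mass is 2h^3 / 3. *)
Lemma edge_mom_approx i h m psi (k d : R) : 0 < h -> smooth psi ->
  (forall t, `|t| <= h -> `|pderiv [:: rev_ord i; rev_ord i] psi (m + t *: ei (rev_ord i)) - k| <= d) ->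
  `|edge_mom i h m psi - 2 * h ^+ 3 / 3 * k| <= 2 * h ^+ 3 / 3 * d.
Proof.
move=> h0 sp; set j := rev_ord i.
have sA := smooth_pderiv [:: j; j] sp; have sj := smooth_pderiv [:: j] sp.
have eA x : 'D_(ei j) (pderiv [:: j] psi) x = pderiv [:: j; j] psi x by [].
set T := edge_mom _ _ _ _.
have eT : T = line i h m (fun x => co j (x - m) * pderiv [:: j] psi x) by [].
move: sA sj eA eT; move: (pderiv [:: j; j] psi) (pderiv [:: j] psi) => A pj sA sj eA eT bd.
(* q has derivative - t and vanishes at both ends of the edge; Q is a primitive of q. *)
pose q : {poly R} := (2^-1)%:P * ((h ^+ 2)%:P - 'X^2).
pose Q : {poly R} := (h ^+ 2 / 2)%:P * 'X - (6^-1)%:P * 'X^3.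
have eq t : q.[t] = (h ^+ 2 - t ^+ 2) / 2 by rewrite /q !hornerE mulrC.
have eQ t : Q.[t] = h ^+ 2 / 2 * t - t ^+ 3 / 6 by rewrite /Q !hornerE /=; field.
have dQ t : Q^`().[t] = q.[t].
  by rewrite eq /Q !(derivXn, derivX, derivC, derivB, derivM) /= !hornerE /=; field.
have dq t : q^`().[t] = - t.
  rewrite /q derivM derivB !derivC derivXn mul0r add0r sub0r /= !hornerE /=.
  by field.
pose F x := q.[co j (x - m)] * pj x.
have sq := smooth_poly q j m; have sQ := smooth_poly Q j m.
have ftc := fun f (sf : smooth f) => @line_ftc R i h m f h0 sf.
have com a : co j (m + a *: ei j - m) = a by rewrite !coE; ring.
have L1 : line i h m (fun x => q.[co j (x - m)]) = 2 * h ^+ 3 / 3.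
  rewrite (_ : (fun x => _) = 'D_(ei j) (fun x => Q.[co j (x - m)])); last first.
    by apply/funext => x; apply/esym; apply: etrans; first exact: d_poly; rewrite dQ.
  by rewrite ftc// -scaleNr !com !eQ; field.
have L2 : line i h m (fun x => q.[co j (x - m)] * A x) = T.
  have := ftc _ (smooth_mul sq sj).
  rewrite (_ : 'D_(ei j) _ = fun x => q.[co j (x - m)] * A x - co j (x - m) * pj x); last first.
    apply/funext => x; apply: etrans; first exact: (@pdM R j _ pj x sq sj).
    by rewrite eA; congr (_ + _); rewrite (@d_poly R q j m x) dq mulrN mulrC.
  have c1 : continuous (fun x => q.[co j (x - m)] * A x) by apply: smooth_continuous; exact: smooth_mul.
  have c2 : continuous (fun x => co j (x - m) * pj x).
    by apply: smooth_continuous; exact: smooth_coM.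
  have q1 : q.[h] = 0 by rewrite eq; ring.
  have q2 : q.[- h] = 0 by rewrite eq; ring.
  have com' : co j (m - h *: ei j - m) = - h by rewrite -scaleNr com.
  rewrite lineB// -eT com com' q1 q2 !mul0r subrr => /eqP.
  by rewrite subr_eq0 => /eqP.
have q0 t : - h <= t <= h -> 0 <= q.[t] by rewrite eq => /andP[? ?]; nra.
have cq : continuous (fun x => q.[co j (x - m)]) by exact: smooth_continuous.
have cqA : continuous (fun x => q.[co j (x - m)] * A x) by apply: smooth_continuous; exact: smooth_mul.
have sZ a : continuous (fun x => a * q.[co j (x - m)]) by apply: smooth_continuous; exact: smooth_scale.
have up : T <= (k + d) * (2 * h ^+ 3 / 3).
  rewrite -L2 -L1 -lineZ//; apply: line_le => // t th; rewrite com mulrC ler_wpM2r ?q0//.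
  by have := bd t; rewrite !ler_norml th => /(_ isT)/andP[? ?]; lra.
have lo : (k - d) * (2 * h ^+ 3 / 3) <= T.
  rewrite -L2 -L1 -lineZ//; apply: line_le => // t th; rewrite com [leRHS]mulrC ler_wpM2r ?q0//.
  by have := bd t; rewrite !ler_norml th => /(_ isT)/andP[? ?]; lra.
rewrite ler_norml; apply/andP; split; lra.
Qed.

End Edge.

(** * Asymptotics of sums of products of moments *)

Section SBP.
Context {R : realType}.
Local Notation R2 := (R * R)%type.
Local Notation M2 := (measurableTypeR R * measurableTypeR R)%type.
Implicit Types (f g psi phi : R2 -> R) (i j : 'I_2) (x m c : R2) (E : set R2) (h r : R) (T : {fset R2}).

Lemma line_lip f i (L : R) x t : smooth f -> (forall y, `|'D_(ei i) f y| <= L) ->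
  `|f (x + t *: ei i) - f x| <= L * `|t|.
Proof.
move=> sf bL.
have P y (s : R) : 0 <= s -> `|f (y + s *: ei i) - f y| <= L * `|s|.
  move=> s0; have D z := @smooth_line R f i y z sf.
  have C : {within `[0, s], continuous (fun t : R => f (y + t *: ei i))}.
    apply: continuous_subspaceT; apply: line_continuous; exact: smooth_continuous.
  have [c _] := @MVT_segment R _ _ _ _ s0 (fun z _ => D z) C.
  by rewrite subr0 scale0r addr0 => ->; rewrite normrM ler_wpM2r.
have [t0|t0] := lerP 0 t; first exact: P.
have := P (x + t *: ei i) (- t); rewrite oppr_ge0 ltW// => /(_ isT).
by rewrite scaleNr addrK distrC normrN.
Qed.

Lemma plane_lip f (L : R) x y : smooth f -> (forall i y, `|'D_(ei i) f y| <= L) ->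
  `|f y - f x| <= L * (`|co ord0 (y - x)| + `|co ord_max (y - x)|).
Proof.
move=> sf bL; set a := co ord0 (y - x); set b := co ord_max (y - x).
have -> : y = x + a *: ei ord0 + b *: ei ord_max.
  apply/eqP; rewrite -addrA addrC -subr_eq; apply/eqP.
  by rewrite {1}(co_split ord0 (y - x)) rev_ord2.1.
rewrite -[X in `|X|](subrKA (f (x + a *: ei ord0))) (le_trans (ler_normD _ _))//.
by rewrite addrC mulrDr lerD// line_lip.
Qed.

Lemma test_lip D (M : R) psi : D `<=` rect ord0 M M 0 -> test_function D psi ->
  exists2 L : R, 0 < L & forall x y,
    `|psi y - psi x| <= L * (`|co ord0 (y - x)| + `|co ord_max (y - x)|).
Proof.
move=> DM tp; have sp := test_smooth tp.
have B i : exists2 L : R, 0 < L & forall x, `|'D_(ei i) psi x| <= L.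
  have [L L0 HL] := @bounded_rect R ord0 M M 0 _ (smooth_continuous (smooth_D i sp)).
  exists L => // x; have [Dx|nDx] := pselect (D x).
    by apply: HL; apply: ltW; have [] := DM _ Dx.
  by rewrite (test_out (test_D i tp) nDx) normr0 ltW.
have [L L0 HL] := B ord0; have [L' L'0 HL'] := B ord_max.
exists (L + L'); first exact: addr_gt0.
move=> x y; apply: plane_lip => // i z; case: (ord2P i) => ->.
  by apply: le_trans (HL z) _; rewrite lerDl ltW.
by apply: le_trans (HL' z) _; rewrite lerDr ltW.
Qed.

Lemma pderivB (s : seq 'I_2) f g : smooth f -> smooth g ->
  pderiv s (fun x => f x - g x) = fun x => pderiv s f x - pderiv s g x.
Proof.
move=> sf sg; elim: s => [//|i s IH]; apply/funext => x /=.
rewrite [X in 'D_(ei i) X x]IH.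
exact: (@pdB R i (pderiv s f) (pderiv s g) x (smooth_pderiv s sf) (smooth_pderiv s sg)).
Qed.

Lemma edge_momB i h m phi psi : smooth phi -> smooth psi ->
  edge_mom i h m (fun x => phi x - psi x) = edge_mom i h m phi - edge_mom i h m psi.
Proof.
move=> sf sg; rewrite /edge_mom -lineB; try by apply: smooth_continuous; apply: smooth_coM; exact: smooth_D.
apply: line_eq => t _; rewrite -mulrBr; congr (_ * _); exact: pdB.
Qed.

(** By [no_neighbour] the open edge does not meet the domain. *)
Lemma edge_mom_boundary D h T i c (a : R) phi : uniform_mesh D h T -> test_function D phi ->
  (a = 1 \/ a = -1) -> c \in T -> c + (a * 2 * h) *: ei i \notin T ->
  edge_mom i h (c + (a * h) *: ei i) phi = 0.
Proof.
move=> mesh tp ha cT nT; have h0 := mesh_h0 mesh.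
transitivity (line i h (c + (a * h) *: ei i) (fun=> 0)); last by rewrite line_cst// mulr0.
apply: line_eq_oo => [||t th]; last 1 first.
- rewrite (test_out (test_D _ tp)) ?mulr0//.
  by apply: (no_neighbour mesh ha cT nT); rewrite ltr_norml.
- by apply: smooth_continuous; apply: smooth_coM; apply: smooth_D; exact: test_smooth tp.
- exact: cst_continuous.
Qed.

(** Abel summation along the lines of cells in direction v: an interior edge is
seen from both of its cells, and the edges without a second cell do not contribute. *)
Lemma summation_by_parts T (v : R2) (A TR TL KR KL : R2 -> R) :
  (forall c, c \in T -> c + v \in T -> TL (c + v) = TR c) ->
  (forall c, c \in T -> c + v \notin T -> TR c = 0) ->
  (forall c, c \in T -> c - v \notin T -> TL c = 0) ->
  (forall c, c \in T -> c + v \in T -> A (c + v) - A c = KR c + KL (c + v)) ->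
  \sum_(c <- T) A c * (TR c - TL c) = - \sum_(c <- T) (TR c * KR c + TL c * KL c).
Proof.
move=> h1 h2 h3 h4.
have shift (F : R2 -> R) : \sum_(c <- T | c + v \in T) F (c + v) = \sum_(c <- T | c - v \in T) F c.
  rewrite -big_filter -[RHS]big_filter -(big_map (fun c => c + v) xpredT F); apply: perm_big.
  apply: uniq_perm; first by rewrite map_inj_uniq ?filter_uniq ?fset_uniq// => x y /addIr.
    by rewrite filter_uniq// fset_uniq.
  move=> x; rewrite mem_filter; apply/mapP/andP => [[y]|[xT' xT]].
    by rewrite mem_filter => /andP[? ?] ->; rewrite addrK.
  by exists (x - v); rewrite ?mem_filter ?subrK// xT.
have Rz (F : R2 -> R) : \sum_(c <- T) TR c * F c = \sum_(c <- T | c + v \in T) TR c * F c.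
  rewrite [LHS](bigID (fun c => c + v \in T)) /= [X in _ + X]big1_seq ?addr0// => c /andP[? ?].
  by rewrite h2// mul0r.
have Lz (F : R2 -> R) : \sum_(c <- T) TL c * F c = \sum_(c <- T | c + v \in T) TR c * F (c + v).
  rewrite [LHS](bigID (fun c => c - v \in T)) /= [X in _ + X]big1_seq ?addr0; last first.
    by move=> c /andP[? ?]; rewrite h3// mul0r.
  rewrite -(shift (fun c => TL c * F c)) [LHS]big_seq_cond [RHS]big_seq_cond.
  by apply: eq_bigr => c /andP[cT ?]; rewrite h1.
rewrite big_split /= Rz Lz -big_split /= -sumrN.
transitivity (\sum_(c <- T) TR c * A c - \sum_(c <- T) TL c * A c).
  by rewrite -sumrB; apply: eq_bigr => c _; ring.
rewrite Rz Lz -sumrB [LHS]big_seq_cond [RHS]big_seq_cond; apply: eq_bigr => c /andP[cT ?].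
by rewrite -mulrDr -h4//; ring.
Qed.

Lemma kap_le h (a b t : R) : `|t| <= h ->
  (a * kapR h t + b * kapL h t) ^+ 2 <= (2 * h ^+ 3 / 3) ^+ 2 * (a ^+ 2 + b ^+ 2).
Proof.
move=> th; have [R0 L0] := kap_ge0 th; rewrite -(kap_sum h t).
move: (kapR h t) (kapL h t) R0 L0 => p q p0 q0.
have -> : (p + q) ^+ 2 * (a ^+ 2 + b ^+ 2) = (a * p + b * q) ^+ 2 + (a * q - b * p) ^+ 2 + 2 * (p * q) * (a ^+ 2 + b ^+ 2) by ring.
rewrite -addrA lerDl addr_ge0 ?sqr_ge0// mulr_ge0 ?addr_ge0 ?sqr_ge0//.
by rewrite mulr_ge0// mulr_ge0.
Qed.

(** The inequality of the arithmetic and geometric means with weight s. *)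
Lemma sqr_le_am (X a Z G s : R) : 0 < s -> 0 <= a -> 0 <= Z -> 0 <= G ->
  X ^+ 2 <= a ^+ 2 * (Z * G) -> `|X| <= a * (s * Z + G / s).
Proof.
move=> s0 a0 Z0 G0 H.
have n0 : 0 <= s * Z + G / s by rewrite addr_ge0// ?divr_ge0 ?mulr_ge0// ltW.
rewrite -(@ler_pXn2r _ 2) ?nnegrE ?mulr_ge0// real_normK ?num_real//.
apply: le_trans H _; rewrite exprMn ler_wpM2l ?sqr_ge0//.
have -> : Z * G = (s * Z) * (G / s) by field; rewrite gt_eqF.
have := sqr_ge0 (s * Z - G / s); have := mulr_ge0 (mulr_ge0 (ltW s0) Z0) (divr_ge0 G0 (ltW s0)).
by move: (s * Z) (G / s) => p q; nra.
Qed.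

Lemma kap_poly h : exists p q : {poly R}, forall t, kapR h t = p.[t] /\ kapL h t = q.[t].
Proof.
exists ((6^-1)%:P * (h%:P + 'X) ^+ 2 * ((2 * h)%:P - 'X)), ((6^-1)%:P * (h%:P - 'X) ^+ 2 * ((2 * h)%:P + 'X)).
by move=> t; rewrite /kapR /kapL !hornerE /=; split; field.
Qed.

(** TR and TL are edge functionals of a function with second derivative A, SR and SL
those of a smoother one with second derivative B.  Since the two kernels add up to
2h^3 / 3 everywhere, the left-hand side is the integral of g against the kernels
times the deviations of TR and TL from 2h^3 / 3 * A. *)
Lemma moment_product_core i h c g (A B : R2 -> R) (TR SR TL SL d D2 s : R) : 0 < h -> 0 < s -> 0 <= D2 ->
  inL2 (cell h c) g -> smooth A -> smooth B ->
  (TR - SR) ^+ 2 <= 8 * h ^+ 4 * (I2 (cell h c) (fun x => (A x - B x) ^+ 2) + D2) ->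
  (TL - SL) ^+ 2 <= 8 * h ^+ 4 * (I2 (cell h c) (fun x => (A x - B x) ^+ 2) + D2) ->
  (forall x, cell h c x -> `|SR - 2 * h ^+ 3 / 3 * B x| <= 2 * h ^+ 3 / 3 * d) ->
  (forall x, cell h c x -> `|SL - 2 * h ^+ 3 / 3 * B x| <= 2 * h ^+ 3 / 3 * d) ->
  `| TR * I2 (cell h c) (fun x => g x * kapR h (co i (x - c)))
   + TL * I2 (cell h c) (fun x => g x * kapL h (co i (x - c)))
   - (2 * h ^+ 3 / 3) ^+ 2 * I2 (cell h c) (fun x => A x * g x) | <=
  h ^+ 6 * (s * (100 * (I2 (cell h c) (fun x => (A x - B x) ^+ 2) + D2)
      + 20 * d ^+ 2 / 16 * I2 (cell h c) (fun=> 1)) + I2 (cell h c) (fun x => g x ^+ 2) / s).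
Proof.
move=> h0 s0 D20 gL sA sB HR HL bR bL.
have mc : meas (cell h c) by exact: rect_meas.
have [p [q pq]] := kap_poly h.
have sR : smooth (fun x => kapR h (co i (x - c))).
  by rewrite (_ : (fun _ => _) = fun x => p.[co i (x - c)]); [exact: smooth_poly|apply/funext => x; have [-> _] := pq (co i (x - c))].
have sL : smooth (fun x => kapL h (co i (x - c))).
  by rewrite (_ : (fun _ => _) = fun x => q.[co i (x - c)]); [exact: smooth_poly|apply/funext => x; have [_ ->] := pq (co i (x - c))].
have I f : smooth f -> itg (cell h c) f by move=> sf; apply: itg_cont; exact: smooth_continuous.
have L f : smooth f -> inL2 (cell h c) f by move=> sf; apply: inL2_cont; exact: smooth_continuous.
set t := 2 * h ^+ 3 / 3 in bR bL *.
pose E x := (TR - t * A x) * kapR h (co i (x - c)) + (TL - t * A x) * kapL h (co i (x - c)).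
have saf a : smooth (fun x => a - t * A x) by apply: smooth_sub; [exact: smooth_cst|exact: smooth_scale].
have sE : smooth E := smooth_add (smooth_mul (saf TR) sR) (smooth_mul (saf TL) sL).
have gM f : smooth f -> itg (cell h c) (fun x => g x * f x) by move=> sf; apply: inL2_itgM => //; exact: L.
have -> : TR * I2 (cell h c) (fun x => g x * kapR h (co i (x - c))) + TL * I2 (cell h c) (fun x => g x * kapL h (co i (x - c)))
   - t ^+ 2 * I2 (cell h c) (fun x => A x * g x) = I2 (cell h c) (fun x => g x * E x).
  have iA : itg (cell h c) (fun x => A x * g x) by apply: inL2_itgM => //; exact: L.
  rewrite -!I2Z//; try exact: gM.
  rewrite -I2D//; try by apply: itgZ => //; exact: gM.
  rewrite -I2B//; try (by apply: itgZ); last by apply: itgD => //; apply: itgZ => //; exact: gM.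
  apply: I2_eq => x _; rewrite /E; have := kap_sum h (co i (x - c)); rewrite -/t.
  move: (kapR _ _) (kapL _ _) => a b ab.
  have -> : b = t - a by rewrite -ab; ring.
  ring.
set D1 := I2 _ (fun x => (A x - B x) ^+ 2) in HR HL *; set V := I2 _ (fun=> 1).
have D10 : 0 <= D1 by apply: I2_ge0 => x _; exact: sqr_ge0.
have V0 : 0 <= V by apply: I2_ge0.
apply: sqr_le_am => //; [by rewrite exprn_ge0// ltW| |by apply: I2_ge0 => x _; exact: sqr_ge0|].
  by rewrite addr_ge0// mulr_ge0// ?addr_ge0// divr_ge0// mulr_ge0// sqr_ge0.
apply: le_trans (cauchy_schwarz mc gL (L _ sE)) _.
rewrite mulrC mulrA; apply: ler_wpM2r; first by apply: I2_ge0 => x _; exact: sqr_ge0.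
pose K := 2 * (3 * (8 * h ^+ 4 * (D1 + D2)) + 3 * (t * d) ^+ 2).
have Ebd x : cell h c x -> E x ^+ 2 <= t ^+ 2 * (K + 6 * t ^+ 2 * (A x - B x) ^+ 2).
  move=> cx; apply: le_trans (kap_le _ _ (ltW (@cellP _ _ _ _ i cx))) _; rewrite -/t.
  apply: ler_wpM2l; first exact: sqr_ge0.
  have aux (T S : R) : (T - S) ^+ 2 <= 8 * h ^+ 4 * (D1 + D2) -> `|S - t * B x| <= t * d ->
    (T - t * A x) ^+ 2 <= K / 2 + 3 * t ^+ 2 * (A x - B x) ^+ 2.
    move=> H1 H2; have H3 : (S - t * B x) ^+ 2 <= (t * d) ^+ 2.
      move: H2; move: (S - t * B x) (t * d) => y e; rewrite ler_norml => /andP[? ?].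
      by nra.
    rewrite /K.
    have -> : T - t * A x = (T - S) + (S - t * B x) - t * (A x - B x) by ring.
    have -> : 3 * t ^+ 2 * (A x - B x) ^+ 2 = 3 * (t * (A x - B x)) ^+ 2 by ring.
    move: H1 H3; move: (T - S) (S - t * B x) (t * (A x - B x)) (8 * h ^+ 4 * (D1 + D2)) ((t * d) ^+ 2) => a b e X Y.
    by have := sqr_ge0 (a - b); have := sqr_ge0 (a + e); have := sqr_ge0 (b + e); clear; nra.
  by have := aux _ _ HR (bR _ cx); have := aux _ _ HL (bL _ cx); clear; lra.
have iAB : itg (cell h c) (fun x => (A x - B x) ^+ 2) by apply: I; apply: smooth_exp; exact: smooth_sub.
have i1 : itg (cell h c) (fun=> 1) by apply: I; exact: smooth_cst.
apply: (@le_trans _ _ (t ^+ 2 * (K * V + 6 * t ^+ 2 * D1))).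
  have -> : t ^+ 2 * (K * V + 6 * t ^+ 2 * D1) = I2 (cell h c) (fun x => t ^+ 2 * (K * 1 + 6 * t ^+ 2 * (A x - B x) ^+ 2)).
    rewrite I2Z//; last by apply: itgD => //; apply: itgZ.
    by rewrite I2D//; [rewrite !I2Z|apply: itgZ|apply: itgZ].
  apply: I2_le => //; first by apply: inL2_sq; exact: L.
    by apply: itgZ => //; apply: itgD => //; apply: itgZ.
  by move=> x cx; rewrite mulr1; exact: Ebd.
have -> : V = 4 * h ^+ 2 by rewrite /V I2_rect_cst//; ring.
rewrite /K /t.
have h6 : 0 <= h ^+ 12 by rewrite exprn_ge0// ltW.
have q1 : 0 <= h ^+ 12 * D1 by rewrite mulr_ge0.
have q2 : 0 <= h ^+ 12 * D2 by rewrite mulr_ge0.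
have q3 : 0 <= h ^+ 12 * (d ^+ 2 * h ^+ 2) by rewrite mulr_ge0// mulr_ge0// sqr_ge0.
have -> : (2 * h ^+ 3 / 3) ^+ 2 * (2 * (3 * (8 * h ^+ 4 * (D1 + D2)) + 3 * (2 * h ^+ 3 / 3 * d) ^+ 2) * (4 * h ^+ 2) +
   6 * (2 * h ^+ 3 / 3) ^+ 2 * D1) = (4/9) * (192 * (h ^+ 12 * D1) + 192 * (h ^+ 12 * D2) + 24 * (4/9) * (h ^+ 12 * (d ^+ 2 * h ^+ 2)) + 6 * (4 / 9) * (h ^+ 12 * D1)) by field.
have -> : (h ^+ 6) ^+ 2 * (100 * (D1 + D2) + 20 * d ^+ 2 / 16 * (4 * h ^+ 2)) =
  100 * (h ^+ 12 * D1) + 100 * (h ^+ 12 * D2) + 5 * (h ^+ 12 * (d ^+ 2 * h ^+ 2)) by field.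
move: q1 q2 q3; clear; lra.
Qed.

Lemma lip_aux (a b u v t h : R) : a < h -> b < h -> t <= h -> v <= t + b -> u <= h + a -> u + v <= 4 * h.
Proof. lra. Qed.

(** The edge functionals of psi are controlled by [edge_mom_approx] and those of
phi - psi by [edge_mom_sq]. *)
Lemma moment_product_cell i h c g phi psi (L s : R) : 0 < h -> 0 < s -> 0 <= L -> inL2 (cell h c) g ->
  smooth phi -> smooth psi ->
  (forall x y, `|pderiv [:: rev_ord i; rev_ord i] psi y - pderiv [:: rev_ord i; rev_ord i] psi x|
     <= L * (`|co ord0 (y - x)| + `|co ord_max (y - x)|)) ->
  `| edge_mom i h (c + h *: ei i) phi * I2 (cell h c) (fun x => g x * kapR h (co i (x - c)))
   + edge_mom i h (c - h *: ei i) phi * I2 (cell h c) (fun x => g x * kapL h (co i (x - c)))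
   - (2 * h ^+ 3 / 3) ^+ 2 * I2 (cell h c) (fun x => pderiv [:: rev_ord i; rev_ord i] phi x * g x) | <=
  h ^+ 6 * (s * (100 * (I2 (cell h c) (fun x => (pderiv [:: rev_ord i; rev_ord i] phi x - pderiv [:: rev_ord i; rev_ord i] psi x) ^+ 2)
     + I2 (cell h c) (fun x => (pderiv [:: i; rev_ord i] phi x - pderiv [:: i; rev_ord i] psi x) ^+ 2))
      + 20 * h ^+ 2 * L ^+ 2 * I2 (cell h c) (fun=> 1)) + I2 (cell h c) (fun x => g x ^+ 2) / s).
Proof.
move=> h0 s0 L0 gL sp sq Lip.
have mc : meas (cell h c) by exact: rect_meas.
pose chi x := phi x - psi x; have sc : smooth chi by exact: smooth_sub.
have T1 := @edge_mom_sq R i h c chi 1 h0 (or_introl erefl) sc.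
have T2 := @edge_mom_sq R i h c chi (-1) h0 (or_intror erefl) sc.
rewrite !pderivB// !mul1r in T1; rewrite !pderivB// !mulN1r scaleNr in T2.
rewrite edge_momB// in T1; rewrite edge_momB// in T2.
have Ap (a : R) x : (a = h \/ a = - h) -> cell h c x ->
   `|edge_mom i h (c + a *: ei i) psi - 2 * h ^+ 3 / 3 * pderiv [:: rev_ord i; rev_ord i] psi x|
     <= 2 * h ^+ 3 / 3 * (4 * h * L).
  move=> ha cx; apply: edge_mom_approx => // t th; apply: le_trans (Lip _ _) _.
  rewrite mulrC; apply: ler_wpM2r => //.
  have -> (y : R2) : `|co ord0 y| + `|co ord_max y| = `|co i y| + `|co (rev_ord i) y|.
    by case: (ord2P i) => ->; rewrite rev_ord2 // addrC.
  have X1 := @cellP _ _ _ _ i cx; have X2 := @cellP _ _ _ _ (rev_ord i) cx.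
  have -> : co i (c + a *: ei i + t *: ei (rev_ord i) - x) = a - co i (x - c) by rewrite !coE; ring.
  have -> : co (rev_ord i) (c + a *: ei i + t *: ei (rev_ord i) - x) = t - co (rev_ord i) (x - c).
    by rewrite !coE; ring.
  have := ler_normB a (co i (x - c)); have := ler_normB t (co (rev_ord i) (x - c)).
  have -> : `|a| = h by case: ha => ->; rewrite ?normrN gtr0_norm.
  exact: lip_aux X1 X2 th.
have Ap1 x := @Ap h x (or_introl erefl); have Ap2 x := @Ap (- h) x (or_intror erefl).
rewrite scaleNr in Ap2.
have sA := smooth_pderiv [:: rev_ord i; rev_ord i] sp; have sB := smooth_pderiv [:: rev_ord i; rev_ord i] sq.
rewrite (_ : 20 * h ^+ 2 * L ^+ 2 * _ = 20 * (4 * h * L) ^+ 2 / 16 * I2 (cell h c) (fun=> 1)); last by field.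
by apply: (@moment_product_core i h c g _ _ _ _ _ _ (4 * h * L) _ s h0 s0 _ gL sA sB T1 T2 Ap1 Ap2); apply: I2_ge0 => x _; exact: sqr_ge0.
Qed.

(** Rewrites all the integrals over the domain as sums over the cells at once. *)
Lemma moment_product_subst (X k a b b' v e h6 s n h L a2 b2 b2' v2 e2 : R) : a = a2 -> b = b2 -> b' = b2' -> v = v2 -> e = e2 ->
  `|X - k * a2| <= h6 * (s * (n * (b2 + b2') + 20 * h ^+ 2 * L ^+ 2 * v2) + e2 / s) ->
  `|X - k * a| <= h6 * (s * (n * (b + b') + 20 * h ^+ 2 * L ^+ 2 * v) + e / s).
Proof. by move=> -> -> -> -> ->. Qed.

Section OneMesh.
Context (D : set R2) (h : R) (T : {fset R2}) (mesh : uniform_mesh D h T).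
Let mD : meas D := mesh_meas mesh.

(** Summation by parts over the mesh, [moment_jump] giving the increments of the
moments and [edge_mom_boundary] the absence of boundary terms, followed by the sum of
the local estimates. *)
Lemma moment_product_err i f f1 g phi psi (L s : R) : 0 < s -> 0 <= L -> inL2 D f -> inL2 D f1 -> inL2 D g ->
  (forall p, test_function D p ->
     I2 D (fun x => f x * 'D_(ei i) p x) = - I2 D (fun x => f1 x * p x)) ->
  (forall p, test_function D p ->
     I2 D (fun x => f1 x * 'D_(ei i) p x) = - I2 D (fun x => g x * p x)) ->
  test_function D phi -> test_function D psi ->
  (forall x y, `|pderiv [:: rev_ord i; rev_ord i] psi y - pderiv [:: rev_ord i; rev_ord i] psi x|
     <= L * (`|co ord0 (y - x)| + `|co ord_max (y - x)|)) ->
  `| \sum_(c <- T) mom i h c f * mom (rev_ord i) h c (pderiv [:: i; rev_ord i] phi)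
     + (2 * h ^+ 3 / 3) ^+ 2 * I2 D (fun x => pderiv [:: rev_ord i; rev_ord i] phi x * g x) | <=
  h ^+ 6 * (s * (100 * (I2 D (fun x => (pderiv [:: rev_ord i; rev_ord i] phi x - pderiv [:: rev_ord i; rev_ord i] psi x) ^+ 2)
     + I2 D (fun x => (pderiv [:: i; rev_ord i] phi x - pderiv [:: i; rev_ord i] psi x) ^+ 2))
      + 20 * h ^+ 2 * L ^+ 2 * I2 D (fun=> 1)) + I2 D (fun x => g x ^+ 2) / s).
Proof.
move=> s0 L0 fL f1L gL H1 H2 tp tq Lip; have h0 := mesh_h0 mesh.
have sp := test_smooth tp; have sq := test_smooth tq.
have [M M0 DM] := mesh_bounded mesh.
have bd F : smooth F -> inL2 D F by move=> sF; exact: (bounded_smooth_inL2 mD DM).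
have sub c : c \in T -> cell h c `<=` D by exact: cell_sub.
have mc c : meas (cell h c) by exact: rect_meas.
pose TR c := edge_mom i h (c + h *: ei i) phi; pose TL c := edge_mom i h (c - h *: ei i) phi.
pose KR c := I2 (cell h c) (fun x => g x * kapR h (co i (x - c))).
pose KL c := I2 (cell h c) (fun x => g x * kapL h (co i (x - c))).
have SBP : \sum_(c <- T) mom i h c f * (TR c - TL c) = - \sum_(c <- T) (TR c * KR c + TL c * KL c).
  apply: (@summation_by_parts T ((2 * h) *: ei i)).
  - move=> c _ _; rewrite /TL /TR; congr edge_mom; apply: (@co_inj _ i); rewrite !coE; ring.
  - move=> c cT; have := @edge_mom_boundary D h T i c 1 phi mesh tp (or_introl erefl) cT.
    by rewrite !mul1r.
  - move=> c cT; have := @edge_mom_boundary D h T i c (-1) phi mesh tp (or_intror erefl) cT.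
    by rewrite !mulN1r mulNr !scaleNr.
  - move=> c cT cT'; apply: (moment_jump mD h0 _ fL f1L gL H1 H2); [exact: (patch_sub mesh cT cT')|exact: sub|exact: sub].
have -> : \sum_(c <- T) mom i h c f * mom (rev_ord i) h c (pderiv [:: i; rev_ord i] phi) =
    \sum_(c <- T) mom i h c f * (TR c - TL c).
  by apply: eq_bigr => c _; congr (_ * _); exact: mom_edges.
rewrite SBP -normrN opprD opprK.
pose A := pderiv [:: rev_ord i; rev_ord i] phi; pose B := pderiv [:: rev_ord i; rev_ord i] psi.
pose A' := pderiv [:: i; rev_ord i] phi; pose B' := pderiv [:: i; rev_ord i] psi.
have sA : smooth A by exact: smooth_pderiv. have sB : smooth B by exact: smooth_pderiv.
have sA' : smooth A' by exact: smooth_pderiv. have sB' : smooth B' by exact: smooth_pderiv.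
have iAB : itg D (fun x => (A x - B x) ^+ 2) by apply: inL2_sq; apply: bd; exact: smooth_sub.
have iAB' : itg D (fun x => (A' x - B' x) ^+ 2) by apply: inL2_sq; apply: bd; exact: smooth_sub.
have i1 : itg D (fun=> 1) by apply: itg_cst => //; exact: mesh_fin mesh.
have iAg : itg D (fun x => A x * g x) by apply: inL2_itgM => //; exact: bd.
have ig : itg D (fun x => g x ^+ 2) by exact: inL2_sq.
apply: (moment_product_subst (I2_mesh mesh iAg) (I2_mesh mesh iAB) (I2_mesh mesh iAB') (I2_mesh mesh i1) (I2_mesh mesh ig)).
rewrite mulr_sumr -sumrB; apply: le_trans (ler_norm_sum _ _ _) _.
rewrite -big_split /= !mulr_sumr -big_split /= mulr_sumr mulr_suml -big_split /= mulr_sumr.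
rewrite [leLHS]big_seq [leRHS]big_seq; apply: ler_sum => c cT.
apply: (@moment_product_cell i h c g phi psi L s h0 s0 L0 _ sp sq Lip).
exact: (inL2_sub mD (mc c) (sub c cT) gL).
Qed.
End OneMesh.

Lemma cvg_le_eventually (x : nat -> R) (a B : R) : x n @[n --> \oo] --> a ->
  (\forall n \near \oo, `|x n| <= B) -> `|a| <= B.
Proof.
move=> /cvg_norm xa H; rewrite -(cvg_lim _ xa)//; apply: limr_le => //.
by apply/cvg_ex; exists `|a|.
Qed.

Lemma cvg_scale (x : nat -> R) (k a : R) : x n @[n --> \oo] --> a -> (k * x n) @[n --> \oo] --> k * a.
Proof. by move=> xa; apply: cvgM => //; exact: cvg_cst. Qed.

Lemma L2_close D (w a b : R2 -> R) (eta : R) : meas D -> inL2 D w -> inL2 D a -> inL2 D b ->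
  I2 D (fun x => (w x - a x) ^+ 2) <= eta -> I2 D (fun x => (w x - b x) ^+ 2) <= eta ->
  I2 D (fun x => (a x - b x) ^+ 2) <= 4 * eta.
Proof.
move=> mD wL aL bL ea eb.
have ia : itg D (fun x => (w x - a x) ^+ 2) by apply: inL2_sq; exact: inL2B.
have ib : itg D (fun x => (w x - b x) ^+ 2) by apply: inL2_sq; exact: inL2B.
apply: (@le_trans _ _ (2 * I2 D (fun x => (w x - a x) ^+ 2) + 2 * I2 D (fun x => (w x - b x) ^+ 2))); last by lra.
rewrite -!I2Z// -I2D//; try exact: itgZ.
apply: I2_le => //; [by apply: inL2_sq; exact: inL2B|by apply: itgD => //; exact: itgZ|].
move=> y _; move: (w y) (a y) (b y) => p q r.
by have := sqr_ge0 (p - q + (p - r)); nra.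
Qed.

Lemma moment_product_mono (s X Y e k G E : R) : 0 < s -> X <= e -> Y <= e -> G <= E ->
  s * (100 * (X + Y) + k) + G <= s * (100 * (e + e) + k) + E.
Proof. by move=> s0 Xe Ye GE; apply: lerD => //; apply: ler_wpM2l; [exact: ltW|lra]. Qed.

(** In [moment_product_err] the function phi runs through test functions tending to u, whereas
psi is one fixed member of the sequence: psi is close enough to u to make the first
error term small, and h is then small compared with the Lipschitz constant of
d_jj psi. *)
Lemma moment_product_limit D (h1 : R) (T1 : {fset R2}) u i f f1 g (eps : R) : uniform_mesh D h1 T1 ->
  inH0 2 D u -> inL2 D f -> inL2 D f1 -> inL2 D g ->
  (forall p, test_function D p ->
     I2 D (fun x => f x * 'D_(ei i) p x) = - I2 D (fun x => f1 x * p x)) ->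
  (forall p, test_function D p ->
     I2 D (fun x => f1 x * 'D_(ei i) p x) = - I2 D (fun x => g x * p x)) ->
  0 < eps -> exists2 h0 : R, 0 < h0 & forall h T, uniform_mesh D h T -> h < h0 ->
  `| \sum_(c <- T) mom i h c f * mom (rev_ord i) h c (U D u [:: i; rev_ord i])
     + (2 * h ^+ 3 / 3) ^+ 2 * I2 D (fun x => U D u [:: rev_ord i; rev_ord i] x * g x) | <= eps * h ^+ 6.
Proof.
move=> mesh1 H0u fL f1L gL H1 H2 e0.
have mD := mesh_meas mesh1; have [M M0 DM] := mesh_bounded mesh1.
set j := rev_ord i.
set G := I2 D (fun x => g x ^+ 2); have G0 : 0 <= G by apply: I2_ge0 => x _; exact: sqr_ge0.
set V := I2 D (fun=> 1); have V0 : 0 <= V by apply: I2_ge0.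
(* The weight s makes the term in G at most eps / 4; two approximants at squared
   distance at most eta from u make the term in phi - psi at most eps / 2. *)
pose s := 4 * (G + 1) / eps; have s0 : 0 < s by rewrite divr_gt0// mulr_gt0// ltr_wpDl.
pose eta := eps / (40 * (40 * s)); have eta0 : 0 < eta.
  by apply: divr_gt0 => //; apply: mulr_gt0; [rewrite ltr0n|apply: mulr_gt0 => //; rewrite ltr0n].
have Gs : G / s <= eps / 4.
  rewrite ler_pdivrMr// /s.
  have -> : eps / 4 * (4 * (G + 1) / eps) = G + 1 by field; rewrite gt_eqF.
  by rewrite lerDl.
have etaE : s * (100 * (4 * eta + 4 * eta)) = eps / 2.
  by rewrite /eta; field; rewrite gt_eqF.
clearbody eta; clearbody s.
have [phi [tphi Lphi]] := dense_seq mesh1 H0u.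
have cj := Lphi [:: j; j] isT; have ci := Lphi [:: i; j] isT.
have near_eta k : L2cvg D (fun n => pderiv k (phi n)) (U D u k) ->
   \forall n \near \oo, I2 D (fun x => (U D u k x - pderiv k (phi n) x) ^+ 2) <= eta.
  move=> [_ _ /cvgrPdist_le /(_ _ eta0)]; apply: filterS => n.
  by rewrite sub0r normrN; apply: le_trans; exact: ler_norm.
have nj := near_eta _ cj; have ni := near_eta _ ci.
(* The N-th approximant is kept fixed, so that its Lipschitz constant L does not
   depend on the mesh. *)
have [N HN] : exists N, I2 D (fun x => (U D u [:: j; j] x - pderiv [:: j; j] (phi N) x) ^+ 2) <= eta /\
    I2 D (fun x => (U D u [:: i; j] x - pderiv [:: i; j] (phi N) x) ^+ 2) <= eta.
  have [N _ HN] := filterI nj ni; by exists N; apply: HN => /=.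
have [L L0 Lip] := test_lip DM (test_pderiv [:: j; j] (tphi N)).
pose h0 := Num.min 1 (eps / (80 * s * (L ^+ 2 * V + 1))).
have W0 : 0 < 80 * s * (L ^+ 2 * V + 1).
  apply: mulr_gt0; first by apply: mulr_gt0 => //; rewrite ltr0n.
  by apply: ltr_wpDl => //; apply: mulr_ge0 => //; exact: sqr_ge0.
exists h0; first by rewrite /h0 lt_min ltr01 divr_gt0.
move=> h T mesh; rewrite /h0 lt_min => /andP[hl1 hh]; have hp := mesh_h0 mesh.
have Vh : s * (20 * h ^+ 2 * L ^+ 2 * V) <= eps / 4.
  have hh2 : h ^+ 2 <= h by rewrite expr2 ler_piMl// ltW.
  have : h * (80 * s * (L ^+ 2 * V + 1)) <= eps by rewrite -ler_pdivlMr// ltW.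
  have LV : 0 <= s * (L ^+ 2 * V) by apply: mulr_ge0; [exact: ltW|apply: mulr_ge0 => //; exact: sqr_ge0].
  have : h ^+ 2 * (s * (L ^+ 2 * V)) <= h * (s * (L ^+ 2 * V)) by rewrite ler_wpM2r.
  have : 0 <= h * s by apply: mulr_ge0; exact: ltW.
  have -> : s * (20 * h ^+ 2 * L ^+ 2 * V) = 20 * (h ^+ 2 * (s * (L ^+ 2 * V))) by ring.
  have -> : h * (80 * s * (L ^+ 2 * V + 1)) = 80 * (h * (s * (L ^+ 2 * V))) + 80 * (h * s) by ring.
  by clear; lra.
have mc c : meas (cell h c) by exact: rect_meas.
pose xb n := (2 * h ^+ 3 / 3) ^+ 2 * I2 D (fun x => pderiv [:: j; j] (phi n) x * g x).
pose xa n := \sum_(c <- T | (c \in T) && true) mom i h c f * mom j h c (pderiv [:: i; j] (phi n)).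
have cb : xb n @[n --> \oo] --> (2 * h ^+ 3 / 3) ^+ 2 * I2 D (fun x => U D u [:: j; j] x * g x).
  have cg := L2cvg_I2 mD cj (L2cvg_cst mD gL).
  exact: (@cvg_scale (fun n => I2 D (fun x => pderiv [:: j; j] (phi n) x * g x)) _ _ cg).
have ca : xa n @[n --> \oo] --> \sum_(c <- T | (c \in T) && true) mom i h c f * mom j h c (U D u [:: i; j]).
  rewrite /xa; apply: cvg_big => [|c /andP[cT _]]; first exact: add_continuous.
  have xiL : inL2 (cell h c) (fun x => co j (x - c)).
    by apply: inL2_cont; apply: smooth_continuous; exact: smooth_coc.
  have cg := L2cvg_I2 (mc c) (L2cvg_cst (mc c) xiL) (L2cvg_sub mD (mc c) (cell_sub mesh cT) ci).
  exact: (@cvg_scale (fun n => mom j h c (pderiv [:: i; j] (phi n))) _ _ cg).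
rewrite [X in X + _]big_seq_cond; apply: (@cvg_le_eventually (fun n => xa n + xb n)); first exact: cvgD.
apply: filterS2 nj ni => n Ej Ei.
have [Laj Luj _] := cj; have [Lai Lui _] := ci.
have Bj := L2_close mD Luj (Laj n) (Laj N) Ej HN.1.
have Bi := L2_close mD Lui (Lai n) (Lai N) Ei HN.2.
rewrite /xa -big_seq_cond; apply: le_trans (moment_product_err mesh s0 (ltW L0) fL f1L gL H1 H2 (tphi n) (tphi N) Lip) _.
rewrite mulrC; apply: ler_wpM2r; first by rewrite exprn_ge0// ltW.
rewrite -/G -/V -/j.
apply: (@le_trans _ _ (s * (100 * (4 * eta + 4 * eta) + 20 * h ^+ 2 * L ^+ 2 * V) + eps / 4)).
  exact: (moment_product_mono _ s0 Bj Bi Gs).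
rewrite mulrDr.
rewrite etaE.
move: Vh; clear; lra.
Qed.

End SBP.

(** * The lower bound for the products of moments *)

Section Lower.
Context {R : realType}.
Local Notation R2 := (R * R)%type.
Local Notation M2 := (measurableTypeR R * measurableTypeR R)%type.
Implicit Types (f g psi phi : R2 -> R) (i j : 'I_2) (x m c : R2) (E : set R2) (h r : R) (T : {fset R2}).

(** The only property of a pair of weak derivatives of consecutive orders that the
moment estimates use. *)
Definition weak_pd (D : set R2) i f g := forall psi, test_function D psi ->
  I2 D (fun x => f x * 'D_(ei i) psi x) = - I2 D (fun x => g x * psi x).

Lemma mom_ibp D h c i f f1 (q : {poly R}) : meas D -> 0 < h -> cell h c `<=` D ->
  inL2 D f -> inL2 D f1 -> weak_pd D i f f1 ->
  I2 (cell h c) (fun x => f x * (cutoff h q)^`().[co i (x - c)]) =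
  - I2 (cell h c) (fun x => f1 x * (cutoff h q).[co i (x - c)]).
Proof.
move=> mD h0; rewrite (cellE i) => sub fL f1L H.
exact: (cutoff_ibp1 q mD h0 h0 sub fL f1L H).
Qed.

(** The coordinate xi is minus the derivative of (h^2 - xi^2) / 2. *)
Lemma mom_half D h c i f f1 : meas D -> 0 < h -> cell h c `<=` D ->
  inL2 D f -> inL2 D f1 -> weak_pd D i f f1 ->
  mom i h c f = I2 (cell h c) (fun x => (cutoff h (2^-1)%:P).[co i (x - c)] * f1 x).
Proof.
move=> mD h0 sub fL f1L H; apply: oppr_inj.
have mc : meas (cell h c) by exact: rect_meas.
have fc : inL2 (cell h c) f by exact: inL2_sub fL.
have L (q : {poly R}) : inL2 (cell h c) (fun x => q.[co i (x - c)]).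
  by apply: inL2_cont; apply: smooth_continuous; exact: smooth_poly.
have Lx : inL2 (cell h c) (fun x => co i (x - c)).
  by apply: inL2_cont; apply: smooth_continuous; exact: smooth_coc.
have E := mom_ibp (2^-1)%:P mD h0 sub fL f1L H.
rewrite /mom -I2N//; last exact: inL2_itgM.
transitivity (I2 (cell h c) (fun x => f x * (cutoff h (2^-1)%:P)^`().[co i (x - c)])).
  apply: I2_eq => x _; rewrite cutoff_deriv derivC !hornerE /=.
  by move: (co i _) (f x) => t a; field.
by rewrite E; congr (- _); apply: I2_eq => x _; rewrite mulrC.
Qed.

Lemma mom_sq D h c i f f1 : meas D -> 0 < h -> cell h c `<=` D ->
  inL2 D f -> inL2 D f1 -> weak_pd D i f f1 ->
  mom i h c f ^+ 2 <= h ^+ 6 * I2 (cell h c) (fun x => f1 x ^+ 2).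
Proof.
move=> mD h0 sub fL f1L H; rewrite (mom_half mD h0 sub fL f1L H).
have mc : meas (cell h c) by exact: rect_meas.
have -> : h ^+ 6 = 4 * h ^+ 2 * (h ^+ 2 / 2) ^+ 2 by field.
apply: cs_cell => //; [by apply: smooth_continuous; exact: smooth_poly|exact: inL2_sub f1L|].
move=> x /(@cellP _ _ _ _ i); rewrite cutoff_horner hornerC.
move: (co i _) => t; rewrite ltr_norml ler_norml => /andP[? ?]; apply/andP; split; nra.
Qed.

(** The weight (h^2 - xi^2) / 2 of [mom_half] differs from its mean h^2 / 3 by the
derivative of xi (h^2 - xi^2) / 6. *)
Lemma mom_third D h c i f f1 g : meas D -> 0 < h -> cell h c `<=` D ->
  inL2 D f -> inL2 D f1 -> inL2 D g -> weak_pd D i f f1 -> weak_pd D i f1 g ->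
  (mom i h c f - h ^+ 2 / 3 * I2 (cell h c) f1) ^+ 2 <= h ^+ 8 * I2 (cell h c) (fun x => g x ^+ 2).
Proof.
move=> mD h0 sub fL f1L gL H H1; rewrite (mom_half mD h0 sub fL f1L H).
have mc : meas (cell h c) by exact: rect_meas.
have f1c : inL2 (cell h c) f1 by exact: inL2_sub f1L.
have fin : (@leb2 R (cell h c) < +oo)%E by exact: rect_fin.
have L (q : {poly R}) : inL2 (cell h c) (fun x => q.[co i (x - c)]).
  by apply: inL2_cont; apply: smooth_continuous; exact: smooth_poly.
have E := mom_ibp ((6^-1)%:P * 'X) mD h0 sub f1L gL H1.
have -> : I2 (cell h c) (fun x => (cutoff h (2^-1)%:P).[co i (x - c)] * f1 x) - h ^+ 2 / 3 * I2 (cell h c) f1 =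
   - I2 (cell h c) (fun x => (cutoff h ((6^-1)%:P * 'X)).[co i (x - c)] * g x).
  rewrite -I2Z//; last exact: inL2_itg.
  rewrite -I2B//; [|exact: inL2_itgM|by apply: itgZ => //; exact: inL2_itg].
  transitivity (I2 (cell h c) (fun x => f1 x * (cutoff h ((6^-1)%:P * 'X))^`().[co i (x - c)])).
    apply: I2_eq => x _; rewrite cutoff_deriv cutoff_horner derivM derivC derivX !hornerE /=.
    by move: (co i _) (f1 x) => t a; field.
  by rewrite E; congr (- _); apply: I2_eq => x _; rewrite mulrC.
rewrite sqrrN.
have h8 : 4 * h ^+ 2 * (h ^+ 3 / 2) ^+ 2 = h ^+ 8 by field.
rewrite -h8; apply: cs_cell => //; [by apply: smooth_continuous; exact: smooth_poly|exact: inL2_sub gL|].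
move=> x /(@cellP _ _ _ _ i); rewrite cutoff_horner !hornerE /=.
move: (co i _) => t; rewrite ltr_norml => /andP[t1 t2].
have -> : (h ^+ 2 - t ^+ 2) * 6^-1 * t = (h ^+ 2 - t ^+ 2) * (t / 6) by ring.
have -> : h ^+ 3 / 2 = (h ^+ 2) * (h / 2) by field.
rewrite normrM; apply: ler_pM => //; rewrite ler_norml; apply/andP; split; nra.
Qed.

Section OneMesh.
Context (D : set R2) (h : R) (T : {fset R2}) (mesh : uniform_mesh D h T).
Let mD : meas D := mesh_meas mesh.

Lemma sum_mom_sq i f f1 : inL2 D f -> inL2 D f1 -> weak_pd D i f f1 ->
  \sum_(c <- T) mom i h c f ^+ 2 <= h ^+ 6 * I2 D (fun x => f1 x ^+ 2).
Proof.
move=> fL f1L H; rewrite (I2_mesh mesh (inL2_sq f1L)) mulr_sumr.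
rewrite [leLHS]big_seq [leRHS]big_seq; apply: ler_sum => c cT.
apply: (mom_sq mD _ _ fL f1L H); [exact: mesh_h0 mesh|exact: (cell_sub mesh cT)].
Qed.

(** Both moments are h^2 / 3 times the integral of the common derivative f1, up to
the error of [mom_third]. *)
Lemma sum_mom_diff i j f f' f1 g g' : inL2 D f -> inL2 D f' -> inL2 D f1 -> inL2 D g -> inL2 D g' ->
  weak_pd D j f f1 -> weak_pd D i f' f1 -> weak_pd D j f1 g -> weak_pd D i f1 g' ->
  \sum_(c <- T) (mom j h c f - mom i h c f') ^+ 2 <=
    h ^+ 8 * (2 * I2 D (fun x => g x ^+ 2) + 2 * I2 D (fun x => g' x ^+ 2)).
Proof.
move=> fL f'L f1L gL g'L H H' H1 H1'; have h0 := mesh_h0 mesh.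
rewrite (I2_mesh mesh (inL2_sq gL)) (I2_mesh mesh (inL2_sq g'L)) !mulr_sumr -big_split /= mulr_sumr.
rewrite [leLHS]big_seq [leRHS]big_seq; apply: ler_sum => c cT.
have sub := cell_sub mesh cT.
have := mom_third mD h0 sub fL f1L gL H H1; have := mom_third mD h0 sub f'L f1L g'L H' H1'.
move: (h ^+ 2 / 3 * I2 (cell h c) f1) (mom i h c f') (mom j h c f) => k b a.
move: (I2 _ (fun x => g x ^+ 2)) (I2 _ (fun x => g' x ^+ 2)) (h ^+ 8) => X Y p.
by have := sqr_ge0 (a - k + (b - k)); nra.
Qed.
End OneMesh.

Lemma perm_iij (i j : 'I_2) : perm_eq [:: i; i; j] (rcons [:: j; i] i).
Proof. exact: (permEl (perm_catC [:: i; i] [:: j])). Qed.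

Lemma norm_subst (X k a b e : R) : `|X + k * a| <= e -> a = b -> `|X + k * b| <= e.
Proof. by move=> + <-. Qed.

(** The arithmetic of [moments_lower].  The hypothesis on mu bounds the sum of the
q^2 from below by c1 h^6, through Young's inequality with weight t; the sum of
the b q is at least half of it because b and q are close; and the sum of the a p
differs from that of the b q by little, the main term F being the same. *)
Lemma lower_core T (z q b a p : R2 -> R) (h mu K t c1 B F : R) : 0 < h -> h < 1 -> 0 < mu -> 0 < t ->
  0 <= B -> c1 = 2 * t * mu / 9 -> t * K <= 2 * mu / 9 -> h < c1 / (4 * (B + 1)) ->
  `|\sum_(c <- T) z c * q c + (2 * h ^+ 3 / 3) ^+ 2 * mu| <= 2 * mu / 9 * h ^+ 6 ->
  `|\sum_(c <- T) a c * p c + (2 * h ^+ 3 / 3) ^+ 2 * F| <= c1 / 16 * h ^+ 6 ->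
  `|\sum_(c <- T) b c * q c + (2 * h ^+ 3 / 3) ^+ 2 * F| <= c1 / 16 * h ^+ 6 ->
  \sum_(c <- T) z c ^+ 2 <= h ^+ 6 * K ->
  \sum_(c <- T) (b c - q c) ^+ 2 <= h ^+ 8 * B ->
  c1 / 4 * h ^+ 6 <= \sum_(c <- T) a c * p c.
Proof.
move=> hp l1 mu0 t0 B0 c1E tK ld Sc Sa Sb Zb dif.
have h6 : 0 < h ^+ 6 by exact: exprn_gt0.
have B1 : 0 < 4 * (B + 1) by apply: mulr_gt0 => //; exact: ltr_wpDl.
pose Q := \sum_(c <- T) q c ^+ 2.
(* Young's inequality with weight t. *)
have XcQ : - (\sum_(c <- T) z c * q c) <= 2^-1 * (t * (\sum_(c <- T) z c ^+ 2) + t^-1 * Q).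
  rewrite /Q mulr_sumr mulr_sumr -big_split /= mulr_sumr -sumrN.
  apply: ler_sum => c _; move: (z c) (q c) => x y.
  have : 0 <= t^-1 * (t * x + y) ^+ 2 by rewrite mulr_ge0 ?sqr_ge0// invr_ge0 ltW.
  have -> : t^-1 * (t * x + y) ^+ 2 = t * x ^+ 2 + 2 * x * y + t^-1 * y ^+ 2 by field; rewrite gt_eqF.
  by clear; lra.
have Qlow : c1 * h ^+ 6 <= Q.
  have e : t * (t^-1 * Q) = Q by rewrite mulrA divff ?mul1r// gt_eqF.
  have tZ : t * (\sum_(c <- T) z c ^+ 2) <= 2 * mu / 9 * h ^+ 6.
    apply: (@le_trans _ _ (t * (h ^+ 6 * K))); first by rewrite ler_wpM2l// ltW.
    by have := ler_wpM2r (ltW h6) tK; rewrite mulrAC -mulrA.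
  have : 2 * mu / 9 * h ^+ 6 <= t^-1 * Q.
    move: Sc; have -> : (2 * h ^+ 3 / 3) ^+ 2 * mu = 4 / 9 * (mu * h ^+ 6) by field.
    rewrite ler_norml => /andP[_]; move: XcQ tZ; have -> : 2 * mu / 9 * h ^+ 6 = 2 / 9 * (mu * h ^+ 6) by field.
    by clear; lra.
  move=> /(ler_wpM2l (ltW t0)); rewrite e; apply: le_trans; rewrite c1E le_eqVlt.
  by apply/orP; left; apply/eqP; field.
have XbQ : 2^-1 * Q - 2^-1 * (h ^+ 8 * B) <= \sum_(c <- T) b c * q c.
  have : 2^-1 * Q - 2^-1 * \sum_(c <- T) (b c - q c) ^+ 2 <= \sum_(c <- T) b c * q c.
    rewrite /Q !mulr_sumr -sumrB; apply: ler_sum => c _.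
    move: (b c) (q c) => x y; have := sqr_ge0 x; nra.
  by move: dif; clear; lra.
have h8 : h ^+ 8 * B <= c1 / 4 * h ^+ 6.
  have hh2 : h ^+ 2 <= h by rewrite expr2 ler_piMl// ltW.
  have -> : h ^+ 8 * B = h ^+ 2 * B * h ^+ 6 by ring.
  rewrite ler_wpM2r ?(ltW h6)//.
  have : h * (4 * (B + 1)) <= c1 by rewrite -ler_pdivlMr// ltW.
  have : h ^+ 2 * B <= h * B by rewrite ler_wpM2r.
  by move: hp; clear; lra.
move: Sa Sb; rewrite !ler_norml => /andP[Sa _] /andP[_ Sb].
move: Sa Sb XbQ Qlow h8; move: (_ * F) (h ^+ 8 * B) => x y; clear; lra.
Qed.

(** Here b_c = mom j (d_ii u), q_c = mom i (d_ji u) and z_c = mom j u in the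
notation of [lower_core]. *)
Lemma moments_lower (D : set R2) h1 T1 u i j : rev_ord i = j -> rev_ord j = i -> uniform_mesh D h1 T1 -> inH0 2 D u -> inH 4 D u ->
  0 < I2 D (fun x => u x ^+ 2) ->
  exists2 c0 : R, 0 < c0 & exists2 h0 : R, 0 < h0 & forall h T, uniform_mesh D h T -> h < h0 ->
  c0 * h ^+ 6 <= \sum_(c <- T) mom i h c (U D u [:: i; i]) * mom j h c (U D u [:: i; j]).
Proof.
move=> ij ji mesh1 H0u H4u upos; have mD := mesh_meas mesh1.
have UL s : (size s <= 4)%N -> inL2 D (U D u s) by exact: U_L2.
have UW s s' k : (size s < 4)%N -> perm_eq s' (rcons s k) -> weak_pd D k (U D u s) (U D u s').
  by move=> ss ps psi tp; exact: (U_ibp H4u ss ps tp).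
have sq0 s : 0 <= I2 D (fun x => U D u s x ^+ 2) by apply: I2_ge0 => x _; exact: sqr_ge0.
have [mu muE] : {m | I2 D (fun x => U D u [:: i; i] x * U D u [:: j; j] x) = m} by exists (I2 D (fun x => U D u [:: i; i] x * U D u [:: j; j] x)).
have mu0 : 0 < mu by rewrite -muE (U_mixed mesh1 i j H0u H4u); exact: (U_mixed_gt0 mesh1 i j H0u upos).
have [K KE] : {m | I2 D (fun x => U D u [:: j] x ^+ 2) = m} by exists (I2 D (fun x => U D u [:: j] x ^+ 2)).
have K0 : 0 <= K by rewrite -KE; exact: sq0.
pose t := 2 * mu / (9 * (K + 1)).
have K1 : 0 < 9 * (K + 1) by apply: mulr_gt0; [rewrite ltr0n|exact: ltr_wpDl].
have t0 : 0 < t by apply: divr_gt0 => //; exact: mulr_gt0.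
pose c1 := 2 * t * mu / 9; have c10 : 0 < c1 by apply: divr_gt0 => //; apply: mulr_gt0 => //; exact: mulr_gt0.
have tK : t * K <= 2 * mu / 9.
  have -> : 2 * mu / 9 = t * (K + 1).
    by rewrite /t; field; rewrite gt_eqF// ltr_wpDl.
  by rewrite ler_wpM2l ?ltW// ltrDl.
have [F FE] : {m | I2 D (fun x => U D u [:: i; i] x * U D u [:: i; i; j; j] x) = m}.
  by exists (I2 D (fun x => U D u [:: i; i] x * U D u [:: i; i; j; j] x)).
have F4 : I2 D (fun x => U D u [:: j; j] x * U D u [:: i; i; i; i] x) = F.
  by rewrite -FE; exact: (U_fourth mesh1 i j H0u H4u).
pose B := 2 * I2 D (fun x => U D u [:: i; i; j; j] x ^+ 2) + 2 * I2 D (fun x => U D u [:: i; i; j; i] x ^+ 2).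
have B0 : 0 <= B by apply: addr_ge0; apply: mulr_ge0.
have e10 : 0 < c1 / 16 by exact: divr_gt0.
have e20 : 0 < 2 * mu / 9 by apply: divr_gt0 => //; exact: mulr_gt0.
(* Direction i with f = d_ii u, then direction j with f = d_ii u and with f = u. *)
have [ha ha0 Sa] := @moment_product_limit R D h1 T1 u i _ _ _ _ mesh1 H0u (UL [:: i; i] isT) (UL [:: i; i; i] isT) (UL [:: i; i; i; i] isT)
  (UW [:: i; i] [:: i; i; i] i isT (perm_refl _)) (UW [:: i; i; i] [:: i; i; i; i] i isT (perm_refl _)) e10.
have [hb hb0 Sb] := @moment_product_limit R D h1 T1 u j _ _ _ _ mesh1 H0u (UL [:: i; i] isT) (UL [:: i; i; j] isT) (UL [:: i; i; j; j] isT)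
  (UW [:: i; i] [:: i; i; j] j isT (perm_refl _)) (UW [:: i; i; j] [:: i; i; j; j] j isT (perm_refl _)) e10.
have [hc hc0 Sc] := @moment_product_limit R D h1 T1 u j _ _ _ _ mesh1 H0u (UL [::] isT) (UL [:: j] isT) (UL [:: j; j] isT)
  (UW [::] [:: j] j isT (perm_refl _)) (UW [:: j] [:: j; j] j isT (perm_refl _)) e20.
exists (c1 / 4); first exact: divr_gt0.
pose hd := Num.min 1 (c1 / (4 * (B + 1))).
have B1 : 0 < 4 * (B + 1) by apply: mulr_gt0 => //; exact: ltr_wpDl.
exists (Num.min (Num.min ha hb) (Num.min hc hd)).
  by rewrite /hd !lt_min ha0 hb0 hc0 ltr01 divr_gt0.
move=> h T mesh; rewrite /hd !lt_min => /andP[/andP[la lb] /and3P[lc l1 ld]].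
have hp := mesh_h0 mesh.
have Sa' := Sa h T mesh la; have Sb' := Sb h T mesh lb; have Sc' := Sc h T mesh lc.
rewrite ij in Sa'; rewrite ji in Sb'; rewrite ji U_nil in Sc'.
have Zb : \sum_(c <- T) mom j h c u ^+ 2 <= h ^+ 6 * K.
  have := UW [::] [:: j] j isT (perm_refl _); rewrite U_nil => W.
  rewrite -KE; have := UL [::] isT; rewrite U_nil => uL; exact: (sum_mom_sq mesh uL (UL [:: j] isT) W).
have dif := sum_mom_diff mesh (UL [:: i; i] isT) (UL [:: j; i] isT) (UL [:: i; i; j] isT) (UL [:: i; i; j; j] isT) (UL [:: i; i; j; i] isT)
    (UW [:: i; i] [:: i; i; j] j isT (perm_refl _))
    (UW [:: j; i] [:: i; i; j] i isT (perm_iij i j))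
    (UW [:: i; i; j] [:: i; i; j; j] j isT (perm_refl _)) (UW [:: i; i; j] [:: i; i; j; i] i isT (perm_refl _)).
exact: (lower_core hp l1 mu0 t0 B0 erefl tK ld (norm_subst Sc' muE) (norm_subst Sa' F4) (norm_subst Sb' FE) Zb dif).
Qed.

End Lower.

(** * Shape functions in centred coordinates *)

Section LocalPoly.
Context {R : realType}.
Local Notation R2 := (R * R)%type.
Local Notation M2 := (measurableTypeR R * measurableTypeR R)%type.
Implicit Types (f g psi phi : R2 -> R) (i j : 'I_2) (x c : R2) (E : set R2) (h r : R) (T : {fset R2})
  (k m : R) (a e b : 'I_2 -> R).

Definition cubic i c a e b x : R :=
  a i * co i (x - c) + e i * co i (x - c) ^+ 2 + b i * co i (x - c) ^+ 3.

(** The shape functions in coordinates centred at c, in which the interpolation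
conditions decouple. *)
Definition lpoly c k a e b m x : R :=
  k + \sum_(i < 2) cubic i c a e b x + m * (co ord0 (x - c) * co ord_max (x - c)).

Lemma lpolyE i c k a e b m x : lpoly c k a e b m x =
  k + (cubic i c a e b x + cubic (rev_ord i) c a e b x) + m * (co i (x - c) * co (rev_ord i) (x - c)).
Proof.
rewrite /lpoly !big_ord_recl big_ord0 addr0.
have -> : lift ord0 ord0 = ord_max :> 'I_2 by apply: val_inj.
case: (ord2P i) => ->; rewrite rev_ord2 //.
by rewrite [X in k + X]addrC [X in m * X]mulrC.
Qed.

Lemma P_T_lpoly c k a e b m : P_T (lpoly c k a e b m).
Proof.
pose x0 := c.1; pose y0 := c.2; pose o := ord0 : 'I_2; pose l := ord_max : 'I_2.
pose B (p q : nat) : R := match p, q with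
  | 0%N, 0%N => k - a o * x0 - a l * y0 + e o * x0 ^+ 2 + e l * y0 ^+ 2 - b o * x0 ^+ 3 - b l * y0 ^+ 3 + m * x0 * y0
  | 1%N, 0%N => a o - 2 * e o * x0 + 3 * b o * x0 ^+ 2 - m * y0
  | 0%N, 1%N => a l - 2 * e l * y0 + 3 * b l * y0 ^+ 2 - m * x0
  | 1%N, 1%N => m
  | 2%N, 0%N => e o - 3 * b o * x0
  | 0%N, 2%N => e l - 3 * b l * y0
  | _, _ => 0 end.
exists (fun x => \sum_(i < 3) \sum_(j < 3 | (i + j <= 2)%N) B i j * x.1 ^+ i * x.2 ^+ j).
  by exists B.
exists (b o, b l) => x.
rewrite (lpolyE ord0) rev_ord2.1 /cubic /co /=.
under eq_bigr do rewrite big_mkcond.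
rewrite !big_ord_recl !big_ord0 /= -/o -/l -/x0 -/y0.
ring.
Qed.

Lemma P_T_lpoly0 p : P_T p -> exists k a e b m, p = lpoly 0 k a e b m.
Proof.
move=> [q [B qB] [[b0 b1] pE]].
exists (B 0%N 0%N), (fun i => if i == ord0 then B 1%N 0%N else B 0%N 1%N),
  (fun i => if i == ord0 then B 2%N 0%N else B 0%N 2%N), (fun i => if i == ord0 then b0 else b1), (B 1%N 1%N).
apply/funext => x; rewrite pE qB (lpolyE ord0) rev_ord2.1 /cubic /co /= !subr0.
under eq_bigr do rewrite big_mkcond.
rewrite !big_ord_recl !big_ord0 /=.
ring.
Qed.

Lemma pd_coc_exp i c n x : 'D_(ei i) (fun y => co i (y - c) ^+ n.+1) x = n.+1%:R * co i (x - c) ^+ n.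
Proof.
elim: n => [|n IH].
  by rewrite expr0 mulr1 (_ : (fun _ => _) = fun y => co i (y - c)) ?pd_coc ?eqxx//; apply/funext => y; rewrite expr1.
rewrite (_ : (fun _ => _) = fun y => co i (y - c) * co i (y - c) ^+ n.+1); last by apply/funext => y; rewrite exprS.
rewrite (@pdM R i (fun y => co i (y - c)) (fun y => co i (y - c) ^+ n.+1) x (smooth_coc i c) (smooth_exp n.+1 (smooth_coc i c))).
by rewrite IH pd_coc eqxx mulr1 exprS -(natr1 n.+1); ring.
Qed.

Lemma pd_coc_exp_rev i c n x : 'D_(ei i) (fun y => co (rev_ord i) (y - c) ^+ n) x = 0.
Proof.
elim: n => [|n IH]; first by rewrite (_ : (fun _ => _) = fun=> 1) ?pd_cst//; apply/funext => y; rewrite expr0.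
rewrite (_ : (fun _ => _) = fun y => co (rev_ord i) (y - c) * co (rev_ord i) (y - c) ^+ n); last by apply/funext => y; rewrite exprS.
rewrite (@pdM R i (fun y => co (rev_ord i) (y - c)) (fun y => co (rev_ord i) (y - c) ^+ n) x (smooth_coc _ c) (smooth_exp n (smooth_coc _ c))).
by rewrite IH pd_coc rev_neq !mulr0 addr0.
Qed.

Lemma smooth_cubic i c a e b : smooth (cubic i c a e b).
Proof.
apply: smooth_add; [apply: smooth_add|]; apply: smooth_scale; try apply: smooth_exp; exact: smooth_coc.
Qed.

Lemma smooth_coco i j c : smooth (fun x => co i (x - c) * co j (x - c)).
Proof. by apply: smooth_mul; exact: smooth_coc. Qed.

Lemma smooth_lpoly c k a e b m : smooth (lpoly c k a e b m).
Proof.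
rewrite (funext (lpolyE ord0 c k a e b m)).
apply: smooth_add; [apply: smooth_add; [exact: smooth_cst|apply: smooth_add; exact: smooth_cubic]|].
by apply: smooth_scale; exact: smooth_coco.
Qed.

Lemma pd_cubic i c a e b x :
  'D_(ei i) (cubic i c a e b) x = a i + 2 * e i * co i (x - c) + 3 * b i * co i (x - c) ^+ 2.
Proof.
have s1 := smooth_coc i c; have s2 := smooth_exp 2 s1; have s3 := smooth_exp 3 s1.
rewrite (@pdD R i (fun y => a i * co i (y - c) + e i * co i (y - c) ^+ 2) (fun y => b i * co i (y - c) ^+ 3) x
  (smooth_add (smooth_scale _ s1) (smooth_scale _ s2)) (smooth_scale _ s3)).
rewrite (@pdD R i (fun y => a i * co i (y - c)) (fun y => e i * co i (y - c) ^+ 2) x (smooth_scale _ s1) (smooth_scale _ s2)).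
rewrite (@pdZ R i _ _ x s1) (@pdZ R i _ _ x s2) (@pdZ R i _ _ x s3) pd_coc eqxx !pd_coc_exp /= ?expr1; ring.
Qed.

Lemma pd_cubic_rev i c a e b x : 'D_(ei i) (cubic (rev_ord i) c a e b) x = 0.
Proof.
have s1 := smooth_coc (rev_ord i) c; have s2 := smooth_exp 2 s1; have s3 := smooth_exp 3 s1.
rewrite (@pdD R i (fun y => a (rev_ord i) * co (rev_ord i) (y - c) + e (rev_ord i) * co (rev_ord i) (y - c) ^+ 2)
  (fun y => b (rev_ord i) * co (rev_ord i) (y - c) ^+ 3) x
  (smooth_add (smooth_scale _ s1) (smooth_scale _ s2)) (smooth_scale _ s3)).
rewrite (@pdD R i (fun y => a (rev_ord i) * co (rev_ord i) (y - c)) (fun y => e (rev_ord i) * co (rev_ord i) (y - c) ^+ 2) x (smooth_scale _ s1) (smooth_scale _ s2)).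
rewrite (@pdZ R i _ _ x s1) (@pdZ R i _ _ x s2) (@pdZ R i _ _ x s3) pd_coc rev_neq !pd_coc_exp_rev /=; ring.
Qed.

Lemma pd_lpoly i c k a e b m x : 'D_(ei i) (lpoly c k a e b m) x =
  a i + 2 * e i * co i (x - c) + 3 * b i * co i (x - c) ^+ 2 + m * co (rev_ord i) (x - c).
Proof.
rewrite (funext (lpolyE i c k a e b m)).
have sc := @smooth_cubic i c a e b; have sr := @smooth_cubic (rev_ord i) c a e b.
have sx := smooth_coco i (rev_ord i) c.
rewrite (@pdD R i (fun y => k + (cubic i c a e b y + cubic (rev_ord i) c a e b y))
  (fun y => m * (co i (y - c) * co (rev_ord i) (y - c))) x
  (smooth_add (smooth_cst k) (smooth_add sc sr)) (smooth_scale m sx)).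
rewrite (@pdD R i (fun=> k) (fun y => cubic i c a e b y + cubic (rev_ord i) c a e b y) x (smooth_cst k) (smooth_add sc sr)).
rewrite (@pdD R i (cubic i c a e b) (cubic (rev_ord i) c a e b) x sc sr) pd_cst add0r pd_cubic pd_cubic_rev addr0.
congr (_ + _); rewrite (@pdZ R i m _ x sx); congr (_ * _).
rewrite (@pdM R i (fun y => co i (y - c)) (fun y => co (rev_ord i) (y - c)) x (smooth_coc i c) (smooth_coc _ c)).
by rewrite !pd_coc rev_neq eqxx mulr0 add0r mulr1.
Qed.

Lemma pd2_lpoly i c k a e b m x :
  pderiv [:: i; i] (lpoly c k a e b m) x = 2 * e i + 6 * b i * co i (x - c).
Proof.
have -> : pderiv [:: i; i] (lpoly c k a e b m) x = 'D_(ei i) (lpoly c (a i) (fun=> m) (fun=> 0) (fun=> 0) 0) x + 'D_(ei i) (fun y => (2 * e i - m) * co i (y - c) + 3 * b i * co i (y - c) ^+ 2) x.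
  have s1 := smooth_coc i c; have s2 := smooth_exp 2 s1.
  rewrite -(@pdD R i _ _ x (smooth_lpoly _ _ _ _ _ _) (smooth_add (smooth_scale (2 * e i - m) s1) (smooth_scale (3 * b i) s2))).
  rewrite /pderiv /=; congr (derive _ x _); apply/funext => y; rewrite pd_lpoly (lpolyE i) /cubic; ring.
have s1 := smooth_coc i c; have s2 := smooth_exp 2 s1.
rewrite pd_lpoly (@pdD R i _ _ x (smooth_scale (2 * e i - m) s1) (smooth_scale (3 * b i) s2)).
rewrite (@pdZ R i _ _ x s1) (@pdZ R i _ _ x s2) pd_coc eqxx pd_coc_exp /= ?expr1; ring.
Qed.

Lemma pd11_lpoly i c k a e b m x : pderiv [:: i; rev_ord i] (lpoly c k a e b m) x = m.
Proof.
have s1 := smooth_coc i c; have t1 := smooth_coc (rev_ord i) c; have t2 := smooth_exp 2 t1.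
pose j := rev_ord i.
have -> : pderiv [:: i; j] (lpoly c k a e b m) x =
   'D_(ei i) (fun y => m * co i (y - c) + (a j + (2 * e j * co j (y - c) + 3 * b j * co j (y - c) ^+ 2))) x.
  rewrite /pderiv /=; congr (derive _ x _); apply/funext => y; rewrite pd_lpoly /j rev_ordK; ring.
rewrite (@pdD R i (fun y => m * co i (y - c)) _ x (smooth_scale m s1) (smooth_add (smooth_cst (a j)) (smooth_add (smooth_scale (2 * e j) t1) (smooth_scale (3 * b j) t2)))).
rewrite (@pdD R i (fun=> a j) _ x (smooth_cst (a j)) (smooth_add (smooth_scale (2 * e j) t1) (smooth_scale (3 * b j) t2))).
rewrite (@pdD R i _ _ x (smooth_scale (2 * e j) t1) (smooth_scale (3 * b j) t2)).
rewrite (@pdZ R i _ _ x s1) (@pdZ R i _ _ x t1) (@pdZ R i _ _ x t2) !pd_coc eqxx rev_neq pd_cst pd_coc_exp_rev /=; ring.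
Qed.

End LocalPoly.

(** * Functions vanishing at the vertices of a cell *)

Section Sup.
Context {R : realType}.
Local Notation R2 := (R * R)%type.
Local Notation M2 := (measurableTypeR R * measurableTypeR R)%type.
Local Notation leb := (@lebesgue_measure R).
Implicit Types (f g w : R2 -> R) (i j : 'I_2) (x c : R2) (h r : R).

Lemma pt_co i a b : co i (pt i a b : R2) = a /\ co (rev_ord i) (pt i a b : R2) = b.
Proof. by rewrite /pt !coE; split; ring. Qed.

Lemma pt_coco i x : pt i (co i x) (co (rev_ord i) x) = x.
Proof. by rewrite /pt -co_split. Qed.

Lemma pt_rev i a b : pt (rev_ord i) b a = pt i a b :> R2.
Proof. by rewrite /pt rev_ordK addrC. Qed.

Lemma pt_line i a b (t : R) : pt i (a + t) b = pt i a b + t *: ei i :> R2.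
Proof. by rewrite /pt scalerDl addrAC. Qed.

Lemma pt_continuous i b f : continuous f -> continuous (fun a : R => f (pt i a b)).
Proof.
move=> cf; rewrite (_ : (fun a => _) = fun t => f (pt i 0 b + t *: ei i)); first exact: line_continuous.
by apply/funext => t; rewrite -pt_line add0r.
Qed.

Lemma pt_derive i b f a : smooth f ->
  is_derive a (1:R) (fun a : R => f (pt i a b)) ('D_(ei i) f (pt i a b)).
Proof.
move=> sf; have := @smooth_line R f i (pt i 0 b) a sf.
rewrite -pt_line add0r; congr is_derive; apply/funext => t.
by rewrite -pt_line add0r.
Qed.

(** Some line carries no more than the average of f over all parallel lines. *)
Lemma good_line i h c f (A : R) : 0 < h -> continuous f -> I2 (cell h c) f < A ->
  exists b, `|b - co (rev_ord i) c| < h /\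
    2 * h * \int[leb]_(a in `[co i c - h, co i c + h]) f (pt i a b) < A.
Proof.
move=> h0 cf lt; apply: contrapT => no.
have [E itgE] := @fubini_rect R i h h c f cf.
move: lt; rewrite (cellE i) E ltNge; apply/negP/negPn.
set m := co (rev_ord i) c in no E itgE *.
have cst : \int[leb]_(b in `]m - h, m + h[) (A / (2 * h)) = A.
  rewrite Rintegral_cst//= lebesgue_measure_itv /= lte_fin ifT; last lra.
  by rewrite -EFinB /=; field; rewrite gt_eqF.
rewrite -{1}cst; apply: le_Rintegral => //.
  by have := @itg1o_cont R (m - h) (m + h) (fun=> A / (2 * h)) (@cst_continuous _ _ _).
move=> b /=; rewrite in_itv /= => /andP[b1 b2].
have h2 : 0 < 2 * h by rewrite mulr_gt0.
rewrite I1_oo_cc; last exact: pt_continuous.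
rewrite ler_pdivrMr// mulrC leNgt; apply/negP => lt; apply: no; exists b; split => //.
by rewrite ltr_norml; apply/andP; split; lra.
Qed.

(** The derivative varies by at most the L1 norm of the second derivative. *)
Lemma taylor_line (v dv ddv : R -> R) (p q x x0 A : R) : continuous dv -> continuous ddv ->
  (forall t, is_derive t (1:R) v (dv t)) -> (forall t, is_derive t (1:R) dv (ddv t)) ->
  p <= x <= q -> p <= x0 <= q -> (q - p) * \int[leb]_(t in `[p, q]) `|ddv t| <= A ->
  `|v x - v x0 - dv x0 * (x - x0)| <= A.
Proof.
move=> cdv cddv dV ddV /andP[x1 x2] /andP[y1 y2] HA.
set N := \int[leb]_(t in `[p, q]) `|ddv t| in HA.
have iN (a b : R) : leb.-integrable (`[a, b]%classic : set (measurableTypeR R)) (EFin \o (fun t => `|ddv t|)).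
  by apply: itg1_cont => t; apply: cvg_norm; exact: cddv.
have slope (a b : R) : p <= a -> b <= q -> a <= b -> `|dv b - dv a| <= N.
  move=> pa bq; rewrite le_eqVlt => /predU1P[->|ab]; first by rewrite subrr normr0 Rintegral_ge0.
  rewrite -(int_derive ab cddv ddV); apply: le_trans (le_normr_Rintegral _ (itg1_cont _ _ cddv)) _ => //.
  rewrite /N /Rintegral fine_le//; [exact: integrable_fin_num (iN _ _)|exact: integrable_fin_num (iN _ _)|].
  apply: ge0_subset_integral => //; first exact: measurable_int (iN _ _).
  by move=> t /=; rewrite !in_itv /= => /andP[? ?]; apply/andP; split; lra.
have slope' (a b : R) : p <= a <= q -> p <= b <= q -> `|dv b - dv a| <= N.
  move=> /andP[? ?] /andP[? ?]; have [ab|ba] := leP a b; first exact: slope.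
  by rewrite distrC; apply: slope => //; exact: ltW.
have N0 : 0 <= N by rewrite Rintegral_ge0.
pose f t := v t - dv x0 * t.
have df t : is_derive t (1:R) f (dv t - dv x0).
  have := is_deriveB (dV t) (is_deriveM (is_derive_cst (dv x0) t 1) (is_derive_id t 1)).
  by rewrite scaler0 addr0 /GRing.scale /= mulr1.
have cf : continuous f.
  by move=> t; apply: differentiable_continuous; apply/derivable1_diffP; have [] := df t.
have aux (a b : R) : p <= a -> b <= q -> a <= b -> `|f b - f a| <= N * (q - p).
  move=> pa bq ab.
  have [t tab ->] := @MVT_segment R f _ a b ab (fun t _ => df t) (continuous_subspaceT cf).
  rewrite normrM ler_pM// ?(@ger0_norm _ (b - a)) ?subr_ge0//; last lra.
  by move: tab; rewrite in_itv /= => /andP[? ?]; apply: slope'; [apply/andP|apply/andP; split; lra].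
have -> : v x - v x0 - dv x0 * (x - x0) = f x - f x0 by rewrite /f; ring.
apply: le_trans HA; rewrite mulrC.
have [xx|xx] := leP x0 x; first exact: aux.
by rewrite distrC; apply: aux => //; exact: ltW.
Qed.

(** The alternating sum is the integral of the mixed derivative over a rectangle
inside the cell. *)
Lemma mixed_diff i h c w (a1 a2 b1 b2 : R) : 0 < h -> smooth w ->
  `|a1 - co i c| <= h -> `|a2 - co i c| <= h -> `|b1 - co (rev_ord i) c| <= h -> `|b2 - co (rev_ord i) c| <= h ->
  `|w (pt i a2 b2) - w (pt i a2 b1) - w (pt i a1 b2) + w (pt i a1 b1)| <=
   I2 (cell h c) (fun x => `|pderiv [:: i; rev_ord i] w x|).
Proof.
move=> h0 sw; set j := rev_ord i; set B := I2 _ _.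
have B0 : 0 <= B by apply: I2_ge0.
have sj : smooth ('D_(ei j) w) by exact: smooth_D.
have s2 : smooth (pderiv [:: i; j] w) by exact: smooth_pderiv.
have main (p p' q q' : R) : p < p' -> q < q' -> `|p - co i c| <= h -> `|p' - co i c| <= h ->
    `|q - co j c| <= h -> `|q' - co j c| <= h ->
    `|w (pt i p' q') - w (pt i p' q) - w (pt i p q') + w (pt i p q)| <= B.
  move=> pp qq; rewrite !ler_norml => /andP[? ?] /andP[? ?] /andP[? ?] /andP[? ?].
  pose m := pt i ((p + p') / 2) ((q + q') / 2) : R2.
  pose r := (p' - p) / 2; pose s := (q' - q) / 2.
  have r0 : 0 < r by rewrite /r; lra.
  have s0 : 0 < s by rewrite /s; lra.
  have corner (sr ss : R) : m + sr *: ei i + ss *: ei j = pt i ((p + p') / 2 + sr) ((q + q') / 2 + ss).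
    by rewrite /m /pt -/j !scalerDl [RHS]addrACA addrA.
  have := @gauss R i r s m ('D_(ei j) w) r0 s0 sj.
  have e1 : m + r *: ei i + s *: ei j = pt i p' q' by rewrite corner; congr pt; rewrite /r /s; field.
  have e2 : m + r *: ei i - s *: ei j = pt i p' q by rewrite -scaleNr corner; congr pt; rewrite /r /s; field.
  have e3 : m - r *: ei i + s *: ei j = pt i p q' by rewrite -scaleNr corner; congr pt; rewrite /r /s; field.
  have e4 : m - r *: ei i - s *: ei j = pt i p q by rewrite -[- (r *: _)]scaleNr -[- (s *: _)]scaleNr corner; congr pt; rewrite /r /s; field.
  rewrite !line_ftc// e1 e2 e3 e4.
  move=> E.
  have -> : w (pt i p' q') - w (pt i p' q) - w (pt i p q') + w (pt i p q) = I2 (rect i r s m) (pderiv [:: i; j] w).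
    by apply: etrans (esym E); ring.
  have mr : meas (rect i r s m) by exact: rect_meas.
  have mc : meas (cell h c) by exact: rect_meas.
  have ic : itg (cell h c) (fun x => `|pderiv [:: i; j] w x|).
    by apply: itg_abs => //; apply: itg_cont; exact: smooth_continuous.
  rewrite -ler_norml; apply: le_trans (I2_abs mr (itg_cont _ _ _ _ (smooth_continuous s2))) _.
  apply: I2_subset => //.
  move=> x; rewrite (cellE i) /rect /= -/j !coB; have [-> ->] := pt_co i ((p + p') / 2) ((q + q') / 2).
  by rewrite /r /s !ltr_norml => -[/andP[? ?] /andP[? ?]]; split; apply/andP; split; lra.
move=> A1 A2 B1 B2.
have [lta|gta|eqa] := ltgtP a1 a2; have [ltb|gtb|eqb] := ltgtP b1 b2.
- exact: main.
- rewrite -normrN [X in `|X|](_ : _ = w (pt i a2 b1) - w (pt i a2 b2) - w (pt i a1 b1) + w (pt i a1 b2)); last by ring.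
  exact: main.
- by rewrite eqb [X in `|X|](_ : _ = 0) ?normr0//; ring.
- rewrite -normrN [X in `|X|](_ : _ = w (pt i a1 b2) - w (pt i a1 b1) - w (pt i a2 b2) + w (pt i a2 b1)); last by ring.
  exact: main.
- rewrite [X in `|X|](_ : _ = w (pt i a1 b1) - w (pt i a1 b2) - w (pt i a2 b1) + w (pt i a2 b2)); last by ring.
  exact: main.
- by rewrite eqb [X in `|X|](_ : _ = 0) ?normr0//; ring.
- by rewrite eqa [X in `|X|](_ : _ = 0) ?normr0//; ring.
- by rewrite eqa [X in `|X|](_ : _ = 0) ?normr0//; ring.
- by rewrite eqa [X in `|X|](_ : _ = 0) ?normr0//; ring.
Qed.

Lemma affine_le_ends (p q h S t : R) : `|p + q * h| <= S -> `|p - q * h| <= S -> `|t| <= h -> `|p + q * t| <= S.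
Proof.
rewrite !ler_norml => /andP[? ?] /andP[? ?] /andP[? ?].
have [q0|q0] := leP 0 q.
  have := ler_wpM2l q0 (_ : t <= h) => /(_ ltac:(done)).
  have := ler_wpM2l q0 (_ : - h <= t) => /(_ ltac:(done)).
  by move=> ? ?; apply/andP; split; lra.
have q0' : 0 <= - q by rewrite oppr_ge0 ltW.
have := ler_wpM2l q0' (_ : t <= h) => /(_ ltac:(done)).
have := ler_wpM2l q0' (_ : - h <= t) => /(_ ltac:(done)).
by move=> ? ?; apply/andP; split; lra.
Qed.

Lemma affine_le_corners (p q r h S s t : R) : (forall a b, (a = 1 \/ a = -1) -> (b = 1 \/ b = -1) -> `|p + q * (a * h) + r * (b * h)| <= S) ->
  `|s| <= h -> `|t| <= h -> `|p + q * s + r * t| <= S.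
Proof.
move=> H hs ht; rewrite -addrA [q * s + _]addrC addrA.
have H' b : (b = 1 \/ b = -1) -> `|p + r * (b * h) + q * s| <= S.
  move=> hb; apply: (affine_le_ends _ _ hs).
    by have := H 1 b (or_introl erefl) hb; rewrite mul1r addrAC.
  by have := H (-1) b (or_intror erefl) hb; rewrite mulN1r mulrN addrAC.
rewrite addrAC; apply: (affine_le_ends _ _ ht).
  by have := H' 1 (or_introl erefl); rewrite mul1r addrAC.
by have := H' (-1) (or_intror erefl); rewrite mulN1r mulrN addrAC.
Qed.

Lemma itv_abs (t m h : R) : `|t - m| <= h -> m - h <= t <= m + h.
Proof. by rewrite ler_norml => /andP[? ?]; apply/andP; split; lra. Qed.

Lemma taylor_plane i h c w (y0 x0 s A : R) : 0 < h -> smooth w ->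
  `|s - co i c| <= h -> `|x0 - co i c| <= h ->
  2 * h * \int[leb]_(a in `[co i c - h, co i c + h]) `|pderiv [:: i; i] w (pt i a y0)| < A ->
  `|w (pt i s y0) - w (pt i x0 y0) - 'D_(ei i) w (pt i x0 y0) * (s - x0)| <= A.
Proof.
move=> h0 sw /itv_abs sh /itv_abs xh LA.
have s1 := smooth_pderiv [:: i] sw; have s2 := smooth_pderiv [:: i; i] sw.
have dV := fun t => @pt_derive i y0 w t sw.
have ddV := fun t => @pt_derive i y0 (pderiv [:: i] w) t s1.
have c1 := @pt_continuous i y0 _ (smooth_continuous s1).
have c2 := @pt_continuous i y0 _ (smooth_continuous s2).
have LA' : (co i c + h - (co i c - h)) * \int[leb]_(a in `[co i c - h, co i c + h]) `|pderiv [:: i; i] w (pt i a y0)| <= A.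
  by rewrite (_ : co i c + h - _ = 2 * h) ?ltW//; ring.
exact: (@taylor_line (fun a => w (pt i a y0)) (fun a => pderiv [:: i] w (pt i a y0)) (fun a => pderiv [:: i; i] w (pt i a y0))
  (co i c - h) (co i c + h) s x0 A c1 c2 dV ddV sh xh LA').
Qed.

(** Two lines through the cell, one in each direction, carry at most the average of
|d_ii w| and of |d_jj w|.  Together with [mixed_diff] this bounds the distance of w
to its tangent plane at the crossing point.  As w vanishes at the vertices, the
tangent plane is equally small there, hence on the whole cell, by convexity. *)
Lemma vertex_sup_core i j h c w (A B C : R) : rev_ord i = j -> rev_ord j = i ->
  A = I2 (cell h c) (fun x => `|pderiv [:: i; i] w x|) ->
  B = I2 (cell h c) (fun x => `|pderiv [:: i; j] w x|) ->
  C = I2 (cell h c) (fun x => `|pderiv [:: j; j] w x|) -> 0 < h -> smooth w ->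
  (forall a b : R, (a = 1 \/ a = -1) -> (b = 1 \/ b = -1) -> w (pt i (co i c + a * h) (co j c + b * h)) = 0) ->
  forall x, cell h c x -> `|w x| <= 2 * (A + B + C).
Proof.
move=> ij ji AE BE CE h0 sw vz.
(* The slack makes strict the inequality that [good_line] requires; it is removed at
   the end. *)
have key A' C' : A < A' -> C < C' -> forall x, cell h c x -> `|w x| <= 2 * (A' + B + C').
  move=> AA CC.
  have sA := smooth_pderiv [:: i; i] sw; have sC := smooth_pderiv [:: j; j] sw.
  have cA : continuous (fun x => `|pderiv [:: i; i] w x|) by move=> x; apply: cvg_norm; exact: smooth_continuous.
  have cC : continuous (fun x => `|pderiv [:: j; j] w x|) by move=> x; apply: cvg_norm; exact: smooth_continuous.
  rewrite AE in AA; rewrite CE in CC.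
  have [y0 [y0c LA]] := good_line i h0 cA AA; rewrite ij in y0c.
  have [x0 [x0c LC]] := good_line j h0 cC CC; rewrite ji in x0c.
  (* The tangent plane at the crossing of the two lines. *)
  pose l (s t : R) := w (pt i x0 y0) + 'D_(ei i) w (pt i x0 y0) * (s - x0) + 'D_(ei j) w (pt i x0 y0) * (t - y0).
  have itv (t m : R) : `|t - m| <= h -> m - h <= t <= m + h by exact: itv_abs.
  have appr (s t : R) : `|s - co i c| <= h -> `|t - co j c| <= h -> `|w (pt i s t) - l s t| <= A' + B + C'.
    move=> hs ht.
    have T1 := taylor_plane h0 sw hs (ltW x0c) LA.
    have T2 := taylor_plane h0 sw ht (ltW y0c) LC.
    rewrite -!(pt_rev j) ji in T2.
    have T3 : `|w (pt i s t) - w (pt i s y0) - w (pt i x0 t) + w (pt i x0 y0)| <= B.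
      have := @mixed_diff i h c w x0 s y0 t h0 sw; rewrite ij -BE.
      by apply => //; exact: ltW.
    have -> : w (pt i s t) - l s t = (w (pt i s y0) - w (pt i x0 y0) - 'D_(ei i) w (pt i x0 y0) * (s - x0))
      + (w (pt i s t) - w (pt i s y0) - w (pt i x0 t) + w (pt i x0 y0))
      + (w (pt i x0 t) - w (pt i x0 y0) - 'D_(ei j) w (pt i x0 y0) * (t - y0)) by rewrite /l; ring.
    apply: le_trans (ler_normD _ _) _; apply: lerD => //.
    by apply: le_trans (ler_normD _ _) _; exact: lerD.
  have aff (s t : R) : `|s - co i c| <= h -> `|t - co j c| <= h -> `|l s t| <= A' + B + C'.
    move=> hs ht.
    pose p := w (pt i x0 y0) + 'D_(ei i) w (pt i x0 y0) * (co i c - x0) + 'D_(ei j) w (pt i x0 y0) * (co j c - y0).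
    have lE s' t' : l s' t' = p + 'D_(ei i) w (pt i x0 y0) * (s' - co i c) + 'D_(ei j) w (pt i x0 y0) * (t' - co j c).
      by rewrite /l /p; ring.
    rewrite lE; apply: (affine_le_corners _ hs ht) => a b ha hb.
    have ab (a' : R) : a' = 1 \/ a' = -1 -> `|a' * h| <= h.
      by case=> ->; rewrite ?mul1r ?mulN1r ?normrN gtr0_norm.
    have := appr (co i c + a * h) (co j c + b * h); rewrite (vz a b ha hb) sub0r normrN lE.
    by rewrite !(addrAC _ _ (- co _ c)) !subrr !add0r; apply; exact: ab.
  move=> x; rewrite (cellE i) /rect /= !coB ij => -[/ltW hx /ltW hy].
  rewrite -(pt_coco i x) ij.
  have := appr _ _ hx hy; have := aff _ _ hx hy.
  move: (w _) (l _ _) (A' + B + C') => p q S H1 H2.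
  have -> : p = (p - q) + q by ring.
  by apply: le_trans (ler_normD _ _) _; rewrite mulr_natl mulr2n; exact: lerD.
move=> x cx; apply/ler_addgt0Pr => e e0.
have := key (A + e / 4) (C + e / 4) _ _ x cx.
by rewrite !ltrDl !divr_gt0// => /(_ isT isT) /le_trans; apply; rewrite le_eqVlt; apply/orP; left; apply/eqP; field.
Qed.

Lemma vertex_sup i h c w : 0 < h -> smooth w ->
  (forall a b : R, (a = 1 \/ a = -1) -> (b = 1 \/ b = -1) -> w (pt i (co i c + a * h) (co (rev_ord i) c + b * h)) = 0) ->
  forall x, cell h c x -> `|w x| <= 2 * (I2 (cell h c) (fun x => `|pderiv [:: i; i] w x|)
     + I2 (cell h c) (fun x => `|pderiv [:: i; rev_ord i] w x|)
     + I2 (cell h c) (fun x => `|pderiv [:: rev_ord i; rev_ord i] w x|)).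
Proof. by move=> *; apply: (@vertex_sup_core i (rev_ord i) h c w _ _ _ erefl (rev_ordK i) erefl erefl erefl). Qed.

End Sup.

(** * The Morley interpolant *)

Section Interp.
Context {R : realType}.
Local Notation R2 := (R * R)%type.
Local Notation M2 := (measurableTypeR R * measurableTypeR R)%type.
Implicit Types (f g w phi : R2 -> R) (i j : 'I_2) (x c : R2) (h r : R).

Definition vtx h c (s t : R) : R2 := c + (s * h) *: ei ord0 + (t * h) *: ei ord_max.

Definition sgnp (s : R) : Prop := s = 1 \/ s = -1.

(** The mean over an edge of the derivative in the coordinate scaled to [-1, 1]. *)
Definition edge_avg h c phi i (s : R) : R := line i h (c + (s * h) *: ei i) ('D_(ei i) phi) / 2.

(** The mean slope, in the scaled coordinate, along the two edges parallel to the
direction i. *)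
Definition slope h c phi i : R :=
  if i == ord0 then (phi (vtx h c 1 1) + phi (vtx h c 1 (-1)) - phi (vtx h c (-1) 1) - phi (vtx h c (-1) (-1))) / 4
  else (phi (vtx h c 1 1) - phi (vtx h c 1 (-1)) + phi (vtx h c (-1) 1) - phi (vtx h c (-1) (-1))) / 4.

Definition quad h c phi i : R := (edge_avg h c phi i 1 - edge_avg h c phi i (-1)) / 4.

Definition cub h c phi i : R := ((edge_avg h c phi i 1 + edge_avg h c phi i (-1)) / 2 - slope h c phi i) / 2.

(** In the scaled coordinates (s, t) of the square [-1, 1]^2 the edge averages
determine the coefficient of s^2 and, with the mean slope, those of s and s^3, and
likewise for t; the vertex values then give the coefficient of s t and the constant. *)
Definition interp h c phi : R2 -> R :=
  lpoly c
    ((phi (vtx h c 1 1) + phi (vtx h c 1 (-1)) + phi (vtx h c (-1) 1) + phi (vtx h c (-1) (-1))) / 4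
      - quad h c phi ord0 - quad h c phi ord_max)
    (fun i => (slope h c phi i - cub h c phi i) / h)
    (fun i => quad h c phi i / h ^+ 2)
    (fun i => cub h c phi i / h ^+ 3)
    ((phi (vtx h c 1 1) - phi (vtx h c 1 (-1)) - phi (vtx h c (-1) 1) + phi (vtx h c (-1) (-1))) / 4 / h ^+ 2).

Lemma interp_smooth h c phi : smooth (interp h c phi).
Proof. exact: smooth_lpoly. Qed.

Lemma interp_P_T h c phi : P_T (interp h c phi).
Proof. exact: P_T_lpoly. Qed.

Lemma interp_vtx h c phi (s t : R) : 0 < h -> sgnp s -> sgnp t ->
  interp h c phi (vtx h c s t) = phi (vtx h c s t).
Proof.
move=> h0 hs ht; have hn : h != 0 by rewrite gt_eqF.
have c0 : co ord0 (vtx h c s t - c) = s * h by rewrite /vtx !coE /co /= /ei /=; ring.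
have c1 : co ord_max (vtx h c s t - c) = t * h by rewrite /vtx !coE /co /= /ei /=; ring.
rewrite /interp (lpolyE ord0) rev_ord2.1 /cubic !c0 !c1 /slope /=.
move: (quad h c phi _) (quad h c phi _) (cub h c phi _) (cub h c phi _) => a b d e.
by case: hs => ->; case: ht => ->; move: (phi _) (phi _) (phi _) (phi _) => p q r l; field.
Qed.

(** An odd function integrates to zero over the edge. *)
Lemma line_lin i h c (A K m : R) : 0 < h ->
  line i h (c + A *: ei i) (fun x => K + m * co (rev_ord i) (x - c)) = 2 * h * K.
Proof.
move=> h0; have s1 := smooth_coc (rev_ord i) c.
have ck : continuous (fun x : R2 => m * co (rev_ord i) (x - c)) := smooth_continuous (smooth_scale m s1).
rewrite lineD//; last exact: cst_continuous.
rewrite line_cst// lineZ; last exact: smooth_continuous.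
set c' := c + A *: ei i.
have -> : line i h c' (fun x => co (rev_ord i) (x - c)) = 0; last by rewrite mulr0 addr0.
have s2 := smooth_exp 2 (smooth_coc (rev_ord i) c').
transitivity (line i h c' ('D_(ei (rev_ord i)) (fun x => 2^-1 * co (rev_ord i) (x - c') ^+ 2))).
  by apply: line_eq => t _; rewrite (@pdZ R _ _ _ _ s2) pd_coc_exp expr1 /c' !coE; field.
rewrite (line_ftc _ _ h0 (smooth_scale 2^-1 s2)) !coE; ring.
Qed.

Lemma interp_flux h c phi i (s : R) : 0 < h -> sgnp s ->
  line i h (c + (s * h) *: ei i) ('D_(ei i) (interp h c phi)) = line i h (c + (s * h) *: ei i) ('D_(ei i) phi).
Proof.
move=> h0 hs; have hn : h != 0 by rewrite gt_eqF.
transitivity (2 * edge_avg h c phi i s); last by rewrite /edge_avg; field.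
set c' := c + _.
pose K := (slope h c phi i - cub h c phi i) / h + 2 * (quad h c phi i / h ^+ 2) * (s * h) + 3 * (cub h c phi i / h ^+ 3) * (s * h) ^+ 2.
pose m := (phi (vtx h c 1 1) - phi (vtx h c 1 (-1)) - phi (vtx h c (-1) 1) + phi (vtx h c (-1) (-1))) / 4 / h ^+ 2.
transitivity (line i h c' (fun x => K + m * co (rev_ord i) (x - c))).
  apply: line_eq => t _; rewrite /interp pd_lpoly.
  have -> : co i (c' + t *: ei (rev_ord i) - c) = s * h by rewrite /c' !coE; ring.
  by [].
rewrite line_lin// /K /cub /quad.
by case: hs => ->; move: (edge_avg h c phi i 1) (edge_avg h c phi i (-1)) (slope _ _ _ _) => p q r; field.
Qed.

Section Error.
Context (h : R) (c : R2) (w : R2 -> R) (h0 : 0 < h) (sw : smooth w).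
Context (wv : forall s t, sgnp s -> sgnp t -> w (vtx h c s t) = 0).
Context (wf : forall i s, sgnp s -> line i h (c + (s * h) *: ei i) ('D_(ei i) w) = 0).

Let wf' i : line i h (c + h *: ei i) ('D_(ei i) w) = 0 /\ line i h (c - h *: ei i) ('D_(ei i) w) = 0.
Proof.
split; first by have := @wf i 1 (or_introl erefl); rewrite mul1r.
by have := @wf i (-1) (or_intror erefl); rewrite mulN1r scaleNr.
Qed.

Lemma wvi i s t : sgnp s -> sgnp t -> w (c + (s * h) *: ei i + (t * h) *: ei (rev_ord i)) = 0.
Proof.
case: (ord2P i) => -> hs ht; rewrite rev_ord2; first exact: wv.
by rewrite addrAC; exact: wv.
Qed.

Let wv' i s : sgnp s -> line i h (c + (s * h) *: ei i) ('D_(ei (rev_ord i)) w) = 0.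
Proof.
move=> hs; rewrite line_ftc//.
have := wvi i hs (or_introl erefl); have := wvi i hs (or_intror erefl).
by rewrite mul1r mulN1r scaleNr => -> ->; rewrite subrr.
Qed.

Let wv1 i : line i h (c + h *: ei i) ('D_(ei (rev_ord i)) w) = 0 /\ line i h (c - h *: ei i) ('D_(ei (rev_ord i)) w) = 0.
Proof.
split; first by have := @wv' i 1 (or_introl erefl); rewrite mul1r.
by have := @wv' i (-1) (or_intror erefl); rewrite mulN1r scaleNr.
Qed.

Lemma err_ii i : I2 (cell h c) (pderiv [:: i; i] w) = 0.
Proof.
rewrite (cellE i) (@gauss R i h h c ('D_(ei i) w) h0 h0 (smooth_D i sw)).
by have [-> ->] := wf' i; rewrite subrr.
Qed.

Lemma err_ij i : I2 (cell h c) (pderiv [:: i; rev_ord i] w) = 0.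
Proof.
rewrite (cellE i) (@gauss R i h h c ('D_(ei (rev_ord i)) w) h0 h0 (smooth_D _ sw)).
by have [-> ->] := wv1 i; rewrite subrr.
Qed.

(** Integrating by parts in direction i or j, both moments are minus the integral
of d_i w; the boundary terms vanish by the flux condition in the first case and by the
vertex values in the second. *)
Lemma err_mom i : mom i h c (pderiv [:: i; i] w) = mom (rev_ord i) h c (pderiv [:: i; rev_ord i] w).
Proof.
have sD := smooth_D i sw.
have mc : meas (cell h c) by exact: rect_meas.
have I f : smooth f -> itg (cell h c) f by move=> sf; apply: itg_cont; exact: smooth_continuous.
have part j (z1 : line j h (c + h *: ei j) ('D_(ei i) w) = 0) (z2 : line j h (c - h *: ei j) ('D_(ei i) w) = 0) :
    mom j h c (pderiv [:: j; i] w) = - I2 (cell h c) ('D_(ei i) w).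
  have := @gauss R j h h c (fun x => co j (x - c) * 'D_(ei i) w x) h0 h0 (smooth_coM j c sD).
  have e (A : R) : line j h (c + A *: ei j) (fun x => co j (x - c) * 'D_(ei i) w x) = A * line j h (c + A *: ei j) ('D_(ei i) w).
    rewrite -lineZ; last exact: smooth_continuous.
    by apply: line_eq => t _; congr (_ * _); rewrite !coE; ring.
  have e' : line j h (c - h *: ei j) (fun x => co j (x - c) * 'D_(ei i) w x) = - h * line j h (c - h *: ei j) ('D_(ei i) w).
    by rewrite -scaleNr e.
  rewrite e e' z1 z2 !mulr0 subrr -cellE.
  rewrite (_ : 'D_(ei j) _ = fun x => 'D_(ei i) w x + co j (x - c) * pderiv [:: j; i] w x); last first.
    by apply/funext => x; rewrite (@pd_coM R j j c _ x sD) eqxx mul1r.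
  rewrite I2D//; [|exact: I|by apply: I; apply: smooth_coM; exact: smooth_pderiv].
  by move=> E; apply/eqP; rewrite -addr_eq0 addrC E.
have [z1 z2] := wf' i.
rewrite (part i z1 z2).
have [y1 y2] := wv1 (rev_ord i); rewrite rev_ordK in y1 y2.
have e1 := esym (part (rev_ord i) y1 y2).
have e2 := congr1 (mom (rev_ord i) h c) (@pderiv_perm R [:: rev_ord i; i] [:: i; rev_ord i] w sw (permEl (perm_catC [:: rev_ord i] [:: i]))).
exact: (etrans e1 e2).
Qed.
End Error.

Section CellEstimates.
Context (h : R) (c : R2) (h0 : 0 < h).
Let mc : meas (cell h c) := rect_meas ord0 h h c.
Let I f : smooth f -> itg (cell h c) f.
Proof. by move=> sf; apply: itg_cont; exact: smooth_continuous. Qed.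
Let L f : smooth f -> inL2 (cell h c) f.
Proof. by move=> sf; apply: inL2_cont; exact: smooth_continuous. Qed.

Lemma I2_cell_cst a : I2 (cell h c) (fun=> a) = 4 * h ^+ 2 * a.
Proof. by rewrite I2_rect_cst//; ring. Qed.

Lemma mom_cst i a : mom i h c (fun=> a) = 0.
Proof.
rewrite /mom (_ : (fun _ => _) = fun x => a * co i (x - c)); last by apply/funext => x; rewrite mulrC.
rewrite I2Z//; last by apply: I; exact: smooth_coc.
have s2 := smooth_exp 2 (smooth_coc i c).
transitivity (a * I2 (cell h c) ('D_(ei i) (fun x => 2^-1 * co i (x - c) ^+ 2))).
  by congr (_ * _); apply: I2_eq => x _; rewrite (@pdZ R _ _ _ _ s2) pd_coc_exp expr1; field.
rewrite (cellE i) (@gauss R i h h c (fun x => 2^-1 * co i (x - c) ^+ 2) h0 h0 (smooth_scale _ s2)).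
rewrite [X in X - _](_ : _ = line i h (c - h *: ei i) (fun x => 2^-1 * co i (x - c) ^+ 2)) ?subrr ?mulr0//.
rewrite /line; apply: eq_Rintegral => t _; congr (_ * _); rewrite !coE; ring.
Qed.

Lemma I2_xi2 i : I2 (cell h c) (fun x => co i (x - c) ^+ 2) = 4 * h ^+ 4 / 3.
Proof.
have s3 := smooth_exp 3 (smooth_coc i c).
transitivity (I2 (cell h c) ('D_(ei i) (fun x => 3^-1 * co i (x - c) ^+ 3))).
  by apply: I2_eq => x _; rewrite (@pdZ R _ _ _ _ s3) pd_coc_exp; field.
rewrite (cellE i) (@gauss R i h h c (fun x => 3^-1 * co i (x - c) ^+ 3) h0 h0 (smooth_scale _ s3)).
transitivity (line i h (c + h *: ei i) (fun=> h ^+ 3 / 3) - line i h (c - h *: ei i) (fun=> - (h ^+ 3 / 3))).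
  by congr (_ - _); apply: line_eq => t _; rewrite !coE; ring.
by rewrite !line_cst//; field.
Qed.

Lemma mom_cs i f : smooth f -> mom i h c f ^+ 2 <= 4 * h ^+ 4 / 3 * I2 (cell h c) (fun x => f x ^+ 2).
Proof.
move=> sf; rewrite -(I2_xi2 i); exact: (cauchy_schwarz mc (L (smooth_coc i c)) (L sf)).
Qed.

Lemma mom_subc i f a : smooth f -> mom i h c (fun x => f x - a) = mom i h c f.
Proof.
move=> sf; rewrite -[RHS]subr0 -[X in _ - X](mom_cst i a) /mom -I2B//.
- by apply: I2_eq => x _; rewrite mulrBr.
- by apply: I; apply: smooth_coM.
- by apply: I; apply: smooth_coM; exact: smooth_cst.
Qed.

(** Among the constants the mean is the best approximation in L2. *)
Lemma const_err G m k : smooth G -> I2 (cell h c) (fun x => G x - m) = 0 ->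
  I2 (cell h c) (fun x => (G x - m) ^+ 2) <= I2 (cell h c) (fun x => (G x - k) ^+ 2).
Proof.
move=> sG Z; have sd a : smooth (fun x => G x - a) by exact: (smooth_sub sG (smooth_cst a)).
have sm := smooth_exp 2 (sd m).
rewrite (_ : (fun x => (G x - k) ^+ 2) = fun x => (G x - m) ^+ 2 + (2 * (m - k) * (G x - m) + (m - k) ^+ 2)); last first.
  by apply/funext => x; ring.
rewrite (I2D mc (I sm) (I (smooth_add (smooth_scale _ (sd m)) (smooth_cst _)))).
rewrite (I2D mc (I (smooth_scale _ (sd m))) (I (smooth_cst _))) (I2Z _ mc (I (sd m))).
by rewrite Z mulr0 add0r lerDl I2_cell_cst mulr_ge0 ?sqr_ge0// mulr_ge0// sqr_ge0.
Qed.

Lemma mean_sq f : smooth f -> I2 (cell h c) f ^+ 2 <= 4 * h ^+ 2 * I2 (cell h c) (fun x => f x ^+ 2).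
Proof.
move=> sf; have := @cs_cell R h c (fun=> 1) f 1 h0 (@cst_continuous _ _ _) (L sf).
rewrite expr1n mulr1 => H; have {H} := H _; rewrite (_ : (fun x => 1 * f x) = f); first by apply => x _; rewrite normr1.
by apply/funext => x; rewrite mul1r.
Qed.

(** The remainder has mean zero, so the mean of F - k determines al - k; its
moment q is small, so the moment of F - k controls be. *)
Lemma affine_err i F al be q Y k : smooth F ->
  I2 (cell h c) (fun x => F x - (al + be * co i (x - c))) = 0 ->
  mom i h c (fun x => F x - (al + be * co i (x - c))) = q -> q ^+ 2 <= 4 * h ^+ 4 / 3 * Y ->
  I2 (cell h c) (fun x => (F x - (al + be * co i (x - c))) ^+ 2) <= 8 * I2 (cell h c) (fun x => (F x - k) ^+ 2) + 4 * Y.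
Proof.
move=> sF Z1 Z2 qY.
have sx := smooth_coc i c.
have sd : smooth (fun x => F x - k) := smooth_sub sF (smooth_cst k).
have sr : smooth (fun x => F x - (al + be * co i (x - c))) := smooth_sub sF (smooth_add (smooth_cst al) (smooth_scale be sx)).
have sg : smooth (fun x => (al - k) + be * co i (x - c)).
  by apply: smooth_add; [exact: smooth_cst|exact: smooth_scale].
set X := I2 _ (fun x => (F x - k) ^+ 2).
have N0 : 0 < 4 * h ^+ 4 / 3 by rewrite divr_gt0// mulr_gt0// exprn_gt0.
have h20 : 0 < 4 * h ^+ 2 by rewrite mulr_gt0// exprn_gt0.
have Ix b : I2 (cell h c) (fun x => b * co i (x - c)) = 0.
  by rewrite -(mom_cst i b) /mom; apply: I2_eq => x _; rewrite mulrC.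
have split1 : I2 (cell h c) (fun x => F x - k) = 4 * h ^+ 2 * (al - k).
  rewrite -I2_cell_cst -[RHS]addr0 -(Ix be) -I2D//; [|by apply: I; exact: smooth_cst|by apply: I; exact: smooth_scale].
  apply/eqP; rewrite -subr_eq0 -I2B//; [|exact: I|exact: I].
  by apply/eqP; rewrite -[RHS]Z1; apply: I2_eq => x _; ring.
have split2 : mom i h c (fun x => F x - k) = q + be * (4 * h ^+ 4 / 3).
  rewrite -(I2_xi2 i) -I2Z//; last by apply: I; apply: smooth_exp.
  rewrite -Z2 -[RHS]addr0 -(mom_cst i (al - k)) /mom.
  have s1 : smooth (fun x => co i (x - c) * (F x - (al + be * co i (x - c)))).
    exact: (smooth_coM i c sr).
  have s2 : smooth (fun x => be * co i (x - c) ^+ 2) by apply: smooth_scale; exact: smooth_exp.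
  have s3 : smooth (fun x => co i (x - c) * (al - k)) by apply: smooth_coM; exact: smooth_cst.
  rewrite -I2D//; [|exact: I|exact: I].
  rewrite -I2D//; [|by apply: I; exact: smooth_add|exact: I].
  by apply: I2_eq => x _; ring.
have X1 := mean_sq sd; have X2 := mom_cs i sd; rewrite split1 -/X in X1; rewrite split2 -/X in X2.
have d1 : 4 * h ^+ 2 * (al - k) ^+ 2 <= X.
  rewrite -(ler_pM2l h20); apply: le_trans X1; rewrite le_eqVlt; apply/orP; left; apply/eqP; ring.
have d2 : be ^+ 2 * (4 * h ^+ 4 / 3) <= 2 * X + 2 * Y.
  rewrite -(ler_pM2l N0); move: X2 qY; move: (4 * h ^+ 4 / 3) => N.
  by have := sqr_ge0 (be * N + 2 * q); clear; nra.
have E2 : I2 (cell h c) (fun x => ((al - k) + be * co i (x - c)) ^+ 2) = 4 * h ^+ 2 * (al - k) ^+ 2 + be ^+ 2 * (4 * h ^+ 4 / 3).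
  have sxx : smooth (fun x => be ^+ 2 * co i (x - c) ^+ 2) by apply: smooth_scale; exact: smooth_exp.
  have sxl : smooth (fun x => 2 * (al - k) * be * co i (x - c)) by exact: smooth_scale.
  rewrite (_ : (fun x => _) = fun x => ((al - k) ^+ 2 + be ^+ 2 * co i (x - c) ^+ 2) + 2 * (al - k) * be * co i (x - c)); last first.
    by apply/funext => x; ring.
  have sk : smooth (fun _ : R2 => (al - k) ^+ 2) by exact: smooth_cst.
  rewrite (I2D mc (I (smooth_add sk sxx)) (I sxl)) (I2D mc (I sk) (I sxx)) Ix addr0 I2_cell_cst.
  by rewrite (I2Z _ mc (I (smooth_exp 2 sx))) I2_xi2.
apply: (@le_trans _ _ (2 * X + 2 * I2 (cell h c) (fun x => ((al - k) + be * co i (x - c)) ^+ 2))).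
  rewrite -I2Z//; last by apply: I; exact: smooth_exp.
  rewrite -I2Z//; last by apply: I; exact: smooth_exp.
  have sA : smooth (fun x => 2 * (F x - k) ^+ 2) by apply: smooth_scale; exact: smooth_exp.
  have sB : smooth (fun x => 2 * ((al - k) + be * co i (x - c)) ^+ 2) by apply: smooth_scale; exact: smooth_exp.
  rewrite -I2D//; [|exact: I|exact: I].
  apply: I2_le => //.
  - exact: (I (smooth_exp 2 sr)).
  - by apply: I; exact: smooth_add.
  move=> x _; rewrite (_ : F x - (al + be * co i (x - c)) = (F x - k) - (al - k + be * co i (x - c))); last by ring.
  move: (F x - k) (al - k + _) => a b; have := sqr_ge0 (a + b); nra.
rewrite E2; move: d1 d2; clear; lra.
Qed.

Lemma sup_L2 w (M : R) : smooth w -> (forall x, cell h c x -> `|w x| <= M) ->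
  I2 (cell h c) (fun x => w x ^+ 2) <= 4 * h ^+ 2 * M ^+ 2.
Proof.
move=> sw S; rewrite -I2_cell_cst.
apply: (I2_le mc (I (smooth_exp 2 sw)) (I (smooth_cst _))) => x cx.
have := S x cx; rewrite -[X in _ -> X <= _]real_normK ?num_real// => H.
by rewrite lerXn2r// nnegrE; apply: le_trans H.
Qed.
End CellEstimates.

Lemma interp_num (h : R) (a b d P Q S X Y Z : R) : 0 < h -> 0 <= X -> 0 <= Y -> 0 <= Z ->
  a ^+ 2 <= 4 * h ^+ 2 * P -> b ^+ 2 <= 4 * h ^+ 2 * Q -> d ^+ 2 <= 4 * h ^+ 2 * S ->
  P <= 8 * X + 4 * Y -> Q <= Y -> S <= 8 * Z + 4 * Y ->
  4 * h ^+ 2 * (2 * (a + b + d)) ^+ 2 <= 12 ^+ 3 * h ^+ 4 * (X + Y + Z).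
Proof.
move=> h0 X0 Y0 Z0 ha hb hd hP hQ hS.
have h20 : 0 <= h ^+ 2 by exact: sqr_ge0.
have h40 : 0 <= h ^+ 4 by rewrite exprn_ge0// ltW.
have s3 : (2 * (a + b + d)) ^+ 2 <= 12 * (a ^+ 2 + b ^+ 2 + d ^+ 2).
  have := sqr_ge0 (a - b); have := sqr_ge0 (a - d); have := sqr_ge0 (b - d).
  by clear; nra.
apply: (@le_trans _ _ (4 * h ^+ 2 * (12 * (4 * h ^+ 2 * (P + Q + S))))).
  by apply: ler_wpM2l; [rewrite mulr_ge0|move: s3 ha hb hd; clear; lra].
have -> : 4 * h ^+ 2 * (12 * (4 * h ^+ 2 * (P + Q + S))) = h ^+ 4 * (192 * (P + Q + S)) by ring.
have -> : 12 ^+ 3 * h ^+ 4 * (X + Y + Z) = h ^+ 4 * (192 * (9 * (X + Y + Z))) by ring.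
apply: ler_wpM2l => //; apply: ler_wpM2l => //; move: X0 Y0 Z0 hP hQ hS; clear; lra.
Qed.

Section L2Error.
Context (h : R) (c : R2) (phi : R2 -> R) (h0 : 0 < h) (sp : smooth phi).
Let p := interp h c phi.
Let sq : smooth p := interp_smooth h c phi.
Let w x := phi x - p x.
Let sw : smooth w := smooth_sub sp sq.
Let mc : meas (cell h c) := rect_meas ord0 h h c.

Let wv s t : sgnp s -> sgnp t -> w (vtx h c s t) = 0.
Proof. by move=> hs ht; rewrite /w /p interp_vtx// subrr. Qed.

Let wf i s : sgnp s -> line i h (c + (s * h) *: ei i) ('D_(ei i) w) = 0.
Proof.
move=> hs; rewrite (_ : 'D_(ei i) w = fun x => 'D_(ei i) phi x - 'D_(ei i) p x); last first.
  by apply/funext => x; exact: (@pdB R i phi p x sp sq).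
rewrite lineB; [|exact: smooth_continuous (smooth_D i sp)|exact: smooth_continuous (smooth_D i sq)].
by rewrite interp_flux// subrr.
Qed.

Let I f : smooth f -> itg (cell h c) f.
Proof. by move=> sf; apply: itg_cont; exact: smooth_continuous. Qed.
Let L f : smooth f -> inL2 (cell h c) f.
Proof. by move=> sf; apply: inL2_cont; exact: smooth_continuous. Qed.

Lemma interp_mean i j : I2 (cell h c) (fun x => pderiv [:: i; j] phi x - pderiv [:: i; j] p x) = 0.
Proof.
have e := @err_ii h c w h0 sw wf i; have e' := @err_ij h c w h0 sw wv i.
rewrite (@pderivB R _ phi p sp sq) in e; rewrite (@pderivB R _ phi p sp sq) in e'.
have [->|->] : j = i \/ j = rev_ord i.
  by case: (ord2P i) => ->; case: (ord2P j) => ->; rewrite rev_ord2; [left|right|right|left].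
- exact: e.
- exact: e'.
Qed.

(** The interpolant does not reproduce the moments of d_ii phi; the slope of the
discrete eigenfunction multiplies this error in [cell_consistency]. *)
Lemma interp_mom i : mom i h c (fun x => pderiv [:: i; i] phi x - pderiv [:: i; i] p x) =
  mom (rev_ord i) h c (pderiv [:: i; rev_ord i] phi).
Proof.
have e := @err_mom h c w h0 sw wv wf i.
rewrite (@pderivB R [:: i; i] phi p sp sq) (@pderivB R [:: i; rev_ord i] phi p sp sq) in e.
apply: (etrans e).
have -> : (fun x => pderiv [:: i; rev_ord i] phi x - pderiv [:: i; rev_ord i] p x) =
  (fun x => pderiv [:: i; rev_ord i] phi x - (phi (vtx h c 1 1) - phi (vtx h c 1 (-1)) - phi (vtx h c (-1) 1) + phi (vtx h c (-1) (-1))) / 4 / h ^+ 2).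
  by apply/funext => x; congr (_ - _); exact: pd11_lpoly.
move: (_ / h ^+ 2) => a.
exact: (mom_subc c h0 _ a (smooth_pderiv [:: i; rev_ord i] sp)).
Qed.

Lemma cell_abs f : smooth f -> I2 (cell h c) (fun x => `|f x|) ^+ 2 <= 4 * h ^+ 2 * I2 (cell h c) (fun x => f x ^+ 2).
Proof.
move=> sf; have LA : inL2 (cell h c) (fun x => `|f x|).
  by apply: inL2_cont => x; apply: cvg_norm; exact: smooth_continuous.
have := @cs_cell R h c (fun=> 1) (fun x => `|f x|) 1 h0 (@cst_continuous _ _ _) LA.
rewrite expr1n mulr1 => H; have {H} := H _; rewrite (_ : (fun x => 1 * `|f x|) = fun x => `|f x|); last first.
  by apply/funext => x; rewrite mul1r.
rewrite (_ : (fun x => `|f x| ^+ 2) = fun x => f x ^+ 2); last by apply/funext => x; rewrite real_normK ?num_real.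
by apply => x _; rewrite normr1.
Qed.

Lemma interp_ii i k k' :
  I2 (cell h c) (fun x => (pderiv [:: i; i] phi x - pderiv [:: i; i] p x) ^+ 2) <=
  8 * I2 (cell h c) (fun x => (pderiv [:: i; i] phi x - k) ^+ 2)
  + 4 * I2 (cell h c) (fun x => (pderiv [:: i; rev_ord i] phi x - k') ^+ 2).
Proof.
have Z1 := interp_mean i i; have Z2 := interp_mom i.
have [al [be E]] : exists al be, forall x, pderiv [:: i; i] p x = al + be * co i (x - c).
  by exists (2 * (quad h c phi i / h ^+ 2)), (6 * (cub h c phi i / h ^+ 3)) => x; exact: pd2_lpoly.
have s1 := smooth_pderiv [:: i; i] sp; have s2 := smooth_pderiv [:: i; rev_ord i] sp.
have q2 : mom (rev_ord i) h c (pderiv [:: i; rev_ord i] phi) ^+ 2 <=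
    4 * h ^+ 4 / 3 * I2 (cell h c) (fun x => (pderiv [:: i; rev_ord i] phi x - k') ^+ 2).
  have := mom_cs c h0 (rev_ord i) (smooth_sub s2 (smooth_cst k')).
  by rewrite (mom_subc c h0 (rev_ord i) k' s2).
rewrite (_ : pderiv [:: i; i] p = fun x => al + be * co i (x - c)) in Z1 Z2 *; last exact/funext.
exact: (affine_err h0 k s1 Z1 Z2 q2).
Qed.

Lemma interp_ij i k : I2 (cell h c) (fun x => (pderiv [:: i; rev_ord i] phi x - pderiv [:: i; rev_ord i] p x) ^+ 2) <=
  I2 (cell h c) (fun x => (pderiv [:: i; rev_ord i] phi x - k) ^+ 2).
Proof.
have Z1 := interp_mean i (rev_ord i).
have [m E] : exists m, forall x, pderiv [:: i; rev_ord i] p x = m.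
  by eexists => x; exact: pd11_lpoly.
have s2 := smooth_pderiv [:: i; rev_ord i] sp.
rewrite (_ : pderiv [:: i; rev_ord i] p = fun x => m) in Z1 *; last exact/funext.
exact: (const_err h0 k s2 Z1).
Qed.

(** The interpolation error vanishes at the vertices, so [vertex_sup] bounds it by its
second derivatives; their L2 norms are bounded by [interp_ii] and [interp_ij]. *)
Lemma interp_L2 k0 k1 k2 : I2 (cell h c) (fun x => (phi x - p x) ^+ 2) <=
  12 ^+ 3 * h ^+ 4 * (I2 (cell h c) (fun x => (pderiv [:: ord0; ord0] phi x - k0) ^+ 2)
   + I2 (cell h c) (fun x => (pderiv [:: ord0; ord_max] phi x - k1) ^+ 2)
   + I2 (cell h c) (fun x => (pderiv [:: ord_max; ord_max] phi x - k2) ^+ 2)).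
Proof.
have pw (s : seq 'I_2) : pderiv s w = fun x => pderiv s phi x - pderiv s p x by exact: (@pderivB R s phi p sp sq).
have e0 := interp_ii ord0 k0 k1; have e1 := interp_ij ord0 k1; have e2 := interp_ii ord_max k2 k1.
rewrite rev_ord2.1 in e0 e1; rewrite rev_ord2.2 in e2.
have sym : pderiv [:: ord_max; ord0] phi = pderiv [:: ord0; ord_max] phi.
  exact: (@pderiv_perm R [:: ord_max; ord0] [:: ord0; ord_max] phi sp (permEl (perm_catC [:: ord_max] [:: ord0]))).
rewrite sym in e2.
have S : forall x, cell h c x -> `|w x| <= 2 * (I2 (cell h c) (fun x => `|pderiv [:: ord0; ord0] w x|)
     + I2 (cell h c) (fun x => `|pderiv [:: ord0; ord_max] w x|)
     + I2 (cell h c) (fun x => `|pderiv [:: ord_max; ord_max] w x|)).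
  have := @vertex_sup R ord0 h c w h0 sw; rewrite rev_ord2; apply => a b ha hb.
  rewrite -[RHS](wv ha hb); congr w; apply: (@co_inj _ ord0); rewrite ?rev_ord2 /pt /vtx ?rev_ord2 !coE /co /ei /=; ring.
have A0 := cell_abs (smooth_pderiv [:: ord0; ord0] sw).
have A1 := cell_abs (smooth_pderiv [:: ord0; ord_max] sw).
have A2 := cell_abs (smooth_pderiv [:: ord_max; ord_max] sw).
have pe q := congr1 (fun F : R2 -> R => I2 (cell h c) (fun x => F x ^+ 2)) (pw q).
have f0 := eq_ind_r (fun z => z <= _) e0 (pe [:: ord0; ord0]).
have f1 := eq_ind_r (fun z => z <= _) e1 (pe [:: ord0; ord_max]).
have f2 := eq_ind_r (fun z => z <= _) e2 (pe [:: ord_max; ord_max]).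
have sq0 f : 0 <= I2 (cell h c) (fun x => f x ^+ 2) by apply: I2_ge0 => x _; exact: sqr_ge0.
have num := interp_num h0 (sq0 _) (sq0 _) (sq0 _) A0 A1 A2 f0 f1 f2.
exact: le_trans (sup_L2 h0 sw S) num.
Qed.

End L2Error.

End Interp.

(** * Piecewise functions and the discrete space *)

Section Glue.
Context {R : realType}.
Local Notation R2 := (R * R)%type.
Local Notation M2 := (measurableTypeR R * measurableTypeR R)%type.
Implicit Types (f g w phi : R2 -> R) (i j : 'I_2) (x c : R2) (h r : R) (E : set R2).

Lemma elt_cell_ae h c : {ae @leb2 R, forall x, elt h c x -> cell h c x}.
Proof.
have FI := @filterI _ _ (@ae_leb2_filter R).
have := FI _ _ (FI _ _ (ae_line ord0 (co ord0 c + h)) (ae_line ord0 (co ord0 c - h)))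
    (FI _ _ (ae_line ord_max (co ord_max c + h)) (ae_line ord_max (co ord_max c - h))).
apply: (@filterS _ _ ae_leb2_filter) => x [[/eqP a1 /eqP a2] [/eqP a3 /eqP a4]].
have N i : `|co i (x - c)| <> h.
  move=> E; have [E1|E1] : co i x = co i c + h \/ co i x = co i c - h.
  - by move: E; rewrite !coE; case: (ger0P (co i x - co i c)) => _ ?; [left|right]; lra.
  - by case: (ord2P i) E1 => ->.
  - by case: (ord2P i) E1 => ->.
by rewrite (eltE ord0) => -[e1 e2]; split; rewrite lt_neqAle ?e1 ?e2 andbT; apply/eqP; exact: N.
Qed.

Lemma is_wderiv_aeq E (s : seq 'I_2) f g k : meas E -> inL2 E f -> inL2 E g ->
  ae_eq (@leb2 R) (E : set M2) (f : M2 -> R) g -> is_wderiv E s f k -> is_wderiv E s g k.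
Proof.
move=> mE fL gL fg [kL H]; split => // psi tp; rewrite -(H psi tp).
have mp : measurable_fun (E : set M2) (pderiv s psi : M2 -> R).
  by apply: meas_smooth; apply: smooth_pderiv; exact: test_smooth tp.
apply/esym/I2_ae => //; [exact: measurable_funM (inL2_meas fL) mp|exact: measurable_funM (inL2_meas gL) mp|].
by move: fg; apply: (@filterS _ _ ae_leb2_filter) => x fgx Ex; rewrite fgx.
Qed.

(** Weak derivatives on a cell being unique almost everywhere, any of them may be
used. *)
Lemma dot_hess_cell h c f g (F G : 'I_2 -> 'I_2 -> R2 -> R) : 0 < h ->
  inL2 (cell h c) f -> inL2 (cell h c) g ->
  (forall i j, is_wderiv (cell h c) [:: i; j] f (F i j)) ->
  (forall i j, is_wderiv (cell h c) [:: i; j] g (G i j)) ->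
  dot_hess (elt h c)° f g = \sum_(i < 2) \sum_(j < 2) I2 (cell h c) (fun x => F i j x * G i j x).
Proof.
move=> h0 fL gL fF gG; rewrite /dot_hess interior_elt//.
have mc : meas (cell h c) by exact: rect_meas.
have Wf i j : inL2 (cell h c) (wderiv (cell h c) [:: i; j] f).
  by have [] := wderiv_spec (ex_intro _ _ (fF i j)).
have Wg i j : inL2 (cell h c) (wderiv (cell h c) [:: i; j] g).
  by have [] := wderiv_spec (ex_intro _ _ (gG i j)).
have Af i j := wderiv_cell_ae h0 fL (fF i j); have Ag i j := wderiv_cell_ae h0 gL (gG i j).
have LF i j : inL2 (cell h c) (F i j) by have [] := fF i j.
have LG i j : inL2 (cell h c) (G i j) by have [] := gG i j.
suff K (wf wg : 'I_2 -> 'I_2 -> R2 -> R) : (forall i j, inL2 (cell h c) (wf i j)) -> (forall i j, inL2 (cell h c) (wg i j)) ->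
    (forall i j, ae_eq (@leb2 R) (cell h c : set M2) (wf i j : M2 -> R) (F i j)) ->
    (forall i j, ae_eq (@leb2 R) (cell h c : set M2) (wg i j : M2 -> R) (G i j)) ->
    I2 (cell h c) (fun x => \sum_(i < 2) \sum_(j < 2) (wf i j x * wg i j x)) =
    \sum_(i < 2) \sum_(j < 2) I2 (cell h c) (fun x => F i j x * G i j x).
  exact: (K (fun i j => wderiv (cell h c) [:: i; j] f) (fun i j => wderiv (cell h c) [:: i; j] g) Wf Wg Af Ag).
move=> {Wf Wg Af Ag} Wf Wg Af Ag.
have I i j : itg (cell h c) (fun x => wf i j x * wg i j x) by apply: inL2_itgM.
rewrite I2_sum//; last by move=> i _; apply: itg_sum.
apply: eq_bigr => i _; rewrite I2_sum//; apply: eq_bigr => j _.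
apply: I2_ae => //; [exact: itg_meas|by apply: itg_meas; exact: inL2_itgM|].
have := @filterI _ _ ae_leb2_filter _ _ (Af i j) (Ag i j); apply: (@filterS _ _ ae_leb2_filter) => x [ef eg] cx.
by rewrite ef// eg.
Qed.

Section OneMesh.
Context (D : set R2) (h : R) (T : {fset R2}) (mesh : uniform_mesh D h T).
Let mD : meas D := mesh_meas mesh.
Let h0 : 0 < h := mesh_h0 mesh.

Lemma cells_disjoint c c' x : c \in T -> c' \in T -> cell h c x -> cell h c' x -> c = c'.
Proof.
move=> cT c'T cx c'x; apply/eqP/negPn/negP => cc'.
case: mesh => _ _ /(_ c c' cT c'T cc').
have I : (elt h c `&` elt h c') x by split; exact: cell_elt.
have N i : `|co i (x - c)| <> h by move=> e; have := @cellP _ _ _ _ i cx; rewrite e ltxx.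
case=> [E|[a [va _] E]|[F [eF _] E]]; rewrite E in I => //.
  by move: va; rewrite -I => -[+ _]; have := N ord0; rewrite /co.
by have := co_onedge eF I; rewrite (gtr0_norm h0); exact: N.
Qed.

(** The value on the sides, a null set, is irrelevant. *)
Definition paste (p : R2 -> R2 -> R) x : R := \sum_(c <- T) (p c \_ (cell h c)) x.

Lemma paste_cell p c x : c \in T -> cell h c x -> paste p x = p c x.
Proof.
move=> cT cx; rewrite /paste (bigD1_seq c)//= ?fset_uniq// big1_seq ?addr0.
  by rewrite patchE mem_set.
move=> c' /andP[c'c c'T]; rewrite patchE ifF//; apply/negbTE/negP => /set_mem c'x.
by move/eqP: c'c; apply; exact: (cells_disjoint c'T cT c'x cx).
Qed.

Lemma paste_L2 p : (forall c, continuous (p c)) -> inL2 D (paste p).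
Proof.
move=> cp; rewrite /paste; have L c : inL2 D (p c \_ (cell h c)).
  have mc : meas (cell h c) by exact: rect_meas.
  have [M M0 HM] := @bounded_rect R ord0 h h c _ (cp c).
  have mp : measurable_fun (D : set M2) (p c \_ (cell h c) : M2 -> R).
    apply: (measurable_funS measurableT) => //; apply/(measurable_restrictT _ mc).
    by apply: (measurable_funS measurableT) => //; exact: continuous_meas2.
  split => //; apply: (@itg_le R D (fun x => (p c \_ (cell h c)) x ^+ 2) (fun=> M ^+ 2) mD).
  - exact: measurable_funX.
  - by apply: itg_cst => //; exact: mesh_fin mesh.
  move=> x _; rewrite ger0_norm ?sqr_ge0// patchE; case: ifPn => [/set_mem [/ltW k1 /ltW k2]|_].
    by rewrite -(real_normK (num_real (p c x))) lerXn2r// ?nnegrE//; [exact: ltW|exact: HM].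
  by rewrite expr0n sqr_ge0.
elim: (enum_fset T) => [|c s IH].
  rewrite (_ : (fun x => _) = fun=> 0); last by apply/funext => x; rewrite big_nil.
  by apply: inL2_cst => //; exact: mesh_fin mesh.
rewrite (_ : (fun x => _) = fun x => (p c \_ (cell h c)) x + \sum_(c <- s) (p c \_ (cell h c)) x); last first.
  by apply/funext => x; rewrite big_cons.
exact: inL2D.
Qed.

Lemma wderiv_smooth_cell (s : seq 'I_2) c q : c \in T -> smooth q -> is_wderiv (cell h c) s q (pderiv s q).
Proof.
move=> cT sq; have [M M0 DM] := mesh_bounded mesh.
apply: (@is_wderiv_smooth R (cell h c) M) => //; first exact: rect_meas.
by apply: subset_trans DM; exact: (cell_sub mesh cT).
Qed.

Lemma wderiv_piece (s : seq 'I_2) c f q : c \in T -> smooth q -> inL2 (cell h c) f ->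
  ae_eq (@leb2 R) (cell h c : set M2) (q : M2 -> R) f -> is_wderiv (cell h c) s f (pderiv s q).
Proof.
move=> cT sq fL qf; have mc : meas (cell h c) by exact: rect_meas.
apply: (is_wderiv_aeq mc _ fL qf); first by apply: inL2_cont; exact: smooth_continuous.
exact: wderiv_smooth_cell.
Qed.

Lemma vertex_vtx c a : vertex h c a -> exists s t, [/\ sgnp s, sgnp t & a = vtx h c s t].
Proof.
have E (y z : R) : `|y - z| = h -> exists s : R, sgnp s /\ y = z + s * h.
  move=> e; have [ge|lt] := leP 0 (y - z).
    by exists 1; split; [left|rewrite -e ger0_norm//; ring].
  by exists (-1); split; [right|rewrite -e ltr0_norm//; ring].
move=> [/E[s [hs e1]] /E[t [ht e2]]]; exists s, t; split => //.
by apply: (@co_inj _ ord0); rewrite ?rev_ord2 /vtx !coE /co /ei /= ?e1 ?e2; ring.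
Qed.

Lemma edge_mid c (F : 'I_2 * R2) : edge h c F -> exists s, sgnp s /\ F.2 = c + (s * h) *: ei F.1.
Proof.
case=> ->; [exists 1|exists (-1)]; split; rewrite ?mul1r ?mulN1r ?scaleNr//; [by left|by right].
Qed.

Lemma boundary_out a : boundary D a -> ~ D a.
Proof. by move=> [_ nI] Da; apply: nI; apply: open_nbhs_nbhs; split => //; exact: mesh_open mesh. Qed.

(** The degrees of freedom of the interpolant are those of phi, which is globally
smooth and vanishes with its derivatives on the boundary. *)
Lemma paste_V_h phi : test_function D phi -> V_h D h T (paste (fun c => interp h c phi)).
Proof.
move=> tp; have sp := test_smooth tp.
split; first by apply: paste_L2 => c; apply: smooth_continuous; exact: interp_smooth.
exists (fun c => interp h c phi); split.
- move=> c cT; split; first exact: interp_P_T.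
  have := elt_cell_ae h c; apply: (@filterS _ _ ae_leb2_filter) => x H /H cx.
  exact: (paste_cell (fun c => interp h c phi) cT cx).
- move=> c c' a _ _ /vertex_vtx[s [t [hs ht e]]] /vertex_vtx[s' [t' [hs' ht' e']]] _.
  by rewrite [in LHS]e [in RHS]e' !interp_vtx// -e -e'.
- move=> c a _ /vertex_vtx[s [t [hs ht e]]] /boundary_out nD.
  by rewrite e interp_vtx// -e (test_out tp nD).
- move=> c c' F _ _ /edge_mid[s [hs e]] /edge_mid[s' [hs' e']].
  have K d r : sgnp r -> F.2 = d + (r * h) *: ei F.1 -> edge_flux h F (interp h d phi) = edge_flux h F phi.
    by move=> hr er; rewrite /edge_flux /edge_pt er; exact: interp_flux.
  exact: (etrans (K c s hs e) (esym (K c' s' hs' e'))).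
- move=> c F _ /edge_mid[s [hs e]] sub.
  have -> : edge_flux h F (interp h c phi) = edge_flux h F phi.
    by rewrite /edge_flux /edge_pt e; exact: interp_flux.
  transitivity (line F.1 h F.2 (fun=> 0)); last by rewrite line_cst// mulr0.
  rewrite -[LHS]/(line F.1 h F.2 ('D_(ei F.1) phi)).
  apply: line_eq => t th; apply: (test_out (test_D F.1 tp)); apply: boundary_out; apply: sub.
  by exists t.
Qed.
End OneMesh.

End Glue.

(** * Bessel inequality and consistency on one cell *)

Section Consistency.
Context {R : realType}.
Local Notation R2 := (R * R)%type.
Local Notation M2 := (measurableTypeR R * measurableTypeR R)%type.
Implicit Types (a f g w phi psi p : R2 -> R) (i j : 'I_2) (x c : R2) (h r : R) (E : set R2).

Lemma sum_ord2 i (F : 'I_2 -> R) : \sum_(j < 2) F j = F i + F (rev_ord i).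
Proof.
rewrite !big_ord_recl big_ord0 addr0.
have -> : lift ord0 ord0 = ord_max :> 'I_2 by apply: val_inj.
by case: (ord2P i) => ->; rewrite rev_ord2// addrC.
Qed.

Definition bil h c (F G : 'I_2 -> 'I_2 -> R2 -> R) : R :=
  \sum_(i < 2) \sum_(j < 2) I2 (cell h c) (fun x => F i j x * G i j x).

Definition hess f i j : R2 -> R := pderiv [:: i; j] f.

(** The coefficient of xi in d_ii p, read off from a moment so that it does not
depend on a choice of coefficients for p. *)
Definition lincoef h c p i : R := mom i h c (hess p i i) / (4 * h ^+ 4 / 3).

Lemma P_T_smooth p : P_T p -> smooth p.
Proof. by move=> /P_T_lpoly0[k [a [e [b [m ->]]]]]; exact: smooth_lpoly. Qed.

Lemma sum_le2 (a b h : R) : a <= h -> b <= h -> a + b <= 2 * h.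
Proof. lra. Qed.

Lemma sqr_split (a b d M : R) : `|b - d| <= M -> (a - d) ^+ 2 <= 2 * (a - b) ^+ 2 + 2 * M ^+ 2.
Proof.
rewrite ler_norml => /andP[l1 l2].
have -> : a - d = (a - b) + (b - d) by ring.
have : (b - d) ^+ 2 <= M ^+ 2 by nra.
have := sqr_ge0 ((a - b) - (b - d)).
by move: (a - b) (b - d) => p q; nra.
Qed.

Lemma pair_comb (a b k a' b' : R) : a = b + k -> a' = b' + 0 -> a + a' = b + b' + k.
Proof. by move=> -> ->; rewrite addr0 addrAC. Qed.

Section Cell.
Context (h : R) (c : R2) (h0 : 0 < h).
Let mc : meas (cell h c) := rect_meas ord0 h h c.
Let Lsm f : smooth f -> inL2 (cell h c) f.
Proof. by move=> sf; apply: inL2_cont; exact: smooth_continuous. Qed.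
Let Lx i : inL2 (cell h c) (fun x => co i (x - c)).
Proof. by apply: Lsm; exact: smooth_coc. Qed.
Let fin : (@leb2 R (cell h c) < +oo)%E := rect_fin ord0 h h c.

Lemma N_gt0 : 0 < 4 * h ^+ 4 / 3.
Proof. by rewrite divr_gt0// mulr_gt0// exprn_gt0. Qed.

Lemma momZx i al A : mom i h c (fun x => al + A * co i (x - c)) = A * (4 * h ^+ 4 / 3).
Proof.
rewrite -(I2_xi2 c h0 i) -I2Z//; last exact: (inL2_sq (Lx i)).
rewrite -[RHS]addr0 -(mom_cst c h0 i al) /mom -I2D//.
- by apply: I2_eq => x _; ring.
- by apply: itgZ => //; exact: (inL2_sq (Lx i)).
- by apply: inL2_itgM => //; exact: inL2_cst.
Qed.

Lemma P_T_hess p i : P_T p ->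
  (exists al, forall x, hess p i i x = al + lincoef h c p i * co i (x - c)) /\
  exists m, forall x, hess p i (rev_ord i) x = m.
Proof.
move=> /P_T_lpoly0[k [a [e [b [m ->]]]]]; split; last by exists m => x; exact: pd11_lpoly.
have E x : hess (lpoly 0 k a e b m) i i x = (2 * e i + 6 * b i * co i c) + 6 * b i * co i (x - c).
  by rewrite /hess pd2_lpoly subr0 coB; ring.
exists (2 * e i + 6 * b i * co i c) => x; rewrite E; congr (_ + _ * _).
by rewrite /lincoef (funext E) momZx mulfK// gt_eqF// N_gt0.
Qed.

Lemma momB_L2 i f g : inL2 (cell h c) f -> inL2 (cell h c) g ->
  mom i h c (fun x => f x - g x) = mom i h c f - mom i h c g.
Proof.
move=> fL gL; rewrite /mom -I2B//; [|exact: inL2_itgM|exact: inL2_itgM].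
by apply: I2_eq => x _; rewrite mulrBr.
Qed.

Lemma bessel1 i f : inL2 (cell h c) f ->
  mom i h c f ^+ 2 / (4 * h ^+ 4 / 3) <= I2 (cell h c) (fun x => f x ^+ 2).
Proof.
move=> fL; rewrite ler_pdivrMr ?N_gt0// mulrC -(I2_xi2 c h0 i).
exact: (cauchy_schwarz mc (Lx i) fL).
Qed.

(** On the cell d_ij p is a constant and d_ii p an affine function of xi_i; a
constant has no moment, and xi_i has moment N. *)
Lemma bessel p (F : 'I_2 -> 'I_2 -> R2 -> R) : P_T p -> (forall i j, inL2 (cell h c) (F i j)) ->
  \sum_(i < 2) ((mom i h c (F i i) - lincoef h c p i * (4 * h ^+ 4 / 3)) ^+ 2
     + mom (rev_ord i) h c (F i (rev_ord i)) ^+ 2) / (4 * h ^+ 4 / 3) <=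
  \sum_(i < 2) \sum_(j < 2) I2 (cell h c) (fun x => (F i j x - hess p i j x) ^+ 2).
Proof.
move=> pT FL; have sp := P_T_smooth pT.
have LP i j : inL2 (cell h c) (hess p i j) by apply: Lsm; exact: smooth_pderiv.
apply: ler_sum => i _; rewrite (sum_ord2 i) mulrDl.
have [[al E1] [m E2]] := P_T_hess i pT.
apply: lerD.
  have := bessel1 i (inL2B mc (FL i i) (LP i i)).
  by rewrite momB_L2// [in X in _ - X](funext E1) momZx.
have := bessel1 (rev_ord i) (inL2B mc (FL i (rev_ord i)) (LP i (rev_ord i))).
by rewrite momB_L2// [in X in _ - X](funext E2) mom_cst// subr0.
Qed.

Lemma pair_split a f g k : inL2 (cell h c) a -> inL2 (cell h c) f -> inL2 (cell h c) g ->
  I2 (cell h c) (fun x => a x * (f x - g x)) = k ->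
  I2 (cell h c) (fun x => a x * f x) = I2 (cell h c) (fun x => a x * g x) + k.
Proof.
move=> aL fL gL <-; rewrite -I2D//; [|exact: inL2_itgM|by apply: inL2_itgM => //; exact: inL2B].
by apply: I2_eq => x _; rewrite mulrBr addrC subrK.
Qed.

Lemma pair_const a m f : inL2 (cell h c) f -> (forall x, a x = m) -> I2 (cell h c) f = 0 ->
  I2 (cell h c) (fun x => a x * f x) = 0.
Proof.
move=> fL E Z; transitivity (I2 (cell h c) (fun x => m * f x)); first by apply: I2_eq => x _; rewrite E.
by rewrite I2Z ?Z ?mulr0//; exact: inL2_itg.
Qed.

Lemma pair_affine i a al A f q : inL2 (cell h c) f -> (forall x, a x = al + A * co i (x - c)) ->
  I2 (cell h c) f = 0 -> mom i h c f = q -> I2 (cell h c) (fun x => a x * f x) = A * q.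
Proof.
move=> fL E Z <-; transitivity (I2 (cell h c) (fun x => al * f x + A * (co i (x - c) * f x))).
  by apply: I2_eq => x _; rewrite E; ring.
have i1 : itg (cell h c) (fun x => al * f x) by apply: itgZ => //; exact: inL2_itg.
have i2 : itg (cell h c) (fun x => co i (x - c) * f x) by exact: inL2_itgM.
by rewrite I2D ?I2Z ?Z ?mulr0 ?add0r//; [exact: inL2_itg|exact: itgZ].
Qed.

(** Against d_ij p, a constant, the interpolation error integrates to zero; against
d_ii p only the slope remains, multiplied by the moment of [interp_mom]. *)
Lemma cell_consistency p phi : P_T p -> smooth phi ->
  bil h c (hess p) (hess phi) = bil h c (hess p) (hess (interp h c phi))
   + \sum_(i < 2) lincoef h c p i * mom (rev_ord i) h c (hess phi i (rev_ord i)).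
Proof.
move=> pT sf; have sp := P_T_smooth pT.
have si : smooth (interp h c phi) := interp_smooth h c phi.
have Lp i j : inL2 (cell h c) (hess p i j) by apply: Lsm; exact: smooth_pderiv.
have Lf i j : inL2 (cell h c) (hess phi i j) by apply: Lsm; exact: smooth_pderiv.
have Li i j : inL2 (cell h c) (hess (interp h c phi) i j) by apply: Lsm; exact: smooth_pderiv.
have Ld i j : inL2 (cell h c) (fun x => hess phi i j x - hess (interp h c phi) i j x) by exact: inL2B.
have B G : bil h c (hess p) G = \sum_(i < 2) (I2 (cell h c) (fun x => hess p i i x * G i i x)
    + I2 (cell h c) (fun x => hess p i (rev_ord i) x * G i (rev_ord i) x)).
  by apply: eq_bigr => i _; exact: (sum_ord2 i (fun j => I2 (cell h c) (fun x => hess p i j x * G i j x))).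
rewrite (B (hess phi)) (B (hess (interp h c phi))) -big_split; apply: eq_bigr => i _ /=.
have [[al E1] [m E2]] := P_T_hess i pT.
have Z1 := pair_affine (Ld i i) E1 (interp_mean c h0 sf i i) (interp_mom c h0 sf i).
have Z2 := pair_const (Ld i (rev_ord i)) E2 (interp_mean c h0 sf i (rev_ord i)).
exact: (pair_comb (pair_split (Lp i i) (Lf i i) (Li i i) Z1) (pair_split (Lp i (rev_ord i)) (Lf i (rev_ord i)) (Li i (rev_ord i)) Z2)).
Qed.

(** The constant k is the value at the centre of a Lipschitz function close to f. *)
Lemma lip_cell f psi k (L : R) : smooth f -> smooth psi -> 0 <= L -> k = psi c ->
  (forall x y, `|psi y - psi x| <= L * (`|co ord0 (y - x)| + `|co ord_max (y - x)|)) ->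
  I2 (cell h c) (fun x => (f x - k) ^+ 2) <=
  2 * I2 (cell h c) (fun x => (f x - psi x) ^+ 2) + 8 * h ^+ 2 * L ^+ 2 * I2 (cell h c) (fun=> 1).
Proof.
move=> sf sq L0 -> lip.
have i1 : itg (cell h c) (fun=> 1) by apply: inL2_itg => //; exact: inL2_cst.
have d1 : itg (cell h c) (fun x => (f x - psi x) ^+ 2) by apply: inL2_sq; apply: Lsm; exact: smooth_sub.
have sk : smooth (fun x => f x - psi c) := smooth_sub sf (smooth_cst (psi c)).
rewrite -I2Z// -I2Z// -I2D//; [|exact: itgZ|exact: itgZ].
apply: I2_le => //; [by apply: inL2_sq; exact: Lsm|by apply: itgD => //; exact: itgZ|].
move=> x cx; have X0 := ltW (@cellP _ _ _ _ ord0 cx); have X1 := ltW (@cellP _ _ _ _ ord_max cx).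
have H : `|psi x - psi c| <= 2 * h * L.
  apply: le_trans (lip _ _) _; rewrite mulrC ler_wpM2r//; exact: sum_le2.
rewrite mulr1 (_ : 8 * h ^+ 2 * L ^+ 2 = 2 * (2 * h * L) ^+ 2); last by ring.
exact: sqr_split.
Qed.
End Cell.
End Consistency.

(** * Consistency of the discrete eigenpair *)

Section Global.
Context {R : realType}.
Local Notation R2 := (R * R)%type.
Local Notation M2 := (measurableTypeR R * measurableTypeR R)%type.
Implicit Types (a f g w phi psi p uh : R2 -> R) (i j : 'I_2) (x c : R2) (h r : R) (E : set R2) (T : {fset R2}) (P : R2 -> R2 -> R).

Lemma normL2_eq1 D f : normL2 D f = 1 -> I2 D (fun x => f x ^+ 2) = 1.
Proof.
have -> : I2 D (fun x => f x ^+ 2) = dotL2 D f f by apply: I2_eq => x _; rewrite expr2.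
rewrite /normL2 => H; rewrite -[LHS]sqr_sqrtr ?H ?expr1n//.
by apply: I2_ge0 => x _; rewrite -expr2 sqr_ge0.
Qed.

(** P c is the polynomial that represents uh on the element with centre c. *)
Record morley_piece D h T (lamh : R) uh P : Prop := MorleyPiece {
  mp_L2 : inL2 D uh;
  mp_PT : forall c, c \in T -> P_T (P c);
  mp_ae : forall c, c \in T -> {ae @leb2 R, forall x, elt h c x -> uh x = P c x};
  mp_eig : forall w, V_h D h T w -> dot_hess_h h T uh w = lamh * dotL2 D uh w;
  mp_eig0 : dot_hess_h h T uh uh = lamh * dotL2 D uh uh;
  mp_norm : I2 D (fun x => uh x ^+ 2) = 1 }.

Lemma morley_pieceP D h T lamh uh : Morley_eigenpair D h T lamh uh -> normL2 D uh = 1 ->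
  exists P, morley_piece D h T lamh uh P.
Proof.
move=> [Vuh eig] n1; have [uL [P [PT _ _ _ _]]] := Vuh.
exists P; split => //.
- by move=> c /PT[].
- by move=> c /PT[].
- exact: eig.
- exact: normL2_eq1.
Qed.

(** How far the discrete equation is from holding with test function f, F standing
for the Hessian of f, once the first-order consistency error of the element is taken
out. *)
Definition defect D h T lamh uh P (F : 'I_2 -> 'I_2 -> R2 -> R) f : R :=
  \sum_(c <- T) (bil h c (hess (P c)) F
     - \sum_(i < 2) lincoef h c (P c) i * mom (rev_ord i) h c (F i (rev_ord i))) - lamh * I2 D (fun x => uh x * f x).

(** Rewrites all the integrals over the domain as sums over the cells at once. *)
Lemma interp_subst (k h L a b d v a2 b2 d2 v2 X : R) : a = a2 -> b = b2 -> d = d2 -> v = v2 ->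
  X <= k * (2 * (a2 + b2 + d2) + 24 * h ^+ 2 * L ^+ 2 * v2) ->
  X <= k * (2 * (a + b + d) + 24 * h ^+ 2 * L ^+ 2 * v).
Proof. by move=> -> -> -> ->. Qed.

Section OneMesh.
Context (D : set R2) (h : R) (T : {fset R2}) (mesh : uniform_mesh D h T).
Let mD : meas D := mesh_meas mesh.
Let h0 : 0 < h := mesh_h0 mesh.

Lemma smooth_L2 f : smooth f -> inL2 D f.
Proof. by move=> sf; have [M M0 DM] := mesh_bounded mesh; exact: (bounded_smooth_inL2 mD DM). Qed.

(** Summed over the cells, the local interpolation estimates measure the
oscillation of the second derivatives, which is small for phi close to fixed Lipschitz
functions. *)
Lemma paste_err phi psi0 psi1 psi2 (L : R) : smooth phi -> 0 <= L ->
  smooth psi0 -> smooth psi1 -> smooth psi2 ->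
  (forall x y, `|psi0 y - psi0 x| <= L * (`|co ord0 (y - x)| + `|co ord_max (y - x)|)) ->
  (forall x y, `|psi1 y - psi1 x| <= L * (`|co ord0 (y - x)| + `|co ord_max (y - x)|)) ->
  (forall x y, `|psi2 y - psi2 x| <= L * (`|co ord0 (y - x)| + `|co ord_max (y - x)|)) ->
  I2 D (fun x => (phi x - paste h T (fun c => interp h c phi) x) ^+ 2) <=
  12 ^+ 3 * h ^+ 4 * (2 * (I2 D (fun x => (hess phi ord0 ord0 x - psi0 x) ^+ 2)
    + I2 D (fun x => (hess phi ord0 ord_max x - psi1 x) ^+ 2)
    + I2 D (fun x => (hess phi ord_max ord_max x - psi2 x) ^+ 2)) + 24 * h ^+ 2 * L ^+ 2 * I2 D (fun=> 1)).
Proof.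
move=> sp L0 s0 s1 s2 l0 l1 l2.
have gL : inL2 D (paste h T (fun c => interp h c phi)).
  by apply: (paste_L2 mesh) => c; apply: smooth_continuous; exact: interp_smooth.
have ig : itg D (fun x => (phi x - paste h T (fun c => interp h c phi) x) ^+ 2).
  by apply: inL2_sq; apply: inL2B => //; exact: smooth_L2.
have sh i j : smooth (hess phi i j) by exact: smooth_pderiv.
have id f g : smooth f -> smooth g -> itg D (fun x => (f x - g x) ^+ 2).
  by move=> sf sg; apply: inL2_sq; apply: smooth_L2; exact: smooth_sub.
have i1 : itg D (fun=> 1) by apply: itg_cst => //; exact: mesh_fin mesh.
apply: (interp_subst (I2_mesh mesh (id _ _ (sh ord0 ord0) s0)) (I2_mesh mesh (id _ _ (sh ord0 ord_max) s1))
   (I2_mesh mesh (id _ _ (sh ord_max ord_max) s2)) (I2_mesh mesh i1)).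
rewrite (I2_mesh mesh ig) -!big_split /= !mulr_sumr -big_split /= mulr_sumr.
rewrite [leLHS]big_seq [leRHS]big_seq; apply: ler_sum => c cT.
have mc : meas (cell h c) by exact: rect_meas.
have -> : I2 (cell h c) (fun x => (phi x - paste h T (fun c0 => interp h c0 phi) x) ^+ 2) =
   I2 (cell h c) (fun x => (phi x - interp h c phi x) ^+ 2).
  by apply: I2_eq => x cx; rewrite (paste_cell mesh (fun c => interp h c phi) cT cx).
apply: le_trans (interp_L2 c h0 sp (psi0 c) (psi1 c) (psi2 c)) _.
apply: ler_wpM2l; first by rewrite mulr_ge0// exprn_ge0// ltW.
have e0 := lip_cell h (sh ord0 ord0) s0 L0 erefl l0.
have e1 := lip_cell h (sh ord0 ord_max) s1 L0 erefl l1.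
have e2 := lip_cell h (sh ord_max ord_max) s2 L0 erefl l2.
apply: le_trans (lerD (lerD (e0 c) (e1 c)) (e2 c)) _.
by rewrite le_eqVlt; apply/orP; left; apply/eqP; ring.
Qed.

Context (lamh : R) (uh : R2 -> R) (P : R2 -> R2 -> R) (mp : morley_piece D h T lamh uh P).

Lemma uh_cell c : c \in T -> inL2 (cell h c) uh.
Proof. by move=> cT; exact: (inL2_sub mD (rect_meas _ _ _ _) (cell_sub mesh cT) (mp_L2 mp)). Qed.

Lemma piece_smooth c : c \in T -> smooth (P c).
Proof. by move=> cT; exact: P_T_smooth (mp_PT mp cT). Qed.

Lemma wd_uh c i j : c \in T -> is_wderiv (cell h c) [:: i; j] uh (hess (P c) i j).
Proof.
move=> cT; apply: (wderiv_piece mesh [:: i; j] cT (piece_smooth cT) (uh_cell cT)).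
by have := mp_ae mp cT; apply: (@filterS _ _ ae_leb2_filter) => x H cx; rewrite H//; exact: cell_elt.
Qed.

Lemma dot_hess_paste phi : test_function D phi ->
  dot_hess_h h T uh (paste h T (fun c => interp h c phi)) =
  \sum_(c <- T) bil h c (hess (P c)) (hess (interp h c phi)).
Proof.
move=> tp; rewrite /dot_hess_h [LHS]big_seq [RHS]big_seq; apply: eq_bigr => c cT.
have gL : inL2 D (paste h T (fun c => interp h c phi)).
  by apply: (paste_L2 mesh) => d; apply: smooth_continuous; exact: interp_smooth.
have gLc := inL2_sub mD (rect_meas _ _ _ _) (cell_sub mesh cT) gL.
apply: (dot_hess_cell h0 (uh_cell cT) gLc) => i j; first exact: wd_uh.
apply: (wderiv_piece mesh [:: i; j] cT (interp_smooth h c phi) gLc).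
by apply: aeW => x cx; rewrite (paste_cell mesh (fun c => interp h c phi) cT cx).
Qed.

(** The interpolant is a legitimate test function of the discrete problem, and
[cell_consistency] compares it with phi. *)
Lemma defect_test phi : test_function D phi ->
  defect D h T lamh uh P (hess phi) phi =
  - lamh * I2 D (fun x => uh x * (phi x - paste h T (fun c => interp h c phi) x)).
Proof.
move=> tp; have sp := test_smooth tp.
have gL : inL2 D (paste h T (fun c => interp h c phi)).
  by apply: (paste_L2 mesh) => d; apply: smooth_continuous; exact: interp_smooth.
have pL := smooth_L2 sp; have uL := mp_L2 mp.
have E := mp_eig mp (paste_V_h mesh tp); rewrite dot_hess_paste// in E.
have -> : I2 D (fun x => uh x * (phi x - paste h T (fun c => interp h c phi) x)) =
    I2 D (fun x => uh x * phi x) - dotL2 D uh (paste h T (fun c => interp h c phi)).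
  rewrite /dotL2 -/(I2 D _) -I2B//; [|exact: inL2_itgM|exact: inL2_itgM].
  by apply: I2_eq => x _; rewrite mulrBr.
rewrite /defect mulNr mulrBr opprB -E; congr (_ - _).
rewrite [LHS]big_seq [RHS]big_seq; apply: eq_bigr => c cT.
exact: (canLR (addrK _) (cell_consistency c h0 (mp_PT mp cT) sp)).
Qed.

Lemma defect_le phi psi0 psi1 psi2 (L : R) : test_function D phi -> 0 <= L ->
  smooth psi0 -> smooth psi1 -> smooth psi2 ->
  (forall x y, `|psi0 y - psi0 x| <= L * (`|co ord0 (y - x)| + `|co ord_max (y - x)|)) ->
  (forall x y, `|psi1 y - psi1 x| <= L * (`|co ord0 (y - x)| + `|co ord_max (y - x)|)) ->
  (forall x y, `|psi2 y - psi2 x| <= L * (`|co ord0 (y - x)| + `|co ord_max (y - x)|)) ->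
  defect D h T lamh uh P (hess phi) phi ^+ 2 <= lamh ^+ 2 *
  (12 ^+ 3 * h ^+ 4 * (2 * (I2 D (fun x => (hess phi ord0 ord0 x - psi0 x) ^+ 2)
    + I2 D (fun x => (hess phi ord0 ord_max x - psi1 x) ^+ 2)
    + I2 D (fun x => (hess phi ord_max ord_max x - psi2 x) ^+ 2)) + 24 * h ^+ 2 * L ^+ 2 * I2 D (fun=> 1))).
Proof.
move=> tp L0 s0 s1 s2 l0 l1 l2; rewrite defect_test// exprMn sqrrN.
apply: ler_wpM2l; first exact: sqr_ge0.
apply: le_trans (paste_err (test_smooth tp) L0 s0 s1 s2 l0 l1 l2).
have gL : inL2 D (paste h T (fun c => interp h c phi)).
  by apply: (paste_L2 mesh) => d; apply: smooth_continuous; exact: interp_smooth.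
have dL : inL2 D (fun x => phi x - paste h T (fun c => interp h c phi) x).
  by apply: inL2B => //; exact: smooth_L2 (test_smooth tp).
by have := cauchy_schwarz mD (mp_L2 mp) dL; rewrite (mp_norm mp) mul1r.
Qed.

Lemma defect_cvg (F_ : nat -> 'I_2 -> 'I_2 -> R2 -> R) (F : 'I_2 -> 'I_2 -> R2 -> R) (f_ : nat -> R2 -> R) f :
  (forall i j, L2cvg D (fun n => F_ n i j) (F i j)) -> L2cvg D f_ f ->
  defect D h T lamh uh P (F_ n) (f_ n) @[n --> \oo] --> defect D h T lamh uh P F f.
Proof.
move=> cF cf.
have mc c : meas (cell h c) by exact: rect_meas.
have c2 : (lamh * I2 D (fun x => uh x * f_ n x)) @[n --> \oo] --> lamh * I2 D (fun x => uh x * f x).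
  have cg := L2cvg_I2 mD (L2cvg_cst mD (mp_L2 mp)) cf.
  exact: (@cvg_scale R (fun n => I2 D (fun x => uh x * f_ n x)) _ _ cg).
have Lc c i j : c \in T -> L2cvg (cell h c) (fun n => F_ n i j) (F i j).
  by move=> cT; exact: (L2cvg_sub mD (mc c) (cell_sub mesh cT) (cF i j)).
have c1 c : c \in T -> bil h c (hess (P c)) (F_ n) @[n --> \oo] --> bil h c (hess (P c)) F.
  move=> cT; rewrite /bil; apply: cvg_big => [|i _]; first exact: add_continuous.
  apply: cvg_big => [|j _]; first exact: add_continuous.
  apply: (L2cvg_I2 (mc c) (L2cvg_cst (mc c) _) (Lc c i j cT)).
  by apply: inL2_cont; apply: smooth_continuous; apply: smooth_pderiv; exact: piece_smooth.
have c3 c : c \in T -> \sum_(i < 2) lincoef h c (P c) i * mom (rev_ord i) h c (F_ n i (rev_ord i)) @[n --> \oo] -->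
   \sum_(i < 2) lincoef h c (P c) i * mom (rev_ord i) h c (F i (rev_ord i)).
  move=> cT; apply: cvg_big => [|i _]; first exact: add_continuous.
  have xiL : inL2 (cell h c) (fun x => co (rev_ord i) (x - c)).
    by apply: inL2_cont; apply: smooth_continuous; exact: smooth_coc.
  have cg := L2cvg_I2 (mc c) (L2cvg_cst (mc c) xiL) (Lc c i (rev_ord i) cT).
  exact: (@cvg_scale R (fun n => mom (rev_ord i) h c (F_ n i (rev_ord i))) _ _ cg).
rewrite /defect; apply: cvgB => //.
rewrite [X in _ --> X]big_seq.
rewrite (_ : (fun n => _) = fun n => \sum_(c <- T | c \in T) (bil h c (hess (P c)) (F_ n) -
   \sum_(i < 2) lincoef h c (P c) i * mom (rev_ord i) h c (F_ n i (rev_ord i)))); last first.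
  by apply/funext => n; rewrite big_seq.
apply: cvg_big => [|c cT]; first exact: add_continuous.
by apply: cvgB; [exact: c1|exact: c3].
Qed.
End OneMesh.

Lemma lip_weaken psi (L L' : R) : L <= L' ->
  (forall x y, `|psi y - psi x| <= L * (`|co ord0 (y - x)| + `|co ord_max (y - x)|)) ->
  forall x y, `|psi y - psi x| <= L' * (`|co ord0 (y - x)| + `|co ord_max (y - x)|).
Proof. by move=> LL H x y; apply: le_trans (H x y) _; apply: ler_wpM2r => //; exact: addr_ge0. Qed.

Lemma defect_num (d l K h e X Y Z V L eta : R) : 0 < K -> 0 < h -> h < 1 -> 0 < e -> 0 <= V ->
  eta * (K * 48) = e ^+ 2 -> h * (K * 48 * (L ^+ 2 * V + 1)) <= e ^+ 2 ->
  X <= 4 * eta -> Y <= 4 * eta -> Z <= 4 * eta ->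
  d ^+ 2 <= l ^+ 2 * (K * h ^+ 4 * (2 * (X + Y + Z) + 24 * h ^+ 2 * L ^+ 2 * V)) ->
  `|d| <= `|l| * (e * h ^+ 2).
Proof.
move=> K0 h0 h1 e0 V0 etaE hE X0 Y0 Z0 H.
have n0 : 0 <= `|l| * (e * h ^+ 2) by rewrite mulr_ge0// mulr_ge0 ?sqr_ge0// ltW.
rewrite -(@ler_pXn2r _ 2) ?nnegrE// real_normK ?num_real//.
apply: le_trans H _; rewrite exprMn real_normK ?num_real//; apply: ler_wpM2l; first exact: sqr_ge0.
have -> : (e * h ^+ 2) ^+ 2 = h ^+ 4 * e ^+ 2 by ring.
have -> : K * h ^+ 4 * (2 * (X + Y + Z) + 24 * h ^+ 2 * L ^+ 2 * V) =
  h ^+ 4 * (K * (2 * (X + Y + Z)) + 24 * (h ^+ 2 * (K * (L ^+ 2 * V)))) by ring.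
apply: ler_wpM2l; first by rewrite exprn_ge0// ltW.
have hh2 : h ^+ 2 <= h by rewrite expr2 ler_piMl// ltW.
have KV : 0 <= K * (L ^+ 2 * V) by rewrite mulr_ge0 ?(ltW K0)// mulr_ge0// sqr_ge0.
have b1 := ler_wpM2r KV hh2.
have b2 : K * (2 * (X + Y + Z)) <= K * (24 * eta) by rewrite ler_pM2l//; move: X0 Y0 Z0; clear; lra.
have Kh : 0 <= h * K by rewrite mulr_ge0// ltW.
move: hE etaE b1 b2 Kh.
have -> : h * (K * 48 * (L ^+ 2 * V + 1)) = 48 * (h * (K * (L ^+ 2 * V))) + 48 * (h * K) by ring.
have -> : eta * (K * 48) = 48 * (K * eta) by ring.
have -> : K * (24 * eta) = 24 * (K * eta) by ring.
clear; lra.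
Qed.

(** By [defect_le] the defect of a test function phi close to u is lamh * o(h^2),
uniformly in phi, and the defect is continuous in the Hessian and the function. *)
Lemma consistency D h1 T1 (u : R2 -> R) (eps : R) : uniform_mesh D h1 T1 -> inH0 2 D u -> 0 < eps ->
  exists2 h0 : R, 0 < h0 & forall h T, uniform_mesh D h T -> h < h0 ->
  forall lamh uh P, morley_piece D h T lamh uh P ->
  `|defect D h T lamh uh P (fun i j => U D u [:: i; j]) u| <= `|lamh| * (eps * h ^+ 2).
Proof.
move=> mesh1 H0u e0; have mD := mesh_meas mesh1; have [M M0 DM] := mesh_bounded mesh1.
have [K [K0 KE]] : exists K : R, 0 < K /\ 12 ^+ 3 = K by exists (12 ^+ 3); split => //; apply: exprn_gt0; rewrite ltr0n.
have [V VE] : {V | I2 D (fun=> 1) = V} by exists (I2 D (fun=> 1)).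
have V0 : 0 <= V by rewrite -VE; apply: I2_ge0.
have K48 : 0 < K * 48 by apply: mulr_gt0 => //; rewrite ltr0n.
have e20 : 0 < eps ^+ 2 by exact: exprn_gt0.
have [eta [eta0 etaE]] : exists eta : R, 0 < eta /\ eta * (K * 48) = eps ^+ 2.
  by exists (eps ^+ 2 / (K * 48)); split; [exact: divr_gt0|rewrite mulfVK// gt_eqF].
have [phi [tphi Lphi]] := dense_seq mesh1 H0u.
have near_eta k : L2cvg D (fun n => pderiv k (phi n)) (U D u k) ->
   \forall n \near \oo, I2 D (fun x => (U D u k x - pderiv k (phi n) x) ^+ 2) <= eta.
  move=> [_ _ /cvgrPdist_le /(_ _ eta0)]; apply: filterS => n.
  by rewrite sub0r normrN; apply: le_trans; exact: ler_norm.
have cF i j := Lphi [:: i; j] isT.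
have n0 := near_eta _ (cF ord0 ord0); have n1 := near_eta _ (cF ord0 ord_max); have n2 := near_eta _ (cF ord_max ord_max).
have [N [N0 N1 N2]] : exists N, [/\ I2 D (fun x => (U D u [:: ord0; ord0] x - pderiv [:: ord0; ord0] (phi N) x) ^+ 2) <= eta,
   I2 D (fun x => (U D u [:: ord0; ord_max] x - pderiv [:: ord0; ord_max] (phi N) x) ^+ 2) <= eta &
   I2 D (fun x => (U D u [:: ord_max; ord_max] x - pderiv [:: ord_max; ord_max] (phi N) x) ^+ 2) <= eta].
  have [N _ HN] := filterI n0 (filterI n1 n2); exists N; by have [? [? ?]] := HN N (leqnn N).
have [L0 L00 l0] := test_lip DM (test_pderiv [:: ord0; ord0] (tphi N)).
have [L1 L10 l1] := test_lip DM (test_pderiv [:: ord0; ord_max] (tphi N)).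
have [L2 L20 l2] := test_lip DM (test_pderiv [:: ord_max; ord_max] (tphi N)).
have [L [L0' le0 le1 le2]] : exists L : R, [/\ 0 <= L, L0 <= L, L1 <= L & L2 <= L].
  by exists (L0 + L1 + L2); split; move: L00 L10 L20; clear; lra.
have W0 : 0 < K * 48 * (L ^+ 2 * V + 1).
  by apply: mulr_gt0 => //; apply: ltr_wpDl => //; apply: mulr_ge0 => //; exact: sqr_ge0.
exists (Num.min 1 (eps ^+ 2 / (K * 48 * (L ^+ 2 * V + 1)))).
  by rewrite lt_min ltr01 divr_gt0.
move=> h T mesh; rewrite lt_min => /andP[hl1 hh] lamh uh P mp; have hp := mesh_h0 mesh.
have hE : h * (K * 48 * (L ^+ 2 * V + 1)) <= eps ^+ 2 by rewrite -ler_pdivlMr// ltW.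
have cf := Lphi [::] isT; rewrite U_nil in cf.
apply: (@cvg_le_eventually R (fun n => defect D h T lamh uh P (hess (phi n)) (phi n))).
  exact: (@defect_cvg D h T mesh lamh uh P mp (fun n => hess (phi n)) _ phi u cF cf).
have sN k : smooth (pderiv k (phi N)) by apply: smooth_pderiv; exact: test_smooth (tphi N).
apply: filterS2 n0 (filterI n1 n2) => n E0 [E1 E2].
have [La0 Lu0 _] := cF ord0 ord0; have [La1 Lu1 _] := cF ord0 ord_max; have [La2 Lu2 _] := cF ord_max ord_max.
have B0 := L2_close mD Lu0 (La0 n) (La0 N) E0 N0.
have B1 := L2_close mD Lu1 (La1 n) (La1 N) E1 N1.
have B2 := L2_close mD Lu2 (La2 n) (La2 N) E2 N2.
have := defect_le mesh mp (tphi n) L0' (sN [:: ord0; ord0]) (sN [:: ord0; ord_max]) (sN [:: ord_max; ord_max])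
  (lip_weaken le0 l0) (lip_weaken le1 l1) (lip_weaken le2 l2).
rewrite KE VE; exact: (defect_num K0 hp hl1 e0 V0 etaE hE B0 B1 B2).
Qed.

End Global.

(** * Comparison of the eigenvalues *)

Lemma lamh_le_arith (R : realType) (x y z : R) : 0 <= 2 ^+ 2 * x - 2 * 2 * 1 * y + 1 * z ->
  z <= 2 * x + 2 * (x - 2 * y + z).
Proof. rewrite expr2; lra. Qed.

Lemma gap_arith (R : realType) (lam lamh X L n e h Sg c0 : R) : 0 < h ->
  3 / (2 * h ^+ 4) * Sg <= lam - 2 * X + lamh + 2 * L ->
  - (lamh * (e * h ^+ 2)) <= X - L - lamh * (1 - n / 2) ->
  c0 * h ^+ 6 <= Sg ->
  3 / 2 * c0 * h ^+ 2 - 2 * lamh * (e * h ^+ 2) - lamh * n <= lam - lamh.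
Proof.
move=> hp B dl low.
have k0 : 0 <= 3 / (2 * h ^+ 4) by rewrite divr_ge0// mulr_ge0// exprn_ge0// ltW.
have low2 := ler_wpM2l k0 low.
have e1 : 3 / (2 * h ^+ 4) * (c0 * h ^+ 6) = 3 / 2 * c0 * h ^+ 2 by field; rewrite gt_eqF.
rewrite e1 in low2; move: (lamh * (e * h ^+ 2)) dl (mulrA 2 lamh (e * h ^+ 2)) => z dl <-.
have {}B := le_trans low2 B; move: B dl; move: (3 / 2 * c0 * h ^+ 2) => y.
by rewrite mulrBr mulr1 mulrA; move: (lamh * n) => w; clear; lra.
Qed.

Lemma small_mesh_arith (R : realType) (Lam C k e h lamh n gap : R) : 0 < h -> 0 <= lamh -> lamh <= Lam -> 0 < k ->
  0 < C -> 2 * Lam * e <= k / 2 -> 0 <= e -> n <= C ^+ 2 * h ^+ 4 -> h < 1 -> h * (Lam * C ^+ 2 + 1) <= k / 2 ->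
  k * h ^+ 2 - 2 * lamh * (e * h ^+ 2) - lamh * n <= gap -> 0 <= gap.
Proof.
move=> hp l0 lL kp Cp eS e0 nS h1 hS; apply: le_trans.
have L0 := le_trans l0 lL.
have A : 2 * lamh * (e * h ^+ 2) <= k / 2 * h ^+ 2.
  rewrite mulrA ler_wpM2r ?sqr_ge0//; apply: le_trans eS.
  by rewrite ler_wpM2r// ler_wpM2l.
have B : lamh * n <= k / 2 * h ^+ 2.
  have b1 : lamh * n <= Lam * (C ^+ 2 * h ^+ 4).
    apply: le_trans (_ : lamh * (C ^+ 2 * h ^+ 4) <= _); first by rewrite ler_wpM2l.
    by rewrite ler_wpM2r// mulr_ge0// exprn_ge0// ltW.
  apply: (le_trans b1); have -> : Lam * (C ^+ 2 * h ^+ 4) = (Lam * C ^+ 2 * h ^+ 2) * h ^+ 2 by ring.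
  rewrite ler_wpM2r ?sqr_ge0//; apply: le_trans hS.
  have LC0 : 0 <= Lam * C ^+ 2 by rewrite mulr_ge0// sqr_ge0.
  apply: le_trans (_ : h * (Lam * C ^+ 2) <= _); last by rewrite ler_wpM2l ?ltW// ltrDl.
  by rewrite mulrC ler_wpM2r// expr2 ger_pMr// ltW.
by move: A B; move: (2 * lamh * (e * h ^+ 2)) (lamh * n) (h ^+ 2) => x y z; clear; lra.
Qed.

Section Final.
Context {R : realType}.
Local Notation R2 := (R * R)%type.
Local Notation M2 := (measurableTypeR R * measurableTypeR R)%type.
Implicit Types (a f g w phi psi p uh u : R2 -> R) (i j : 'I_2) (x c : R2) (h r : R) (E : set R2) (T : {fset R2}) (P : R2 -> R2 -> R).

Lemma normL2_sqr D f : normL2 D f ^+ 2 = I2 D (fun x => f x ^+ 2).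
Proof.
have -> : I2 D (fun x => f x ^+ 2) = dotL2 D f f by apply: I2_eq => x _; rewrite expr2.
rewrite sqr_sqrtr//; apply: I2_ge0 => x _; exact: sqr_ge0.
Qed.

Lemma I2_quad E f g (s t : R) : meas E -> inL2 E f -> inL2 E g ->
  I2 E (fun x => (s * f x - t * g x) ^+ 2) =
  s ^+ 2 * I2 E (fun x => f x ^+ 2) - 2 * s * t * I2 E (fun x => g x * f x) + t ^+ 2 * I2 E (fun x => g x ^+ 2).
Proof.
move=> mE fL gL.
have i1 := inL2_sq fL; have i2 := inL2_itgM mE gL fL; have i3 := inL2_sq gL.
rewrite -(I2Z _ mE i1) -(I2Z _ mE i2) -(I2Z _ mE i3).
rewrite -(I2B mE (itgZ _ mE i1) (itgZ _ mE i2)).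
rewrite -(I2D mE (itgB mE (itgZ _ mE i1) (itgZ _ mE i2)) (itgZ _ mE i3)).
by apply: I2_eq => x _; ring.
Qed.

Lemma sum_ij_quad (s t : R) (X A B C : 'I_2 -> 'I_2 -> R) :
  (forall i j, X i j = s ^+ 2 * A i j - 2 * s * t * B i j + t ^+ 2 * C i j) ->
  \sum_(i < 2) \sum_(j < 2) X i j = s ^+ 2 * (\sum_(i < 2) \sum_(j < 2) A i j)
   - 2 * s * t * (\sum_(i < 2) \sum_(j < 2) B i j) + t ^+ 2 * (\sum_(i < 2) \sum_(j < 2) C i j).
Proof.
move=> H; rewrite !mulr_sumr -sumrB -big_split; apply: eq_bigr => i _ /=.
by rewrite !mulr_sumr -sumrB -big_split; apply: eq_bigr => j _ /=.
Qed.

Section OneMesh.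
Context (D : set R2) (h : R) (T : {fset R2}) (mesh : uniform_mesh D h T).
Context (u : R2 -> R) (reg : inH 4 D u).
Context (lamh : R) (uh : R2 -> R) (P : R2 -> R2 -> R) (mp : morley_piece D h T lamh uh P).
Let mD : meas D := mesh_meas mesh.
Let h0 : 0 < h := mesh_h0 mesh.
Let mc c : meas (cell h c) := rect_meas ord0 h h c.
Let V i j : R2 -> R := U D u [:: i; j].

Let VL i j : inL2 D (V i j).
Proof. exact: U_L2 reg _. Qed.

Let VLc i j c : c \in T -> inL2 (cell h c) (V i j).
Proof. by move=> cT; exact: (inL2_sub mD (mc c) (cell_sub mesh cT) (VL i j)). Qed.

Let PLc i j c : c \in T -> inL2 (cell h c) (hess (P c) i j).
Proof.
by move=> cT; apply: inL2_cont; apply: smooth_continuous; apply: smooth_pderiv; exact: (piece_smooth mp cT).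
Qed.

Lemma hess_u : dot_hess D u u = \sum_(c <- T) \sum_(i < 2) \sum_(j < 2) I2 (cell h c) (fun x => V i j x ^+ 2).
Proof.
transitivity (I2 D (fun x => \sum_(i < 2) \sum_(j < 2) V i j x ^+ 2)).
  apply: I2_eq => x _; apply: eq_bigr => i _; apply: eq_bigr => j _.
  by rewrite /V /U -lock expr2.
have I i j : itg D (fun x => V i j x ^+ 2) by apply: inL2_sq.
rewrite I2_sum//; last by move=> i _; apply: itg_sum.
rewrite exchange_big /=; apply: eq_bigr => i _; rewrite I2_sum// exchange_big /=.
by apply: eq_bigr => j _; exact: (I2_mesh mesh (I i j)).
Qed.

Lemma hess_uh : lamh = \sum_(c <- T) \sum_(i < 2) \sum_(j < 2) I2 (cell h c) (fun x => hess (P c) i j x ^+ 2).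
Proof.
have := mp_eig0 mp; have -> : dotL2 D uh uh = 1.
  by rewrite -(mp_norm mp); apply: I2_eq => x _; rewrite expr2.
rewrite mulr1 => <-; rewrite /dot_hess_h [LHS]big_seq [RHS]big_seq; apply: eq_bigr => c cT.
rewrite (dot_hess_cell h0 (uh_cell mesh mp cT) (uh_cell mesh mp cT) (fun i j => wd_uh mesh mp i j cT) (fun i j => wd_uh mesh mp i j cT)).
by apply: eq_bigr => i _; apply: eq_bigr => j _; apply: I2_eq => x _; rewrite expr2.
Qed.

Lemma hess_diff : dot_hess_h h T (u \- uh) (u \- uh) =
  \sum_(c <- T) \sum_(i < 2) \sum_(j < 2) I2 (cell h c) (fun x => (V i j x - hess (P c) i j x) ^+ 2).
Proof.
rewrite /dot_hess_h [LHS]big_seq [RHS]big_seq; apply: eq_bigr => c cT.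
have uL : inL2 (cell h c) u by exact: (inL2_sub mD (mc c) (cell_sub mesh cT) reg.1).
have uhL := uh_cell mesh mp cT.
have [M M0 DM] := mesh_bounded mesh.
have DMc : cell h c `<=` rect ord0 M M 0 by apply: subset_trans DM; exact: (cell_sub mesh cT).
have W i j : is_wderiv (cell h c) [:: i; j] (u \- uh) (fun x => V i j x - hess (P c) i j x).
  apply: (@is_wderivB R (cell h c) M (mc c) DMc u uh [:: i; j] _ _ uL uhL); last exact: (wd_uh mesh mp i j cT).
  by apply: (is_wderiv_sub mD (mc c) (cell_sub mesh cT)); exact: (U_spec reg).
have dL : inL2 (cell h c) (u \- uh) by exact: inL2B.
rewrite (dot_hess_cell h0 dL dL W W).
by apply: eq_bigr => i _; apply: eq_bigr => j _; apply: I2_eq => x _; rewrite expr2.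
Qed.

Lemma hess_quad (s t : R) :
  \sum_(c <- T) \sum_(i < 2) \sum_(j < 2) I2 (cell h c) (fun x => (s * V i j x - t * hess (P c) i j x) ^+ 2) =
  s ^+ 2 * dot_hess D u u - 2 * s * t * (\sum_(c <- T) bil h c (hess (P c)) V) + t ^+ 2 * lamh.
Proof.
rewrite hess_u {1}hess_uh !mulr_sumr -sumrB -big_split /= [LHS]big_seq [RHS]big_seq; apply: eq_bigr => c cT.
by apply: sum_ij_quad => i j; apply: I2_quad => //; [exact: VLc|exact: PLc].
Qed.

Lemma lamh_ge0 : 0 <= lamh.
Proof.
by rewrite hess_uh; apply: sumr_ge0 => c _; apply: sumr_ge0 => i _; apply: sumr_ge0 => j _; apply: I2_ge0 => x _; exact: sqr_ge0.
Qed.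

(** The expansion of the square, lamh being the squared seminorm of uh. *)
Lemma hess_expand : dot_hess_h h T (u \- uh) (u \- uh) =
  dot_hess D u u - 2 * (\sum_(c <- T) bil h c (hess (P c)) V) + lamh.
Proof.
have := hess_quad 1 1; rewrite expr1n !mul1r !mulr1 => <-; rewrite hess_diff.
by apply: eq_bigr => c _; apply: eq_bigr => i _; apply: eq_bigr => j _; apply: I2_eq => x _; rewrite !mul1r.
Qed.

(** The square of 2 Hess u - Hess uh is nonnegative. *)
Lemma lamh_le : lamh <= 2 * dot_hess D u u + 2 * dot_hess_h h T (u \- uh) (u \- uh).
Proof.
have H : 0 <= \sum_(c <- T) \sum_(i < 2) \sum_(j < 2) I2 (cell h c) (fun x => (2 * V i j x - 1 * hess (P c) i j x) ^+ 2).
  by apply: sumr_ge0 => c _; apply: sumr_ge0 => i _; apply: sumr_ge0 => j _; apply: I2_ge0 => x _; exact: sqr_ge0.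
rewrite hess_quad in H; rewrite hess_expand; move: H; move: (dot_hess _ _ _) (\sum_(c <- T) _) lamh => x y z.
by rewrite expr1n; exact: lamh_le_arith.
Qed.

Lemma dot_uh : I2 D (fun x => u x ^+ 2) = 1 ->
  I2 D (fun x => uh x * u x) = 1 - normL2 D (u \- uh) ^+ 2 / 2.
Proof.
move=> u1; rewrite normL2_sqr.
have := @I2_quad D u uh 1 1 mD reg.1 (mp_L2 mp); rewrite (mp_norm mp) u1.
have -> : I2 D (fun x => (1 * u x - 1 * uh x) ^+ 2) = I2 D (fun x => (u \- uh) x ^+ 2).
  by apply: I2_eq => x _; rewrite !mul1r.
by move=> ->; rewrite expr1n; field.
Qed.

(** With a and q the moments of u, A the slope of uh and N the integral of xi^2,
((a - A N)^2 + q^2) / N + 2 A q = 2 a q / N + (a - A N - q)^2 / N. *)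
Lemma bessel_sum : \sum_(c <- T) \sum_(i < 2) 2 * (mom i h c (V i i) * mom (rev_ord i) h c (V i (rev_ord i))) / (4 * h ^+ 4 / 3) <=
  dot_hess_h h T (u \- uh) (u \- uh) +
  2 * \sum_(c <- T) \sum_(i < 2) lincoef h c (P c) i * mom (rev_ord i) h c (V i (rev_ord i)).
Proof.
rewrite hess_diff mulr_sumr -big_split /= [leLHS]big_seq [leRHS]big_seq; apply: ler_sum => c cT.
apply: le_trans (lerD (bessel h0 (mp_PT mp cT) (fun i j => VLc i j cT)) (lexx _)).
rewrite mulr_sumr -big_split /=; apply: ler_sum => i _.
have N0 := N_gt0 h0; move: (mom i h c (V i i)) (mom (rev_ord i) h c (V i (rev_ord i))) (lincoef h c (P c) i) => a q A.
move: N0; move: (4 * h ^+ 4 / 3) => N N0.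
rewrite -subr_ge0 (_ : _ - _ = (a - A * N - q) ^+ 2 / N) ?divr_ge0 ?sqr_ge0 ?ltW//.
by field; rewrite gt_eqF.
Qed.

(** The sum of the A q in [bessel_sum] is eliminated with the consistency
estimate, and (u, uh) = 1 - |u - uh|^2 / 2 by [dot_uh]. *)
Lemma eigenvalue_gap (c0 e : R) : I2 D (fun x => u x ^+ 2) = 1 ->
  `|defect D h T lamh uh P V u| <= `|lamh| * (e * h ^+ 2) ->
  c0 * h ^+ 6 <= \sum_(i < 2) \sum_(c <- T) mom i h c (V i i) * mom (rev_ord i) h c (V i (rev_ord i)) ->
  3 / 2 * c0 * h ^+ 2 - 2 * lamh * (e * h ^+ 2) - lamh * normL2 D (u \- uh) ^+ 2 <= dot_hess D u u - lamh.
Proof.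
move=> u1; rewrite (ger0_norm lamh_ge0) ler_norml => /andP[dl _] low.
have B := bessel_sum; rewrite hess_expand in B.
have e1 : \sum_(c <- T) \sum_(i < 2) 2 * (mom i h c (V i i) * mom (rev_ord i) h c (V i (rev_ord i))) / (4 * h ^+ 4 / 3) =
  3 / (2 * h ^+ 4) * \sum_(i < 2) \sum_(c <- T) mom i h c (V i i) * mom (rev_ord i) h c (V i (rev_ord i)).
  rewrite exchange_big mulr_sumr /=; apply: eq_bigr => i _; rewrite mulr_sumr; apply: eq_bigr => c _.
  by move: (_ * mom _ _ _ _) => q; field; rewrite gt_eqF.
rewrite e1 in B.
move: dl; rewrite /defect sumrB (dot_uh u1) => dl.
exact: (gap_arith h0 B dl low).
Qed.
End OneMesh.

End Final.

Theorem theorem2p1 (R : realType) (Omega : set (R * R)%type)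
  (lam : R) (u : (R * R)%type -> R)
  (eig : biharmonic_eigenpair Omega lam u)
  (u_norm : normL2 Omega u = 1)
  (reg : inH 4 Omega u)
  (H : set R) (T_ : R -> {fset (R * R)%type})
  (lam_ : R -> R) (u_ : R -> (R * R)%type -> R) (C : R)
  (mesh : forall h, H h -> uniform_mesh Omega h (T_ h))
  (eig_h : forall h, H h -> Morley_eigenpair Omega h (T_ h) (lam_ h) (u_ h))
  (u_h_norm : forall h, H h -> normL2 Omega (u_ h) = 1)
  (C_gt0 : 0 < C)
  (err_L2 : forall h, H h -> normL2 Omega (u \- u_ h) <= C * h ^+ 2)
  (err_hess : forall h, H h ->
     dot_hess_h h (T_ h) (u \- u_ h) (u \- u_ h) <= C * h ^+ 2) :
  exists2 h0 : R, 0 < h0 & forall h, H h -> h < h0 -> lam_ h <= lam.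
Proof.
have [[h1 Hh1]|noH] := pselect (exists h1, H h1); last first.
  (* A mesh is needed below to know that the domain is open and bounded. *)
  by exists 1 => // h Hh; case: noH; exists h.
have mesh1 := mesh _ Hh1; have [H0u eigu] := eig.
have u1 := normL2_eq1 u_norm.
have lamE : dot_hess Omega u u = lam.
  have d1 : dotL2 Omega u u = 1 by rewrite -[RHS]u1; apply: I2_eq => x _; rewrite expr2.
  by rewrite eigu// d1 mulr1.
have upos : 0 < I2 Omega (fun x => u x ^+ 2) by rewrite u1.
have r01 : rev_ord ord0 = ord_max :> 'I_2 by apply: val_inj.
have r10 : rev_ord ord_max = ord0 :> 'I_2 by apply: val_inj.
have [c0 c0p [h2 h2p low0]] := moments_lower r01 r10 mesh1 H0u reg upos.
have [c1 c1p [h3 h3p low1]] := moments_lower r10 r01 mesh1 H0u reg upos.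
(* (2 / N) times the sums of the products of moments is at least k * h^2. *)
pose k := 3 / 2 * (c0 + c1).
have kp : 0 < k by rewrite mulr_gt0// ?divr_gt0// addr_gt0.
(* A bound for lam_ h, valid for h < 1 by [lamh_le]. *)
pose Lam := `|2 * lam + 2 * C| + 1.
have Lp : 0 < Lam by rewrite ltr_wpDl.
pose e := k / (4 * Lam).
have ep : 0 < e by rewrite divr_gt0// mulr_gt0.
have eS : 2 * Lam * e <= k / 2.
  by rewrite le_eqVlt; apply/orP; left; apply/eqP; rewrite /e; field; rewrite gt_eqF.
have [h4 h4p cons] := consistency mesh1 H0u ep.
have Dp : 0 < Lam * C ^+ 2 + 1 by rewrite ltr_wpDl// mulr_ge0 ?sqr_ge0// ltW.
pose h5 := k / 2 / (Lam * C ^+ 2 + 1).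
have h5p : 0 < h5 by rewrite !divr_gt0.
exists (Num.min (Num.min (Num.min h2 h3) (Num.min h4 h5)) 1); first by rewrite !lt_min h2p h3p h4p h5p ltr01.
move=> h Hh; rewrite !lt_min => /andP[/andP[/andP[hh2 hh3] /andP[hh4 hh5]] hh1].
have m := mesh _ Hh; have hp := mesh_h0 m.
have [P mp] := morley_pieceP (eig_h _ Hh) (u_h_norm _ Hh).
have l0 := lamh_ge0 m mp.
have lL : lam_ h <= Lam.
  apply: le_trans (lamh_le m reg mp) _; rewrite lamE.
  have s1 : 2 * lam + 2 * dot_hess_h h (T_ h) (u \- u_ h) (u \- u_ h) <= 2 * lam + 2 * C.
    rewrite lerD2l ler_wpM2l//; apply: le_trans (err_hess _ Hh) _.
    by rewrite ger_pMr// expr_le1// ltW.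
  by apply: (le_trans s1); rewrite (le_trans (ler_norm _))// lerDl.
have low : (c0 + c1) * h ^+ 6 <= \sum_(i < 2) \sum_(c <- T_ h)
    mom i h c (U Omega u [:: i; i]) * mom (rev_ord i) h c (U Omega u [:: i; rev_ord i]).
  rewrite (sum_ord2 ord0) r01 r10 mulrDl; exact: lerD (low0 _ _ m hh2) (low1 _ _ m hh3).
have nS : normL2 Omega (u \- u_ h) ^+ 2 <= C ^+ 2 * h ^+ 4.
  rewrite (_ : C ^+ 2 * h ^+ 4 = (C * h ^+ 2) ^+ 2); last by rewrite exprMn -exprM.
  by rewrite lerXn2r ?nnegrE ?err_L2 ?sqrtr_ge0// mulr_ge0 ?sqr_ge0// ltW.
have hS : h * (Lam * C ^+ 2 + 1) <= k / 2 by rewrite -ler_pdivlMr// ltW.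
have := eigenvalue_gap m reg mp u1 (cons _ _ m hh4 _ _ _ mp) low.
rewrite lamE -/k => gap.
have := small_mesh_arith hp l0 lL kp C_gt0 eS (ltW ep) nS hh1 hS gap.
by rewrite subr_ge0.
Qed.
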